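(* Let $\mathbb{F}\colon\mathbb{R}^d\to\mathbb{R}^d$ have a zero $x_\star$, i.e. $\mathbb{F}(x_\star)=0$, and let $\mathbb{F}(\cdot;\xi)$ be a jointly measurable stochastic oracle such that, for some $\sigma>0$ and $L>0$: for every $x\in\mathbb{R}^d$, $\mathbb{E}[\mathbb{F}(x;\xi)]=\mathbb{F}(x)$ and $\mathbb{E}[\|\mathbb{F}(x;\xi)-\mathbb{F}(x)\|^2]\le\sigma^2$; and almost surely $\mathbb{F}(\cdot;\xi)$ is monotone and $L$-Lipschitz on $\mathbb{R}^d$. For each sampled $\xi$, $\mathbb{F}(\cdot;\xi)$ can be evaluated at multiple points. Let $\epsilon>0$ and let $x_0\in\mathbb{R}^d$ satisfy $\|x_0-x_\star\|\le D$. Set $$N=\max\left\{2,\left\lceil\frac{32LD}{\epsilon}\right\rceil\right\},\qquad \rho_k=\frac{1}{2N^3},\qquad B_k=\max\left\{1,\left\lceil\frac{1024\,\sigma^2}{\epsilon^2(N-k)}\sqrt{\log(eN)\,\log\left(\frac{eN}{N-k}\right)}\right\rceil\right\}$$ for $k=0,\dots,N-1$, and let $\mathbb{T}_k$ be the random map computed by the approximate resolvent procedure (defined in the context) with sample budget $B_k$, tolerance $\rho_k$, $\alpha=\frac{1}{2L}$ and $\gamma_j=\frac{2}{j+2}$, using fresh independent samples for each $k$. Let $$x_{k+1}=x_k+\frac{N-k-1}{N-k}\left(\mathbb{T}_k(x_k)-\mathbb{T}_{k-1}(x_{k-1})\right),\qquad k=0,\dots,N-2,\qquad \mathbb{T}_{-1}(x_{-1}):=x_0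 .$$ Then the final output $y_N=\mathbb{T}_{N-1}(x_{N-1})$ attains $$\mathbb{E}\left[\|\mathbb{F}(y_N)\|^2\right]\le\epsilon^2$$ using $$\mathcal{O}\!\left(\left(1+\frac{LD}{\epsilon}\right)\log\left(1+\frac{LD}{\epsilon}\right)+\frac{\sigma^2}{\epsilon^2}\log^2\left(1+\frac{LD}{\epsilon}\right)\right)$$ operator evaluations (evaluations of the sample operators $\mathbb{F}(\cdot;\xi)$).
   Context: $\|\cdot\|$ is the Euclidean norm. An operator $\mathbb{G}\colon\mathbb{R}^d\to\mathbb{R}^d$ is monotone if $\langle\mathbb{G}(x)-\mathbb{G}(y),x-y\rangle\ge0$ for all $x,y$, and $L$-Lipschitz if $\|\mathbb{G}(x)-\mathbb{G}(y)\|\le L\|x-y\|$ for all $x,y$. Approximate resolvent procedure. Given input $u\in\mathbb{R}^d$, integer sample budget $B_k\ge1$, tolerance $\rho_k\in(0,1]$, and parameters $\alpha,\gamma_j$: set $w_0=u$. For $j=0,\dots,B_k-1$: draw a fresh sample $\xi_j$ (independent of all previously drawn samples, within and across the indices $k$); set $p_j=(1-\gamma_j)w_j+\gamma_ju$, $q_0=p_j$, and $m_{k,j}=\left\lceil\frac{\log(16/\rho_k)}{\log(j+2)}\right\rceil$; for $r=0,\dots,m_{k,j}$ set $q_{r+1}=p_j-\alpha\gamma_j\mathbb{F}(q_r;\xi_j)$; set $w_{j+1}=q_{m_{k,j}+1}$. The output is $\mathbb{T}_k(u)=w_{B_k}$. Thus one evaluation of $\mathbb{T}_k$ uses $\sum_{j=0}^{B_k-1}(m_{k,j}+1)$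 evaluations of sample operators. Each $\mathbb{T}_k$ is evaluated once (at $x_k$), and $\mathbb{T}_{k-1}(x_{k-1})$ is reused from the previous step.
   Formalization: The O(...) bound on operator evaluations is stated for LD/ε ≥ c0, with a constant depending only on the arbitrary c0 > 0; with one constant for all parameters it fails (for D = 0 the bound is 0 but evaluations are made). *)

(* Defs.v *)
From HB Require Import structures.
From mathcomp Require Import all_boot all_order all_algebra.
From mathcomp Require Import all_classical all_reals all_analysis.

Set Implicit Arguments.
Unset Strict Implicit.
Unset Printing Implicit Defensive.

Import Order.TTheory GRing.Theory Num.Theory.
Import numFieldNormedType.Exports.

Local Open Scope classical_set_scope.
Local Open Scope ring_scope.

(* The library gives [n.-tuple T] the product sigma-algebra but equips row
   vectors with none.  This is the same construction on 'rV[R]_n: the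
   sigma-algebra generated by the coordinates, i.e. the Borel one of R^n. *)
Section measurable_rV.
Context {R : realType} (n : nat).

Let coors : 'I_n -> 'rV[R]_n -> measurableTypeR R := fun i x => x ord0 i.

Let rV_set0 : g_sigma_preimage coors set0.
Proof. exact: sigma_algebra0. Qed.

Let rV_setC A : g_sigma_preimage coors A -> g_sigma_preimage coors (~` A).
Proof. exact: sigma_algebraC. Qed.

Let rV_bigcup (A : (set 'rV[R]_n)^nat) :
  (forall i, g_sigma_preimage coors (A i)) ->
  g_sigma_preimage coors (\bigcup_i (A i)).
Proof. exact: sigma_algebra_bigcup. Qed.

HB.instance Definition _ := @isMeasurable.Build default_measure_display
  'rV[R]_n (g_sigma_preimage coors) rV_set0 rV_setC rV_bigcup.

End measurable_rV.

Section operators.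
Context {R : realType} {n : nat}.
Implicit Types (u v x y : 'rV[R]_n) (G : 'rV[R]_n -> 'rV[R]_n).

Definition edot u v : R := \sum_(i < n) u ord0 i * v ord0 i.

(* The library's norm `|u| on 'rV[R]_n is the sup norm. *)
Definition enorm u : R := Num.sqrt (edot u u).

Definition monotone_op G := forall x y, 0 <= edot (G x - G y) (x - y).

Definition lipschitz_op (L : R) G :=
  forall x y, enorm (G x - G y) <= L * enorm (x - y).

End operators.

Section independence.
Context {dO dX : measure_display} {Omega : measurableType dO}
  {Xi : measurableType dX} {R : realType}.

Definition mutually_independent (P : probability Omega R) (I : eqType)
    (D : set I) (X : I -> Omega -> Xi) :=
  forall s : seq I, uniq s -> (forall i, i \in s -> D i) ->
  forall A : I -> set Xi, (forall i, measurable (A i)) ->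
    P [set w | forall i, i \in s -> A i (X i w)] =
    (\prod_(i <- s) P (X i @^-1` A i))%E.

Definition has_law (P : probability Omega R) (mu : probability Xi R)
    (X : Omega -> Xi) :=
  forall A : set Xi, measurable A -> P (X @^-1` A) = mu A.

End independence.

Section resolvent.
Context {R : realType} {n : nat} {Xi : Type}.
Variable G : 'rV[R]_n -> Xi -> 'rV[R]_n.

(* |.|%N turns the int-valued ceiling into a nat; for 0 < rho <= 1 the
   ceiling is nonnegative, so nothing is lost. *)
Definition inner_iters (rho : R) (j : nat) : nat :=
  `|Num.ceil (ln (16 / rho) / ln (j + 2)%:R)|%N.

Definition inner_step (rho alpha gamma : R) (z : Xi) (j : nat)
    (u w : 'rV[R]_n) : 'rV[R]_n :=
  let p := (1 - gamma) *: w + gamma *: u in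
  iter (inner_iters rho j).+1 (fun q => p - (alpha * gamma) *: G q z) p.

Fixpoint approx_resolvent (B : nat) (rho alpha : R) (gamma : nat -> R)
    (z : nat -> Xi) (u : 'rV[R]_n) : 'rV[R]_n :=
  if B is j.+1 then
    inner_step rho alpha (gamma j) (z j) j u
      (approx_resolvent j rho alpha gamma z u)
  else u.

End resolvent.

(* Sample-operator evaluations spent by one call of [approx_resolvent]. *)
Definition resolvent_evals {R : realType} (B : nat) (rho : R) : nat :=
  (\sum_(j < B) (inner_iters rho j).+1)%N.

(* State after k steps: the pair (x_k, T_(k-1)(x_(k-1))), where
   T_(-1)(x_(-1)) := x_0.  Each T_k is thus evaluated once, at x_k, and y_N is
   the second component at k = N. *)
Fixpoint outer_iter {R : realType} {n : nat} (N : nat)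
    (T : nat -> 'rV[R]_n -> 'rV[R]_n) (x0 : 'rV[R]_n) (k : nat) :
    'rV[R]_n * 'rV[R]_n :=
  if k is k'.+1 then
    let: (x, t) := outer_iter N T x0 k' in
    let t' := T k' x in
    (x + ((N - k' - 1)%:R / (N - k')%:R) *: (t' - t), t')
  else (x0, x0).

Section parameters.
Context {R : realType}.
Variables (L D sigma eps : R).

Definition horizon : nat := maxn 2 `|Num.ceil (32 * L * D / eps)|%N.

Definition tolerance : R := 1 / (2 * horizon%:R ^+ 3).

Definition budget (k : nat) : nat :=
  let e := expR 1 in
  let N := horizon%:R in
  let i := (horizon - k)%:R in
  maxn 1 `|Num.ceil (1024 * sigma ^+ 2 / (eps ^+ 2 * i) *
                     Num.sqrt (ln (e * N) * ln (e * N / i)))|%N.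

Definition stepsize : R := 1 / (2 * L).

Definition gamma_seq (j : nat) : R := 2 / (j + 2)%:R.

Definition drawn : set (nat * nat) :=
  [set kj | (kj.1 < horizon)%N /\ (kj.2 < budget kj.1)%N].

Definition total_evals : nat :=
  (\sum_(k < horizon) resolvent_evals (budget k) tolerance)%N.

(* y_N as a function of the samples z k j *)
Definition final_output {n : nat} {Xi : Type}
    (G : 'rV[R]_n -> Xi -> 'rV[R]_n) (x0 : 'rV[R]_n)
    (z : nat -> nat -> Xi) : 'rV[R]_n :=
  (outer_iter horizon
     (fun k => approx_resolvent G (budget k) tolerance stepsize gamma_seq (z k))
     x0 horizon).2.

End parameters.

(* Main.v *)
Require Import Defs.
From HB Require Import structures.
From mathcomp Require Import all_boot all_order all_algebra.
From mathcomp Require Import all_classical all_reals all_analysis.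
From mathcomp Require Import measurable_realfun ring lra zify.

Set Implicit Arguments.
Unset Strict Implicit.
Unset Printing Implicit Defensive.

Import Order.TTheory GRing.Theory Num.Theory.
Import numFieldNormedType.Exports.

Local Open Scope classical_set_scope.
Local Open Scope ring_scope.

(* Write A = F/(2L), J = (I + A)^-1 and u = eps^2/(1024 L^2).  An inner step solves
   w' + gamma A_z(w') = p up to a defect proportional to rho, so one call of T_k
   is a stochastic Halpern-type iteration for J, of mean square error c_k = O(1/B_k)
   up to multiples of rho, and it is nonexpansive up to a small random drift.

   Let v = x_(N-1) and t = J v.  Because the outer momentum is (N-k-1)/(N-k), an
   exact identity telescopes to
     |v-t|^2 / 2 + sum_k w_k |x_k - v|^2 <= 2 D^2/N^2 + sum_k w_k |z_(k+1) - t|^2,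
   with w_k = 1/((N-k)(N-k-1)) and z_(k+1) = T_k(x_k).  The mean of
   |z_(k+1) - t|^2 has to be compared with that of |x_k - v|^2, but t depends on the
   samples of step k.  Resampling those samples gives independent copies of z_(k+1)
   and t; nearly nonexpansive maps carry a change of z_(k+1) to a change of t of at
   most the same size plus drift, so the dependence costs only O(c_k).  The budgets
   make sum_k w_k c_k = O(u), whence E|v - J v|^2 <= 116 u.  Finally
   F(J v) = 2L (v - J v), and y_N = T_(N-1)(v) is within O(u) of J v in mean square. *)

(** * Euclidean inner product and norm *)

(** The pathwise identity holds for arbitrary maps T_k; probability enters only when |z_(k+1) - t|^2
    is averaged. There z_(k+1) and t fluctuate together, and passing to the crossed pairs (z, t'),
    (z', t) leaves -2 <z - z', t - t'>. Both factors have mean square O(c_k) up to rho and drift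
    terms, hence the second-order price. The given probability space may have no room for
    independent copies, so the run is transported to the space of sample paths, whose square and
    cube carry them. The budgets balance two sums. Put l = log(eN) and t_k = log(eN/(N-k)). Then w_k
    c_k is at most of order u / ((N-k-1) sqrt(l t_k)), while one call costs at most a multiple of l
    (B_k / t_k + exp(t_k / 2)). Error and cost are thus both governed by the sum of 1 / (i
    sqrt(log(eN/i))), which telescopes to O(sqrt l): total error O(u), total cost O(l N + l^2
    sigma^2 / eps^2). The tolerance is cubic in 1/N because second moments may reach order N^2 u:
    times rho they are O(u/N). The almost sure hypotheses on the oracle are made sure by zeroing it
    on one null set of samples. *)

Section euclid.
Context {R : realType} {n : nat}.
Implicit Types (x y z u v w : 'rV[R]_n) (a b c : R).

Lemma edotC x y : edot x y = edot y x.
Proof. by apply: eq_bigr => i _; rewrite mulrC. Qed.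

Lemma edotDl x y z : edot (x + y) z = edot x z + edot y z.
Proof. by rewrite -big_split; apply: eq_bigr => i _; rewrite mxE mulrDl. Qed.

Lemma edotZl a x y : edot (a *: x) y = a * edot x y.
Proof. by rewrite mulr_sumr; apply: eq_bigr => i _; rewrite mxE mulrA. Qed.

Lemma edotNl x y : edot (- x) y = - edot x y.
Proof. by rewrite -scaleN1r edotZl mulN1r. Qed.

Lemma edotDr x y z : edot x (y + z) = edot x y + edot x z.
Proof. by rewrite edotC edotDl !(edotC x). Qed.

Lemma edotZr a x y : edot x (a *: y) = a * edot x y.
Proof. by rewrite edotC edotZl edotC. Qed.

Lemma edotNr x y : edot x (- y) = - edot x y.
Proof. by rewrite edotC edotNl edotC. Qed.

Definition edotE := (edotDl, edotDr, edotNl, edotNr, edotZl, edotZr).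

Lemma edot_ge0 x : 0 <= edot x x.
Proof. by apply: sumr_ge0 => i _; rewrite -expr2 sqr_ge0. Qed.

Lemma enorm_ge0 x : 0 <= enorm x.
Proof. exact: sqrtr_ge0. Qed.

Lemma sqr_enorm x : enorm x ^+ 2 = edot x x.
Proof. by rewrite sqr_sqrtr // edot_ge0. Qed.

Lemma enorm_eq0 x : (enorm x == 0) = (x == 0).
Proof.
rewrite sqrtr_eq0; apply/idP/eqP => [xx0|->]; last first.
  by rewrite /edot big1 // => i _; rewrite mxE mul0r.
have /eqP : edot x x = 0 by apply/eqP; rewrite eq_le xx0 edot_ge0.
rewrite psumr_eq0 => [/allP xx|i _]; last by rewrite -expr2 sqr_ge0.
apply/rowP => i; rewrite mxE; apply/eqP.
by have := xx i (mem_index_enum _); rewrite -expr2 sqrf_eq0.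
Qed.

Lemma enorm0 : enorm (0 : 'rV[R]_n) = 0.
Proof. by apply/eqP; rewrite enorm_eq0. Qed.

Lemma enormZ a x : enorm (a *: x) = `|a| * enorm x.
Proof.
by rewrite /enorm edotZl edotZr mulrA -expr2 sqrtrM ?sqr_ge0 // sqrtr_sqr.
Qed.

Lemma enormN x : enorm (- x) = enorm x.
Proof. by rewrite -scaleN1r enormZ normrN1 mul1r. Qed.

Lemma enorm_distC x y : enorm (x - y) = enorm (y - x).
Proof. by rewrite -enormN opprB. Qed.

Lemma edot_le_enorm x y : edot x y <= enorm x * enorm y.
Proof.
have [/eqP|x0] := eqVneq (enorm x) 0.
  rewrite enorm_eq0 => /eqP ->; rewrite enorm0 mul0r.
  by rewrite /edot big1 // => i _; rewrite mxE mul0r.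
have [/eqP|y0] := eqVneq (enorm y) 0.
  rewrite enorm_eq0 => /eqP ->; rewrite enorm0 mulr0.
  by rewrite /edot big1 // => i _; rewrite mxE mulr0.
have xy : 0 < enorm x * enorm y.
  by rewrite mulr_gt0 // lt_neqAle eq_sym ?x0 ?y0 enorm_ge0.
have := edot_ge0 (enorm y *: x - enorm x *: y).
rewrite !edotE -!sqr_enorm (edotC y x) => h.
rewrite -(ler_pM2l xy); nra.
Qed.

Lemma le_enormP x y : (enorm x <= enorm y) = (edot x x <= edot y y).
Proof. by rewrite -!sqr_enorm ler_sqr ?nnegrE ?enorm_ge0. Qed.

Lemma ler_enormD x y : enorm (x + y) <= enorm x + enorm y.
Proof.
rewrite -ler_sqr ?nnegrE ?addr_ge0 ?enorm_ge0 // sqr_enorm !edotE -!sqr_enorm.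
have := edot_le_enorm x y; rewrite (edotC y x); nra.
Qed.

Lemma ler_enormB x y : enorm (x - y) <= enorm x + enorm y.
Proof. by rewrite -(enormN y) ler_enormD. Qed.

Lemma enormD_sqr_le x y : enorm (x + y) ^+ 2 <= 2 * (enorm x ^+ 2 + enorm y ^+ 2).
Proof. by have := edot_ge0 (x - y); rewrite !sqr_enorm !edotE; lra. Qed.

Lemma enorm_sqr_triangle y x z :
  enorm (x - z) ^+ 2 <= 2 * (enorm (x - y) ^+ 2 + enorm (y - z) ^+ 2).
Proof. by rewrite -[x - z](subrKA y); exact: enormD_sqr_le. Qed.

(** The free weight matters: for a perturbation y of size k, both excess terms are of order k. *)
Lemma enorm_sqr_young k x y : 0 < k ->
  enorm (x + y) ^+ 2 <= (1 + k) * enorm x ^+ 2 + (1 + k^-1) * enorm y ^+ 2.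
Proof.
move=> k0; have := edot_ge0 (k *: x - y).
rewrite !sqr_enorm !edotE (edotC y x) => h.
rewrite -(ler_pM2l k0).
have -> : k * ((1 + k) * edot x x + (1 + k^-1) * edot y y) =
   (k + k ^+ 2) * edot x x + (k + 1) * edot y y.
  by field; rewrite gt_eqF.
nra.
Qed.

Lemma enorm_sqr_convex a x y : 0 <= a <= 1 ->
  enorm ((1 - a) *: x + a *: y) ^+ 2 <=
  (1 - a) * enorm x ^+ 2 + a * enorm y ^+ 2.
Proof.
move=> /andP[a0 a1]; have := edot_ge0 (x - y).
rewrite !sqr_enorm !edotE (edotC y x) => h.
have := mulr_ge0 (mulr_ge0 a0 (_ : 0 <= 1 - a)) h.
rewrite subr_ge0 => /(_ a1); nra.
Qed.

(** Bias-variance decomposition around the weighted mean m: the linear terms cancel since the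
    weights sum to 1, and the nonnegative variance is dropped. *)
Lemma enorm_sqr_jensen (I : Type) (r : seq I) (a : I -> R) (f : I -> 'rV[R]_n) y :
  (forall i, 0 <= a i) -> \sum_(i <- r) a i = 1 ->
  enorm (\sum_(i <- r) a i *: f i - y) ^+ 2 <=
  \sum_(i <- r) a i * enorm (f i - y) ^+ 2.
Proof.
move=> a0 a1; pose m := \sum_(i <- r) a i *: f i.
have edot_suml (g : I -> 'rV[R]_n) z :
    edot (\sum_(i <- r) g i) z = \sum_(i <- r) edot (g i) z.
  elim/big_rec2: _ => [|i s t _ <-]; last by rewrite edotDl.
  by rewrite /edot big1 // => i _; rewrite mxE mul0r.
have : 0 <= \sum_(i <- r) a i * enorm (f i - m) ^+ 2.
  by apply: sumr_ge0 => i _; rewrite mulr_ge0 ?sqr_ge0.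
have dec i : a i * enorm (f i - y) ^+ 2 = a i * enorm (f i - m) ^+ 2
    + 2 * edot (a i *: f i) (m - y)
    + a i * (edot (m - y) (m - y) - 2 * edot m (m - y)).
  by rewrite !sqr_enorm !edotE !(edotC _ (f i)) !(edotC y m); ring.
rewrite (eq_bigr _ (fun i _ => dec i)) !big_split/= -mulr_suml a1 mul1r.
rewrite -mulr_sumr -edot_suml -/m sqr_enorm; lra.
Qed.

Lemma enorm_sum_le (I : Type) (r : seq I) (f : I -> 'rV[R]_n) :
  enorm (\sum_(i <- r) f i) <= \sum_(i <- r) enorm (f i).
Proof.
elim/big_rec2: _ => [|i y x _ h]; first by rewrite enorm0.
by apply: le_trans (ler_enormD _ _) _; rewrite lerD2l.
Qed.

Lemma coord_le_enorm x i : `|x ord0 i| <= enorm x.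
Proof.
rewrite -ler_sqr ?nnegrE ?enorm_ge0 ?normr_ge0 // sqr_enorm real_normK ?num_real //.
rewrite /edot (bigD1 i) //= -expr2 lerDl.
by apply: sumr_ge0 => j _; rewrite -expr2 sqr_ge0.
Qed.

End euclid.

(** * Resolvents *)

Section resolvent_theory.
Context {R : realType} {n : nat}.
Implicit Types (x y z u v w : 'rV[R]_n).

(** Nonexpansiveness of (I + g A)^-1, phrased without an inverse so that it also compares points
    solving their equations only approximately. *)
Lemma monotone_op_expansive (A : 'rV[R]_n -> 'rV[R]_n) (g : R) x y :
  monotone_op A -> 0 <= g ->
  enorm (x - y) <= enorm (x + g *: A x - (y + g *: A y)).
Proof.
move=> mA g0; have [->|xy] := eqVneq x y; first by rewrite !subrr.
have xy0 : 0 < enorm (x - y).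
  by rewrite lt_neqAle enorm_ge0 eq_sym enorm_eq0 subr_eq0 xy.
rewrite -(ler_pM2l xy0) -expr2; apply: le_trans (edot_le_enorm _ _).
rewrite sqr_enorm opprD addrACA -scalerBr [leRHS]edotDr edotZr lerDl.
by rewrite mulr_ge0 // edotC; exact: mA.
Qed.

(** This is (I + A)^-1 v, reached by Picard iteration when A is 1/2-Lipschitz. Being an explicit
    pointwise limit, it is measurable in v as soon as A is measurable. *)
Definition resolvent (A : 'rV[R]_n -> 'rV[R]_n) v : 'rV[R]_n :=
  \row_i limn (fun m => iter m (fun q => v - A q) 0 ord0 i).

Section contraction.
Variable A : 'rV[R]_n -> 'rV[R]_n.
Hypothesis lA : lipschitz_op (1 / 2) A.

Let q v m := iter m (fun q => v - A q) 0.

Lemma cvg_enorm0 (f : nat -> 'rV[R]_n) :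
  (forall i, f m ord0 i @[m --> \oo] --> 0) -> enorm (f m) @[m --> \oo] --> 0.
Proof.
move=> f0; have : edot (f m) (f m) @[m --> \oo] --> 0.
  rewrite /edot; elim: (index_enum _) => [|i s ih].
    by under eq_fun do rewrite big_nil; exact: cvg_cst.
  under eq_fun do rewrite big_cons.
  have := cvgD (cvgM (f0 i) (f0 i)) ih.
  by rewrite mulr0 addr0; apply.
by move=> /(continuous_cvg _ (@sqrt_continuous R 0)); rewrite sqrtr0.
Qed.

Lemma enorm_picard v m : enorm (q v m.+1 - q v m) <= (1 / 2) ^+ m * enorm (q v 1).
Proof.
elim: m => [|m ih]; first by rewrite expr0 mul1r subr0.
rewrite [q v m.+2]/= [q v m.+1 in X in _ - X]/= -/(q v m.+1) -/(q v m).
rewrite opprB addrC addrA subrK enorm_distC exprS -mulrA.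
by apply: le_trans (lA _ _) _; rewrite ler_pM2l.
Qed.

Lemma is_cvg_picard v i : cvgn (fun m => q v m ord0 i).
Proof.
set C := enorm (q v 1).
have step m : `|q v m.+1 ord0 i - q v m ord0 i| <= (1 / 2) ^+ m * C.
  apply: le_trans (enorm_picard v m).
  by apply: le_trans (coord_le_enorm _ i); rewrite !mxE.
have half m : (1 / 2) ^+ m.+1 = (1 / 2) ^+ m / 2 :> R by rewrite exprSr mul1r.
(* Twice the last increment bound is the remaining geometric tail. Subtracting or adding it gives
   monotone sequences that bracket the coordinate, so monotone convergence applies. *)
pose lo m := q v m ord0 i - 2 * ((1 / 2) ^+ m * C).
pose up m := q v m ord0 i + 2 * ((1 / 2) ^+ m * C).
have lo_nd : nondecreasing_seq lo.
  apply/nondecreasing_seqP => m; rewrite /lo half.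
  by have := step m; rewrite ler_norml => /andP[]; lra.
have up_ni : nonincreasing_seq up.
  apply/nonincreasing_seqP => m; rewrite /up half.
  by have := step m; rewrite ler_norml => /andP[]; lra.
have lo_cvg : cvgn lo.
  apply: nondecreasing_is_cvgn => //; exists (up 0%N) => _ [m _ <-].
  apply: (@le_trans _ _ (up m)); last exact: up_ni.
  have : 0 <= (1 / 2) ^+ m * C by rewrite mulr_ge0 ?exprn_ge0 ?enorm_ge0.
  by rewrite /lo /up; lra.
have -> : (fun m => q v m ord0 i) = (fun m => lo m + 2 * C * (1 / 2) ^+ m).
  by apply/funext => m; rewrite /lo; ring.
apply: is_cvgD => //; apply: is_cvgM; first exact: is_cvg_cst.
apply/cvg_ex; exists 0; apply: cvg_expr.
by rewrite ger0_norm //; lra.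
Qed.

Lemma cvg_picard v i : q v m ord0 i @[m --> \oo] --> resolvent A v ord0 i.
Proof. by rewrite mxE; exact: is_cvg_picard. Qed.

Lemma resolventK v : resolvent A v + A (resolvent A v) = v.
Proof.
set y := resolvent A v.
have qy : enorm (q v m - y) @[m --> \oo] --> 0.
  apply: cvg_enorm0 => i.
  rewrite (_ : (fun m => _) = (fun m => q v m ord0 i - y ord0 i)); last first.
    by apply/funext => m; rewrite !mxE.
  rewrite (_ : 0 = y ord0 i - y ord0 i); last by rewrite subrr.
  by apply: cvgB; [exact: cvg_picard|exact: cvg_cst].
have qSy : enorm (q v m.+1 - y) @[m --> \oo] --> 0 by rewrite (cvg_shiftS (fun m => enorm (q v m - y))).
apply/eqP; rewrite -subr_eq0 -enorm_eq0 eq_le enorm_ge0 andbT.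
have h : enorm (q v m.+1 - y) + 1 / 2 * enorm (q v m - y) @[m --> \oo]
    --> (0 + 1 / 2 * 0 : R).
  by apply: cvgD => //; apply: cvgM => //; exact: cvg_cst.
rewrite mulr0 addr0 in h; apply: (ler_cvg_to (cvg_cst _) h).
apply: nearW => m.
(* Since q_(m+1) = v - A q_m, the defect of the limit is a difference of quantities that tend to
   0. *)
rewrite (_ : y + _ - v = (A y - A (q v m)) - (q v m.+1 - y)); last first.
  rewrite [q v m.+1]/= -/(q v m) opprB opprB.
  by apply/rowP => i; rewrite !mxE; ring.
apply: le_trans (ler_enormB _ _) _; rewrite addrC lerD2l.
by rewrite enorm_distC; exact: lA.
Qed.

Hypothesis mA : monotone_op A.

Lemma resolvent_nonexpansive u v :
  enorm (resolvent A u - resolvent A v) <= enorm (u - v).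
Proof.
rewrite -[in leRHS](resolventK u) -[in leRHS](resolventK v).
by have := monotone_op_expansive (resolvent A u) (resolvent A v) mA ler01; rewrite !scale1r.
Qed.

Lemma resolvent_zero x : A x = 0 -> resolvent A x = x.
Proof.
move=> Ax; apply/eqP; rewrite -subr_eq0 -enorm_eq0 eq_le enorm_ge0 andbT.
have := monotone_op_expansive (resolvent A x) x mA ler01.
by rewrite !scale1r Ax addr0 resolventK subrr enorm0.
Qed.

(** Because v - J v = A (J v), this is monotonicity between J v and the zero x. *)
Lemma resolvent_firm x v : A x = 0 ->
  0 <= edot (v - resolvent A v) (resolvent A v - x).
Proof.
move=> Ax; rewrite -[X in edot (X - _) _](resolventK v) addrAC subrr add0r.
by have := mA (resolvent A v) x; rewrite Ax subr0.
Qed.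

(** In the expansion of |v - x|^2 around J v, the cross term is nonnegative by [resolvent_firm]. *)
Lemma resolvent_residual_le x v : A x = 0 ->
  enorm (v - resolvent A v) <= enorm (v - x).
Proof.
move=> Ax; rewrite le_enormP; have := resolvent_firm v Ax.
set t := resolvent A v; have := edot_ge0 (t - x).
by rewrite !edotE (edotC t v) (edotC x v) (edotC x t); lra.
Qed.

End contraction.
End resolvent_theory.

(** * Measurability and means *)

Section measurable_rV_theory.
Context {R : realType} {n : nat} {d : measure_display} {T : measurableType d}.
Implicit Types (f g : T -> 'rV[R]_n).

Lemma measurable_fun_rVP f : measurable_fun setT f <->
  forall i, measurable_fun setT (fun x => f x ord0 i).
Proof.
split=> [mf i _ A mA|mf].
  rewrite (_ : (fun x => f x ord0 i) @^-1` A =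
    f @^-1` ((fun v : 'rV[R]_n => v ord0 i) @^-1` A)) //.
  apply: mf => //; apply: sub_sigma_algebra => /=.
  rewrite -bigcup_seq/=; exists i => /=; first by rewrite mem_index_enum.
  by exists A => //; rewrite setTI.
apply: (measurability (\big[setU/set0]_(i < n) preimage_set_system setT
  (fun v : 'rV[R]_n => v ord0 i) (@measurable _ (measurableTypeR R)))) => // B [C].
rewrite -bigcup_seq/= => -[i _ [A mA <-] <-].
by rewrite setTI; exact: mf.
Qed.

Lemma measurable_rVD f g : measurable_fun setT f -> measurable_fun setT g ->
  measurable_fun setT (fun x => f x + g x).
Proof.
move=> /measurable_fun_rVP mf /measurable_fun_rVP mg; apply/measurable_fun_rVP => i.
by under eq_fun do rewrite mxE; exact: measurable_funD.
Qed.

Lemma measurable_rVZ a f : measurable_fun setT f ->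
  measurable_fun setT (fun x => a *: f x).
Proof.
move=> /measurable_fun_rVP mf; apply/measurable_fun_rVP => i.
by under eq_fun do rewrite mxE; exact: measurable_funM.
Qed.

Lemma measurable_rVB f g : measurable_fun setT f -> measurable_fun setT g ->
  measurable_fun setT (fun x => f x - g x).
Proof.
move=> mf mg; apply: measurable_rVD => //.
by under eq_fun do rewrite -scaleN1r; exact: measurable_rVZ.
Qed.

Lemma measurable_edot f g : measurable_fun setT f -> measurable_fun setT g ->
  measurable_fun setT (fun x => edot (f x) (g x)).
Proof.
move=> /measurable_fun_rVP mf /measurable_fun_rVP mg.
by apply: measurable_sum => i; exact: measurable_funM.
Qed.

Lemma measurable_enorm_sqr f : measurable_fun setT f ->
  measurable_fun setT (fun x => enorm (f x) ^+ 2).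
Proof. by move=> mf; under eq_fun do rewrite sqr_enorm; exact: measurable_edot. Qed.

Lemma measurable_enorm f : measurable_fun setT f ->
  measurable_fun setT (fun x => enorm (f x)).
Proof.
move=> mf; exact: (measurableT_comp
  (continuous_measurable_fun (@sqrt_continuous R)) (measurable_edot mf mf)).
Qed.

End measurable_rV_theory.

Section measurable_resolvent.
Context {R : realType} {n : nat}.

Lemma measurable_resolvent (A : 'rV[R]_n -> 'rV[R]_n) : lipschitz_op (1 / 2) A ->
  measurable_fun setT A -> measurable_fun setT (resolvent A).
Proof.
move=> lA mA; apply/measurable_fun_rVP => i.
pose h m (v : 'rV[R]_n) := iter m (fun q => v - A q) 0 ord0 i.
apply: (@measurable_fun_cvg _ _ _ setT h (fun v => resolvent A v ord0 i)).
  move=> m; rewrite /h; apply: (measurable_fun_rVP _).1 => /=.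
  elim: m => [|m ih] /=.
    exact: measurable_cst.
  by apply: measurable_rVB => //; exact: measurableT_comp.
by move=> v _; exact: cvg_picard.
Qed.

End measurable_resolvent.

Section mean_le.
Context {R : realType} {d : measure_display} {T : measurableType d}.
Variable mu : probability T R.
Implicit Types (f g : T -> R) (r s k : R).

(** Measurability and nonnegativity travel with the bound, so means can be added and conditioned in
    [0, +oo] without separate integrability proofs; the real bound makes the mean finite. *)
Definition mean_le f r :=
  [/\ measurable_fun setT f, forall x, 0 <= f x & ('E_mu[f] <= r%:E)%E].

Lemma ge0_expectationD f g : measurable_fun setT f -> (forall x, 0 <= f x) ->
  measurable_fun setT g -> (forall x, 0 <= g x) ->
  ('E_mu[fun x => (f x + g x)%R] = 'E_mu[f] + 'E_mu[g])%E.
Proof.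
move=> mf f0 mg g0; rewrite expectation.unlock; under eq_integral do rewrite EFinD.
by rewrite ge0_integralD //; (try by move=> x _; rewrite lee_fin);
  exact/measurable_EFinP.
Qed.

Lemma ge0_expectationZl k f : 0 <= k -> measurable_fun setT f ->
  (forall x, 0 <= f x) -> ('E_mu[fun x => (k * f x)%R] = k%:E * 'E_mu[f])%E.
Proof.
move=> k0 mf f0; rewrite expectation.unlock; under eq_integral do rewrite EFinM.
by rewrite ge0_integralZl_EFin //; [move=> x _; rewrite lee_fin|exact/measurable_EFinP].
Qed.

Lemma mean_leW f r s : r <= s -> mean_le f r -> mean_le f s.
Proof.
by move=> rs [mf f0 fr]; split => //; apply: le_trans fr _; rewrite lee_fin.
Qed.

Lemma mean_le_trans f g r : measurable_fun setT f -> (forall x, 0 <= f x <= g x) ->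
  mean_le g r -> mean_le f r.
Proof.
move=> mf fg [mg g0 gr]; split => //; first by move=> x; case/andP: (fg x).
apply: le_trans gr; rewrite expectation.unlock; apply: ge0_le_integral => //.
- by move=> x _; rewrite lee_fin; case/andP: (fg x).
- exact/measurable_EFinP.
- exact/measurable_EFinP.
- by move=> x _; rewrite lee_fin; case/andP: (fg x).
Qed.

Lemma mean_le_cst r : 0 <= r -> mean_le (fun=> r) r.
Proof.
by move=> r0; split => //; rewrite (_ : (fun=> r) = cst r) // expectation_cst.
Qed.

Lemma mean_leD f g r s : mean_le f r -> mean_le g s ->
  mean_le (fun x => f x + g x) (r + s).
Proof.
move=> [mf f0 fr] [mg g0 gs]; split; first exact: measurable_funD.
  by move=> x; rewrite addr_ge0.
by rewrite ge0_expectationD // EFinD; exact: leeD.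
Qed.

Lemma mean_leZ k f r : 0 <= k -> mean_le f r -> mean_le (fun x => k * f x) (k * r).
Proof.
move=> k0 [mf f0 fr]; split; first exact: measurable_funM.
  by move=> x; rewrite mulr_ge0.
by rewrite ge0_expectationZl // EFinM; apply: lee_wpmul2l; rewrite ?lee_fin.
Qed.

Lemma mean_le_sum (I : Type) (s : seq I) (f : I -> T -> R) (r : I -> R) :
  (forall i, mean_le (f i) (r i)) ->
  mean_le (fun x => \sum_(i <- s) f i x) (\sum_(i <- s) r i).
Proof.
move=> fr; elim: s => [|i s ih].
  under eq_fun do rewrite big_nil; rewrite big_nil; exact: mean_le_cst.
by under eq_fun do rewrite big_cons; rewrite big_cons; exact: mean_leD.
Qed.

Lemma fine_meanK f r : mean_le f r -> ('E_mu[f] = (fine 'E_mu[f])%:E)%E.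
Proof.
move=> [_ f0 fr]; rewrite fineK // ge0_fin_numE; last exact: expectation_ge0.
by apply: le_lt_trans fr _; rewrite ltry.
Qed.

(** Lets an exact mean serve as its own bound, so that it can later be cancelled as a real
    number. *)
Lemma mean_le_fine f r : mean_le f r -> mean_le f (fine ('E_mu[f])%E).
Proof. by move=> fr; have [mf f0 _] := fr; split => //; rewrite -(fine_meanK fr). Qed.

Lemma fine_mean_le f r : mean_le f r -> fine ('E_mu[f])%E <= r.
Proof. by move=> fr; rewrite -lee_fin -(fine_meanK fr); case: fr. Qed.

End mean_le.

Section mean_le_transfer.
Context {R : realType} {d d' : measure_display} {T : measurableType d}
  {T' : measurableType d'}.
Variables (mu : probability T R) (nu : probability T' R).

Lemma expectation_law (phi : T -> T') (f : T' -> R) :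
  measurable_fun setT phi -> has_law mu nu phi ->
  measurable_fun setT f -> (forall y, 0 <= f y) -> ('E_mu[f \o phi] = 'E_nu[f])%E.
Proof.
move=> mphi law mf f0; rewrite expectation.unlock.
have -> : (\int[nu]_y (f y)%:E = \int[pushforward mu phi]_y (f y)%:E)%E.
  by apply: eq_measure_integral => A mA _; exact/esym/law.
by rewrite ge0_integral_pushforward //; [exact/measurable_EFinP|move=> y _; rewrite lee_fin].
Qed.

Lemma mean_le_law (phi : T -> T') (f : T' -> R) r :
  measurable_fun setT phi -> has_law mu nu phi ->
  mean_le nu f r -> mean_le mu (f \o phi) r.
Proof.
move=> mphi law [mf f0 fr]; split; [exact: measurableT_comp|by move=> x /=|].
by move: fr; rewrite -(expectation_law mphi law mf f0).
Qed.

Lemma mean_le_of_law (phi : T -> T') (f : T' -> R) r :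
  measurable_fun setT phi -> has_law mu nu phi ->
  measurable_fun setT f -> (forall x, 0 <= f x) ->
  mean_le mu (f \o phi) r -> mean_le nu f r.
Proof. by move=> mphi law mf f0 [_ _]; rewrite (expectation_law mphi law mf f0). Qed.

(* Conditioning on the first coordinate. *)
Lemma mean_le_prod (f : T * T' -> R) (h : T -> R) r :
  measurable_fun setT f -> (forall p, 0 <= f p) ->
  (forall x, mean_le nu (fun y => f (x, y)) (h x)) ->
  mean_le mu h r -> mean_le (mu \x nu)%E f r.
Proof.
move=> mf f0 fh [mh h0 hr]; split => //; rewrite expectation.unlock.
have mf' : measurable_fun setT (fun p => (f p)%:E) by exact/measurable_EFinP.
have f0' p : (0 <= (f p)%:E)%E by rewrite lee_fin.
rewrite (fubini_tonelli1 _ mf' f0').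
apply: le_trans hr; rewrite expectation.unlock; apply: ge0_le_integral => //.
- by move=> x _; apply: integral_ge0 => y _; rewrite lee_fin.
- exact: measurable_fun_fubini_tonelli_F.
- exact/measurable_EFinP.
- by move=> x _; have [_ _] := fh x; rewrite expectation.unlock.
Qed.

End mean_le_transfer.

(** * The space of samples *)

Section sample_space.
Context {I : eqType} {d : measure_display} {Xi : measurableType d}.
Implicit Types (l : seq I) (A : I -> set Xi) (J : pred I).

Definition cylinder l A : set (I -> Xi) := [set s | forall i, i \in l -> A i (s i)].

Definition cylinders (D : set I) : set (set (I -> Xi)) :=
  [set C | exists l A, [/\ forall i, i \in l -> D i,
    forall i, measurable (A i) & C = cylinder l A]].

(** Paths are measured only through the coordinates in D, because laws and independence are assumed
    for the drawn samples alone. *)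
Definition sample_space (D : set I) := g_sigma_algebraType (cylinders D).

Definition splice J (s1 s2 : I -> Xi) : I -> Xi :=
  fun i => if J i then s2 i else s1 i.

(** Makes the cylinders a pi-system, so that they determine a law on paths. *)
Lemma setI_closed_cylinders D : setI_closed (cylinders D).
Proof.
move=> _ _ [l [A [lD mA ->]]] [l' [A' [lD' mA' ->]]].
exists (l ++ l'), (fun i => (if i \in l then A i else setT) `&`
  (if i \in l' then A' i else setT)); split.
- by move=> i; rewrite mem_cat => /orP[/lD|/lD'].
- by move=> i; apply: measurableI; case: ifP => _; rewrite ?mA ?mA'.
- apply/seteqP; split=> s /=; [move=> [sl sl'] i _|move=> sll'].
    by split; case: ifPn => // il; [exact: sl|exact: sl'].
  by split=> i il; have := sll' i; rewrite mem_cat il ?orbT => /(_ isT)[].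
Qed.

Lemma measurable_fun_sampleP (D : set I) d' (T : measurableType d')
    (f : T -> sample_space D) : measurable_fun setT f <->
  forall i, D i -> measurable_fun setT (fun x => f x i).
Proof.
split=> [mf i Di _ B mB|mf].
  rewrite setTI (_ : _ @^-1` _ = f @^-1` cylinder [:: i] (fun=> B)).
    rewrite -[X in measurable X]setTI; apply: mf => //; apply: sub_sigma_algebra.
    exists [:: i], (fun=> B); split => // j; by rewrite inE => /eqP ->.
  apply/seteqP; split=> x /= => [Bx j|]; first by rewrite inE => /eqP ->.
  by apply; rewrite inE.
apply: (@measurability _ _ T (sample_space D) setT f (cylinders D)) => //.
move=> _ [_ [l [A [lD mA ->]]] <-].
rewrite setTI; elim: l lD => [_|i l ih il].
  by rewrite (_ : _ @^-1` _ = setT) //; apply/seteqP; split => // x _ i.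
rewrite (_ : _ @^-1` _ = (fun x => f x i) @^-1` A i `&` f @^-1` cylinder l A).
  apply: measurableI; last by apply: ih => j jl; apply: il; rewrite inE jl orbT.
  rewrite -[X in measurable X]setTI; apply: mf => //.
  by apply: il; rewrite inE eqxx.
apply/seteqP; split=> x /= => [h|[h1 h2] j].
  split; first by apply: h; rewrite inE eqxx.
  by move=> j jl; apply: h; rewrite inE jl orbT.
by rewrite inE => /orP[/eqP ->|/h2].
Qed.

Lemma measurable_coord (D : set I) i : D i ->
  measurable_fun setT (fun s : sample_space D => s i).
Proof. by move: i; apply/measurable_fun_sampleP; exact: measurable_id. Qed.

Lemma measurable_splice (D : set I) J :
  measurable_fun setT (fun p : sample_space D * sample_space D =>
    splice J p.1 p.2 : sample_space D).
Proof.
apply/measurable_fun_sampleP => i Di; rewrite /splice; case: (J i).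
- exact: measurableT_comp (measurable_coord Di) measurable_snd.
- exact: measurableT_comp (measurable_coord Di) measurable_fst.
Qed.

Section law.
Context {R : realType} {dO : measure_display} {Omega : measurableType dO}.
Variables (P : probability Omega R) (D : set I) (X : I -> {RV P >-> Xi}).

Definition sample_path (w : Omega) : sample_space D := fun i => X i w.

Lemma measurable_sample_path : measurable_fun setT sample_path.
Proof. by apply/measurable_fun_sampleP => i _; exact: measurable_funPT. Qed.

HB.instance Definition _ :=
  isMeasurableFun.Build _ _ _ _ sample_path measurable_sample_path.

Definition sample_law : probability (sample_space D) R :=
  distribution P (sample_path : {mfun Omega >-> sample_space D}).

Lemma sample_path_law : has_law P sample_law sample_path.
Proof. by []. Qed.

Hypothesis indep : mutually_independent P D (fun i => X i).

Lemma sample_law_cylinder l A : uniq l -> (forall i, i \in l -> D i) ->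
  (forall i, measurable (A i)) ->
  sample_law (cylinder l A) = (\prod_(i <- l) P (X i @^-1` A i))%E.
Proof. by move=> ul lD mA; rewrite -indep. Qed.

(* Resampling the coordinates in J from an independent copy preserves the law. *)
Lemma splice_law J : has_law (sample_law \x sample_law)%E sample_law
  (fun p => splice J p.1 p.2 : sample_space D).
Proof.
pose phi (p : sample_space D * sample_space D) : sample_space D := splice J p.1 p.2.
have mphi : measurable_fun setT phi by exact: measurable_splice.
pose phi' : {mfun _ >-> _} := HB.pack phi (isMeasurableFun.Build _ _ _ _ phi mphi).
move=> B mB; apply/esym; rewrite -[RHS]/(distribution (sample_law \x sample_law)%E phi' B).
apply: (@measure_unique _ _ (sample_space D) (cylinders D) (fun=> setT)) => //=.
- exact: setI_closed_cylinders.
- move=> _; exists [::], (fun=> setT); split => //.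
  by apply/seteqP; split => // s _ i.
- by apply/seteqP; split => // s _; exists 0%N.
- move=> _ [l' [A [l'D mA ->]]].
  (* [mutually_independent] speaks of duplicate-free lists. *)
  pose l := undup l'.
  have -> : cylinder l' A = cylinder l A.
    by apply/seteqP; split => s /= h i il; apply: h; move: il; rewrite mem_undup.
  have lD i : i \in l -> D i by rewrite mem_undup; exact: l'D.
  have ul : uniq l by exact: undup_uniq.
  (* The preimage of a cylinder under splicing is a rectangle: coordinates outside J constrain the
     first path, those in J the second. Its measure is the full product over l, split by J. *)
  transitivity ((sample_law \x sample_law)%E (cylinder [seq i <- l | ~~ J i] A `*`
      cylinder [seq i <- l | J i] A)); last first.
    apply: (congr1 (sample_law \x sample_law)%E).
    apply/esym/seteqP; split=> -[s1 s2] /=.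
      move=> h; split=> i; rewrite mem_filter => /andP[Ji /h];
        by rewrite /phi /splice/= ?Ji // ifN.
    move=> [h1 h2] i il; rewrite /phi /splice/=.
    by case: ifPn => Ji; [apply: h2|apply: h1]; rewrite mem_filter /= Ji.
  have mcyl l0 : {subset l0 <= l} -> @measurable _ (sample_space D) (cylinder l0 A).
    by move=> l0l; apply: sub_sigma_algebra; exists l0, A; split => // i /l0l /lD.
  rewrite product_measure1E;
    [|by apply: mcyl => i; rewrite mem_filter => /andP[]..].
  have cylE p : sample_law (cylinder [seq i <- l | p i] A) =
      (\prod_(i <- l | p i) P (X i @^-1` A i))%E.
    rewrite sample_law_cylinder ?filter_uniq ?big_filter // => i.
    by rewrite mem_filter => /andP[_ /lD].
  rewrite [LHS]sample_law_cylinder // (bigID J)/= muleC.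
  by congr (_ * _)%E; exact/esym/cylE.
- by move=> _; rewrite -[X in (X < _)%E]/(sample_law setT) probability_setT ltry.
Qed.

End law.
End sample_space.

(** * The inner loop *)

Section inner_loop.
Context {R : realType} {n : nat} {Xi : Type}.
Variables (G : 'rV[R]_n -> Xi -> 'rV[R]_n) (rho alpha : R).
Hypothesis rho01 : 0 < rho <= 1.
Hypothesis mono : forall z, monotone_op (fun x => alpha *: G x z).
Hypothesis lips : forall z, lipschitz_op (1 / 2) (fun x => alpha *: G x z).
Implicit Types (x y u v w : 'rV[R]_n) (z : Xi) (j : nat).

Local Notation gamma := (@gamma_seq R).

Lemma gamma_seq_gt0 j : 0 < gamma j.
Proof. by rewrite divr_gt0 // ltr0n addn2. Qed.

Lemma gamma_seq_le1 j : gamma j <= 1.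
Proof. by rewrite ler_pdivrMr ?mul1r ?ltr0n ?addn2 // ler_nat. Qed.

(** The Picard map of step j contracts by gamma_j / 2 = 1/(j+2), and the iteration count is the
    logarithm of 16/rho to the base j+2, rounded up. *)
Lemma inner_iters_contract j : (gamma j / 2) ^+ inner_iters rho j <= rho / 16.
Proof.
have /andP[rho0 rho1] := rho01.
have j2 : 1 < (j + 2)%:R :> R by rewrite ltr1n addn2.
have lnj : 0 < ln (j + 2)%:R :> R by rewrite ln_gt0.
have rho16 : 0 < 16 / rho by rewrite divr_gt0.
have le_m : ln (16 / rho) / ln (j + 2)%:R <= (inner_iters rho j)%:R :> R.
  apply: le_trans (ceil_ge _) _; rewrite /inner_iters natr_absz.
  by rewrite ler_int ler_norm.
have -> : gamma j / 2 = ((j + 2)%:R)^-1.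
  by rewrite /gamma_seq mulrAC divff ?mul1r ?pnatr_eq0.
have j0 : 0 < (j + 2)%:R :> R by apply: lt_trans j2.
rewrite exprVn -[leRHS]invrK lef_pV2 ?posrE ?exprn_gt0 ?invr_gt0 ?divr_gt0 //.
rewrite invf_div -ler_ln ?posrE ?exprn_gt0 // lnXn //.
by rewrite -[leRHS]mulr_natl -ler_pdivrMr.
Qed.

(** The defect of the last iterate is gamma_j times the difference of A at the last two iterates,
    and successive differences decay geometrically. The second factor gamma_j comes from the first
    Picard increment. *)
Lemma inner_step_defect z j u w (p := (1 - gamma j) *: w + gamma j *: u)
    (w' := inner_step G rho alpha (gamma j) z j u w) :
  enorm (w' + gamma j *: (alpha *: G w' z) - p) <=
  rho * gamma j ^+ 2 / 32 * enorm (alpha *: G p z).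
Proof.
set g := gamma j; have g0 : 0 < g := gamma_seq_gt0 j.
pose q r := iter r (fun x => p - (alpha * g) *: G x z) p.
pose A x := alpha *: G x z.
have qS r : q r.+1 = p - g *: A (q r) by rewrite /A scalerA (mulrC g).
have dq r : enorm (q r.+1 - q r) <= (g / 2) ^+ r * (g * enorm (A p)).
  elim: r => [|r ih].
    by rewrite qS expr0 mul1r addrC addKr enormN enormZ gtr0_norm.
  have -> : q r.+2 - q r.+1 = g *: (A (q r) - A (q r.+1)).
    by rewrite (qS r.+1) {2}(qS r) scalerBr opprB addrC addrA subrK.
  rewrite enormZ gtr0_norm //.
  apply: (@le_trans _ _ (g * (1 / 2 * enorm (q r - q r.+1)))).
    by rewrite ler_pM2l //; exact: lips.
  have -> : g * (1 / 2 * enorm (q r - q r.+1)) = g / 2 * enorm (q r.+1 - q r).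
    by rewrite enorm_distC; field.
  rewrite exprS -[leRHS]mulrA.
  by rewrite ler_pM2l // divr_gt0.
rewrite -/(q (inner_iters rho j).+1) -[w']/(q (inner_iters rho j).+1) -/(A _).
set m := inner_iters rho j.
have -> : q m.+1 + g *: A (q m.+1) - p = g *: (A (q m.+1) - A (q m)).
  by rewrite {1}(qS m) scalerBr addrAC [p - _]addrC addrK addrC.
rewrite enormZ gtr0_norm //.
apply: (@le_trans _ _ (g * (1 / 2 * ((g / 2) ^+ m * (g * enorm (A p)))))).
  by rewrite ler_pM2l //; apply: le_trans (lips _ _ _) _; rewrite ler_pM2l.
have -> : g * (1 / 2 * ((g / 2) ^+ m * (g * enorm (A p)))) =
    (g / 2) ^+ m * (g ^+ 2 / 2 * enorm (A p)).
  by move: ((g / 2) ^+ m) => e; ring.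
have -> : rho * g ^+ 2 / 32 * enorm (alpha *: G p z) =
    (rho / 16) * (g ^+ 2 / 2 * enorm (A p)) by rewrite /A; field.
apply: ler_wpM2r; last exact: inner_iters_contract.
by rewrite mulr_ge0 ?enorm_ge0 // divr_ge0 ?sqr_ge0.
Qed.

(** Both outputs solve equations with the same sampled operator up to their defects, and the
    right-hand sides p, p' differ by a convex combination of w - x and u - v. *)
Lemma inner_step_dist z j u v w x :
  enorm (inner_step G rho alpha (gamma j) z j u w -
         inner_step G rho alpha (gamma j) z j v x) <=
  (1 - gamma j) * enorm (w - x) + gamma j * enorm (u - v)
  + rho * gamma j ^+ 2 / 32 *
     enorm (alpha *: G ((1 - gamma j) *: w + gamma j *: u) z)
  + rho * gamma j ^+ 2 / 32 *
     enorm (alpha *: G ((1 - gamma j) *: x + gamma j *: v) z).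
Proof.
have := inner_step_defect z j u w; have := inner_step_defect z j v x; cbv zeta.
move: (inner_step _ _ _ _ _ _ u w) (inner_step _ _ _ _ _ _ v x) => w' x' dx dw.
have g0 := gamma_seq_gt0 j; have g1 := gamma_seq_le1 j.
have := monotone_op_expansive w' x' (mono z) (ltW g0).
move=> /le_trans; apply; move: dx dw.
move: (alpha *: G w' z) (alpha *: G x' z) => a b.
set p := (1 - _) *: w + _; set p' := (1 - _) *: x + _ => dx dw.
have -> : w' + gamma j *: a - (x' + gamma j *: b) =
    (w' + gamma j *: a - p) - (x' + gamma j *: b - p') + (p - p').
  move: (w' + _) (x' + _) (p) (p') => c c' q q'.
  by apply/rowP => i; rewrite !mxE; ring.
have h1 := ler_enormD ((w' + gamma j *: a - p) - (x' + gamma j *: b - p')) (p - p').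
have h2 := ler_enormB (w' + gamma j *: a - p) (x' + gamma j *: b - p').
have h3 : enorm (p - p') <= (1 - gamma j) * enorm (w - x) + gamma j * enorm (u - v).
  have -> : p - p' = (1 - gamma j) *: (w - x) + gamma j *: (u - v).
    by rewrite !scalerBr opprD addrACA.
  apply: le_trans (ler_enormD _ _) _; rewrite !enormZ ger0_norm ?subr_ge0 //.
  by rewrite gtr0_norm.
lra.
Qed.

(** The reference y solves the mean equation, so p - (y + gamma_j A_z y) = M - gamma_j noise. The
    noise stays inside the square so that averaging can remove its cross term with M. *)
Lemma inner_step_ref (A : 'rV[R]_n -> 'rV[R]_n) z j u v w y
    (M := (1 - gamma j) *: (w - y) + gamma j *: (u - v))
    (k := rho * gamma j ^+ 2 / 32) (noise := alpha *: G y z - A y) :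
  y + A y = v ->
  enorm (inner_step G rho alpha (gamma j) z j u w - y) ^+ 2 <=
  (1 + k) * enorm (M - gamma j *: noise) ^+ 2
  + k * (3 / 2 * enorm M ^+ 2 + 27 / 2 * enorm (v - y) ^+ 2
         + 6 * enorm noise ^+ 2).
Proof.
move=> yv; subst v; have := inner_step_defect z j u w; cbv zeta.
move: (inner_step _ _ _ _ _ _ _ _) => w'; rewrite /k /M => {k M}.
set g := gamma j; set k := rho * _ / _; set M := _ *: (w - y) + _.
set p := (1 - g) *: w + g *: u; set th := (X in enorm X <= _) => dth.
have g0 : 0 < g := gamma_seq_gt0 j; have g1 : g <= 1 := gamma_seq_le1 j.
have /andP[rho0 rho1] := rho01.
have k0 : 0 < k by rewrite divr_gt0 // mulr_gt0 // exprn_gt0.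
have k1 : k <= 1 by rewrite /k -/g; nra.
have le1 : enorm (w' - y) <= enorm (M - g *: noise + th).
  have := monotone_op_expansive w' y (mono z) (ltW g0).
  suff -> : w' + g *: (alpha *: G w' z) - (y + g *: (alpha *: G y z)) =
      M - g *: noise + th by [].
  by rewrite /th /M /noise /p; apply/rowP => i; rewrite !mxE; ring.
have le2 : enorm (w' - y) ^+ 2 <= enorm (M - g *: noise + th) ^+ 2.
  by rewrite ler_sqr ?nnegrE ?enorm_ge0.
(* Young's weight is the defect coefficient k itself: since |th| <= k |A_z p|, the second term is k
   (k + 1) |A_z p|^2, again of order k. *)
apply: le_trans le2 _; apply: le_trans (enorm_sqr_young _ _ k0) _.
rewrite lerD2l.
have Ap : enorm (alpha *: G p z) <=
    1 / 2 * enorm M + 3 / 2 * enorm (y + A y - y) + enorm noise.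
  have -> : alpha *: G p z =
      (alpha *: G p z - alpha *: G y z) + (noise + (y + A y - y)).
    by rewrite /noise; apply/rowP => i; rewrite !mxE; ring.
  apply: le_trans (ler_enormD _ _) _.
  have h1 := ler_enormD noise (y + A y - y).
  have h2 : enorm (alpha *: G p z - alpha *: G y z) <= 1 / 2 * enorm (p - y).
    exact: lips.
  have h3 : enorm (p - y) <= enorm M + g * enorm (y + A y - y).
    rewrite -[in leRHS](gtr0_norm g0) -enormZ.
    suff -> : p - y = M + g *: (y + A y - y) by exact: ler_enormD.
    by rewrite /p /M; apply/rowP => i; rewrite !mxE; ring.
  have h4 : g * enorm (y + A y - y) <= enorm (y + A y - y) by rewrite ler_piMl ?enorm_ge0.
  lra.
have th2 : enorm th ^+ 2 <= k ^+ 2 * enorm (alpha *: G p z) ^+ 2.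
  by rewrite -exprMn ler_sqr ?nnegrE ?mulr_ge0 ?enorm_ge0 // ltW.
have kk : (1 + k^-1) * k ^+ 2 = k * (k + 1) by field; rewrite gt_eqF.
apply: (@le_trans _ _ ((1 + k^-1) * (k ^+ 2 * enorm (alpha *: G p z) ^+ 2))).
  by rewrite ler_pM2l // addr_gt0 // invr_gt0.
rewrite mulrA kk -[leLHS]mulrA ler_pM2l //.
move: Ap; move: (enorm_ge0 M) (enorm_ge0 (y + A y - y)) (enorm_ge0 noise).
move: (enorm_ge0 (alpha *: G p z)).
move: (enorm (alpha *: G p z)) (enorm M) (enorm (y + A y - y)) (enorm noise).
move=> a b c e a0 b0 c0 e0 abce.
have a2 : a ^+ 2 <= (1 / 2 * b + 3 / 2 * c + e) ^+ 2.
  by rewrite ler_sqr ?nnegrE //; lra.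
have : a ^+ 2 <= 3 * (1 / 4 * b ^+ 2 + 9 / 4 * c ^+ 2 + e ^+ 2).
  apply: le_trans a2 _.
  have := sqr_ge0 (1 / 2 * b - 3 / 2 * c); have := sqr_ge0 (1 / 2 * b - e).
  have := sqr_ge0 (3 / 2 * c - e); nra.
have := sqr_ge0 a; nra.
Qed.

End inner_loop.

(** * The mean operator and the noise of the oracle *)

Section stochastic_oracle.
Context {R : realType} {n : nat} {dX : measure_display} {Xi : measurableType dX}.
Variables (mu : probability Xi R) (F : 'rV[R]_n -> 'rV[R]_n).
Variables (G : 'rV[R]_n -> Xi -> 'rV[R]_n) (L sigma : R).
Hypothesis mG : measurable_fun [set: 'rV[R]_n * Xi] (fun p => G p.1 p.2).
Hypothesis meanG : forall x i, ('E_mu[fun z => G x z ord0 i] = (F x ord0 i)%:E)%E.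
Hypothesis varG : forall x,
  ('E_mu[fun z => (enorm (G x z - F x) ^+ 2)%R] <= (sigma ^+ 2)%:E)%E.

Lemma measurable_oracle d (T : measurableType d) (f : T -> 'rV[R]_n) (zeta : T -> Xi) :
  measurable_fun setT f -> measurable_fun setT zeta ->
  measurable_fun setT (fun t => G (f t) (zeta t)).
Proof. by move=> mf mz; exact: (measurableT_comp mG (measurable_fun_pair mf mz)). Qed.

Lemma measurable_oracle2 x : measurable_fun setT (G x).
Proof.
exact: (measurable_oracle (measurable_cst x) (@measurable_id _ _ setT)).
Qed.

Lemma integrable_oracle x i : mu.-integrable setT (fun z => (G x z ord0 i)%:E).
Proof.
have mGi : measurable_fun setT (fun z => G x z ord0 i).
  by move: i; apply/measurable_fun_rVP; exact: measurable_oracle2.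
have m2 : measurable_fun setT (fun z => enorm (G x z - F x) ^+ 2).
  by apply: measurable_enorm_sqr; apply: measurable_rVB => //; exact: measurable_oracle2.
have i2 : mu.-integrable setT (fun z => (enorm (G x z - F x) ^+ 2)%:E).
  apply/integrableP; split; first exact/measurable_EFinP.
  under eq_integral do rewrite gee0_abs ?lee_fin ?sqr_ge0 //.
  by have := varG x; rewrite expectation.unlock => /le_lt_trans; apply; rewrite ltry.
(* A coordinate of G is dominated by |G - F|^2 + 1 + |F_i|, because r <= r^2 + 1. *)
have i3 : mu.-integrable setT
    (fun z => (enorm (G x z - F x) ^+ 2 + (1 + `|F x ord0 i|))%:E).
  under eq_fun do rewrite EFinD; apply: integrableD => //.
  exact: finite_measure_integrable_cst.
apply: (le_integrable _ _ _ i3) => //; first exact/measurable_EFinP.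
move=> z _; rewrite lee_fin [leRHS]ger0_norm; last first.
  by rewrite addr_ge0 ?sqr_ge0 // addr_ge0.
have h1 := coord_le_enorm (G x z - F x) i.
have h2 : `|G x z ord0 i| <= `|(G x z - F x) ord0 i| + `|F x ord0 i|.
  by rewrite !mxE -[X in `|X| <= _](subrK (F x ord0 i)) ler_normD.
by have := sqr_ge0 (enorm (G x z - F x) - 1); nra.
Qed.

Lemma mean_edot_oracle x c :
  mu.-integrable setT (fun z => (edot (G x z) c)%:E) /\
  ('E_mu[fun z => edot (G x z) c] = (edot (F x) c)%:E)%E.
Proof.
rewrite expectation.unlock /edot; elim: (index_enum _) => [|i s [ih1 ih2]].
  have E : (fun z => (\sum_(i <- [::]) G x z ord0 i * c ord0 i)%:E) = cst 0%E.
    by apply/funext => z /=; rewrite big_nil.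
  by rewrite E integral0 big_nil; split => //; exact: integrable0.
have E1 : (fun z => (G x z ord0 i * c ord0 i)%:E) =
    (fun z => (c ord0 i)%:E * (G x z ord0 i)%:E)%E.
  by apply/funext => z; rewrite mulrC EFinM.
have i1 : mu.-integrable setT (fun z => (G x z ord0 i * c ord0 i)%:E).
  by rewrite E1; apply: integrableZl => //; exact: integrable_oracle.
have E : (fun z => (\sum_(i <- i :: s) G x z ord0 i * c ord0 i)%:E) =
  (fun z => (G x z ord0 i * c ord0 i)%:E +
            (\sum_(i <- s) G x z ord0 i * c ord0 i)%:E)%E.
  by apply/funext => z /=; rewrite big_cons EFinD.
rewrite E; split; first exact: integrableD.
rewrite integralD_EFin // big_cons EFinD ih2; congr (_ + _)%E.
rewrite E1 integralZl //; last exact: integrable_oracle.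
by have := meanG x i; rewrite expectation.unlock => ->; rewrite mulrC.
Qed.

Hypothesis mono : forall z, monotone_op (G ^~ z).
Hypothesis lips : forall z, lipschitz_op L (G ^~ z).

(** A pointwise bound on a linear functional passes to the mean. Monotonicity of F follows with c =
    -(x - y), its Lipschitz bound with c = F x - F y. *)
Lemma edot_mean_oracle_le x y c r : (forall z, edot (G x z - G y z) c <= r) ->
  edot (F x - F y) c <= r.
Proof.
move=> le_r; have [ix mx] := mean_edot_oracle x c; have [iy my] := mean_edot_oracle y c.
rewrite edotDl edotNl -lee_fin EFinB -mx -my -(expectation_cst mu r).
rewrite expectation.unlock -integralB_EFin //; apply: le_integral => //.
- exact: integrableB.
- exact: finite_measure_integrable_cst.
- by move=> z _; rewrite lee_fin -edotNl -edotDl.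
Qed.

Lemma monotone_mean : monotone_op F.
Proof.
move=> x y; rewrite -oppr_le0 -edotNr.
by apply: edot_mean_oracle_le => z; rewrite edotNr oppr_le0; exact: mono.
Qed.

Lemma lipschitz_mean : lipschitz_op L F.
Proof.
move=> x y; have [->|n0] := eqVneq (enorm (F x - F y)) 0.
  (* Any sample shows that [L * enorm (x - y)] is nonnegative. *)
  by apply: le_trans (lips point x y); exact: enorm_ge0.
have n1 : 0 < enorm (F x - F y) by rewrite lt_neqAle eq_sym n0 enorm_ge0.
rewrite -(ler_pM2r n1) -expr2 sqr_enorm; apply: edot_mean_oracle_le => z.
by apply: le_trans (edot_le_enorm _ _) _; rewrite ler_pM2r //; exact: lips.
Qed.

(** The coordinates of F are parametric integrals of a jointly measurable function; Tonelli is
    applied to the positive and negative parts. *)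
Lemma measurable_mean : measurable_fun setT F.
Proof.
apply/measurable_fun_rVP => i; apply/measurable_EFinP.
pose f (p : 'rV[R]_n * Xi) := (G p.1 p.2 ord0 i)%:E.
have mf : measurable_fun setT f.
  by apply/measurable_EFinP; move: i @f; apply/measurable_fun_rVP.
rewrite (_ : EFin \o _ = fun x => (fubini_F mu (f^\+)%E x - fubini_F mu (f^\-)%E x)%E).
  apply: emeasurable_funB; apply: measurable_fun_fubini_tonelli_F => //.
  - exact: measurable_funepos.
  - exact: measurable_funeneg.
apply/funext => x /=; rewrite -meanG expectation.unlock integralE.
by congr (_ - _)%E; apply: eq_integral => z _; rewrite ?funeposE ?funenegE.
Qed.

Section scaled.
Variable alpha : R.

Let noise y z := alpha *: G y z - alpha *: F y.

Lemma mean_le_noise y : mean_le mu (fun z => enorm (noise y z) ^+ 2) ((alpha * sigma) ^+ 2).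
Proof.
rewrite exprMn; under eq_fun do rewrite /noise -scalerBr enormZ exprMn real_normK ?num_real //.
apply: mean_leZ; first exact: sqr_ge0.
split => //; last by move=> z; exact: sqr_ge0.
by apply: measurable_enorm_sqr; apply: measurable_rVB => //; exact: measurable_oracle2.
Qed.

(** The noise is centred, so its cross term with the deterministic m has mean zero. *)
Lemma mean_le_shifted_noise y m g :
  mean_le mu (fun z => enorm (m - g *: noise y z) ^+ 2)
    (enorm m ^+ 2 + g ^+ 2 * (alpha * sigma) ^+ 2).
Proof.
have [mn n0 nle] := mean_le_noise y.
have mnoise : measurable_fun setT (noise y).
  by apply: measurable_rVB => //; apply: measurable_rVZ; exact: measurable_oracle2.
split; [|by move=> z; exact: sqr_ge0|].
  by apply: measurable_enorm_sqr; apply: measurable_rVB => //; exact: measurable_rVZ.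
have [imx mx] := mean_edot_oracle y m.
have i2 : mu.-integrable setT (fun z => (enorm (noise y z) ^+ 2)%:E).
  apply/integrableP; split; first exact/measurable_EFinP.
  under eq_integral do rewrite gee0_abs ?lee_fin ?sqr_ge0 //.
  by move: nle; rewrite expectation.unlock => /le_lt_trans; apply; rewrite ltry.
(* All deterministic terms, including the share of the cross term due to F y, which cancels the mean
   of the remaining linear term in G y z. *)
pose c := enorm m ^+ 2 + 2 * g * alpha * edot (F y) m.
have E z : (enorm (m - g *: noise y z) ^+ 2)%:E =
   ((c + g ^+ 2 * enorm (noise y z) ^+ 2)%:E - (2 * g * alpha * edot (G y z) m)%:E)%E.
  rewrite -EFinB; congr EFin; rewrite /c /noise !sqr_enorm !edotE.
  by rewrite !(edotC m) (edotC (F y) (G y z)); ring.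
have ig2 : mu.-integrable setT (fun z => (g ^+ 2 * enorm (noise y z) ^+ 2)%:E).
  by under eq_fun do rewrite EFinM; exact: integrableZl.
have ic : mu.-integrable setT (fun z => (c + g ^+ 2 * enorm (noise y z) ^+ 2)%:E).
  under eq_fun do rewrite EFinD; apply: integrableD => //.
  exact: finite_measure_integrable_cst.
have ie : mu.-integrable setT (fun z => (2 * g * alpha * edot (G y z) m)%:E).
  by under eq_fun do rewrite EFinM; exact: integrableZl.
have mcst (r : R) : (\int[mu]_z r%:E = r%:E)%E.
  by have := expectation_cst mu r; rewrite expectation.unlock.
rewrite expectation.unlock; under eq_integral do rewrite E.
rewrite integralB_EFin //.
have -> : (\int[mu]_z (c + g ^+ 2 * enorm (noise y z) ^+ 2)%:E =
    c%:E + (g ^+ 2)%:E * \int[mu]_z (enorm (noise y z) ^+ 2)%:E)%E.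
  under eq_integral do rewrite EFinD.
  rewrite integralD //; last exact: finite_measure_integrable_cst.
  under [X in (_ + X)%E]eq_integral do rewrite EFinM.
  by rewrite integralZl // mcst.
have -> : (\int[mu]_z (2 * g * alpha * edot (G y z) m)%:E =
    (2 * g * alpha * edot (F y) m)%:E)%E.
  under eq_integral do rewrite EFinM.
  by rewrite integralZl //; move: mx; rewrite expectation.unlock => ->.
move: nle; rewrite expectation.unlock; move: (integral _ _ _) => e nle.
rewrite addeAC -EFinB (_ : c - _ = enorm m ^+ 2); last by rewrite /c; ring.
rewrite EFinD EFinM; apply: leeD2l.
by apply: lee_wpmul2l nle; rewrite lee_fin sqr_ge0.
Qed.

End scaled.
End stochastic_oracle.

(** * Deviation of the inexact procedure from a nonexpansive map *)

Section inner_drift.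
Context {R : realType} {n : nat} {Xi : Type}.
Variables (G : 'rV[R]_n -> Xi -> 'rV[R]_n) (rho alpha : R).
Implicit Types (z : nat -> Xi) (u v : 'rV[R]_n) (B j : nat).

Local Notation gamma := (@gamma_seq R).

Definition inner_point z u j : 'rV[R]_n :=
  (1 - gamma j) *: approx_resolvent G j rho alpha gamma z u + gamma j *: u.

(* Bounds how far [approx_resolvent] with the samples z is from a nonexpansive
   map of u: its exact counterpart is nonexpansive, and each inexact inner step
   contributes at most its defect. *)
Fixpoint inner_drift B z u : R :=
  if B is j.+1 then (1 - gamma j) * inner_drift j z u +
    gamma j * (rho * gamma j / 32 * enorm (alpha *: G (inner_point z u j) (z j)))
  else 0.

Lemma approx_resolventS B z u : approx_resolvent G B.+1 rho alpha gamma z u =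
  inner_step G rho alpha (gamma B) (z B) B u (approx_resolvent G B rho alpha gamma z u).
Proof. by []. Qed.

Lemma eq_approx_resolvent B z z' u : (forall j, (j < B)%N -> z j = z' j) ->
  approx_resolvent G B rho alpha gamma z u = approx_resolvent G B rho alpha gamma z' u.
Proof.
elim: B => [//|B ih] zz; rewrite !approx_resolventS.
rewrite (zz B (ltnSn B)) (ih (fun j jB => zz j (ltnW jB))); reflexivity.
Qed.

Lemma eq_inner_drift B z z' u : (forall j, (j < B)%N -> z j = z' j) ->
  inner_drift B z u = inner_drift B z' u.
Proof.
elim: B => [//|B ih] zz; rewrite [LHS]/= [RHS]/= /inner_point.
have zz' j : (j < B)%N -> z j = z' j by move=> jB; exact: zz (ltnW jB).
rewrite (zz B (ltnSn B)) (ih zz') (eq_approx_resolvent u zz'); reflexivity.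
Qed.

Lemma inner_drift_ge0 B z u : 0 <= rho -> 0 <= inner_drift B z u.
Proof.
move=> rho0; elim: B => [//|j ih] /=.
have g0 : 0 < gamma j := gamma_seq_gt0 j.
have g1 : gamma j <= 1 := gamma_seq_le1 j.
by rewrite addr_ge0 // !mulr_ge0 ?subr_ge0 ?enorm_ge0 // ltW.
Qed.

Lemma approx_resolvent_dist B z u v : 0 < rho <= 1 ->
  (forall c : Xi, monotone_op (fun x => alpha *: G x c)) ->
  (forall c : Xi, lipschitz_op (1 / 2) (fun x => alpha *: G x c)) ->
  enorm (approx_resolvent G B rho alpha gamma z u -
         approx_resolvent G B rho alpha gamma z v) <=
  enorm (u - v) + inner_drift B z u + inner_drift B z v.
Proof.
move=> rho01 mono lips; elim: B => [|j ih] /=; first by rewrite !addr0.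
apply: le_trans (inner_step_dist rho01 mono lips _ _ _ _ _ _) _.
rewrite -/(inner_point z u j) -/(inner_point z v j).
have g1 : 0 <= 1 - gamma j by rewrite subr_ge0; exact: gamma_seq_le1.
move: (ler_wpM2l g1 ih); lra.
Qed.

End inner_drift.

(* With a = j + 1 this is the induction step, from j to j + 1, of the bound
   (1 + 2/3 rho (1 - 1/a)) (c + 4 b / a) on the mean square error of the inner loop. *)
Lemma inner_rate (R : realType) (rho a b c : R) : 0 < rho <= 1 / 16 ->
  1 <= a -> 0 <= b -> 0 <= c ->
  (1 + rho * (2 / (a + 1)) ^+ 2 / 12) *
    ((1 - 2 / (a + 1)) * ((1 + 2 / 3 * rho * (1 - a^-1)) * (c + 4 * b / a))
     + 2 / (a + 1) * c) + (2 / (a + 1)) ^+ 2 * b <=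
  (1 + 2 / 3 * rho * (1 - (a + 1)^-1)) * (c + 4 * b / (a + 1)).
Proof.
move=> /andP[rho0 rho1] a1 b0 c0.
have a0 : 0 < a by lra.
have a10 : 0 < a + 1 by lra.
set i := a^-1; set i' := (a + 1)^-1.
have i0 : 0 < i by rewrite invr_gt0.
have i'0 : 0 < i' by rewrite invr_gt0.
have ii' : i - i' = i * i' by rewrite /i /i'; field; rewrite !gt_eqF.
have i1 : i <= 1 by rewrite invf_le1.
have i'i : i' <= i by have := mulr_gt0 i0 i'0; lra.
have i'2 : i' <= 1 / 2 by have := mulr_gt0 i0 i'0; nra.
set K := 1 + 2 / 3 * rho * (1 - i); set K' := 1 + 2 / 3 * rho * (1 - i').
have K1 : 1 <= K <= 2 by rewrite /K; apply/andP; split; nra.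
have K'1 : 1 <= K' by rewrite /K'; nra.
(* The accumulated factor grows by 2/3 rho (1/a - 1/(a+1)) = 2/3 rho / (a (a+1)). This dominates the
   new relative error rho K / (3 (a+1)^2), as K <= 2. *)
have KK' : (1 + rho * (2 * i') ^+ 2 / 12) * K <= K'.
  have -> : K' = K + 2 / 3 * rho * (i * i') by rewrite -ii' /K /K'; ring.
  have : rho * (i' * i') * K <= rho * (i * i') * 2.
    case/andP: K1 => K1 K2.
    apply: ler_pM => //; first by rewrite mulr_ge0 ?mulr_ge0 // ltW.
      by lra.
    by rewrite ler_pM2l // ler_pM2r.
  by lra.
(* The usual 1/a recursion for weights 2/(a+1): with i - i' = i i', the left side equals 4 b (i' -
   i' (i - i')). *)
have h1 : (1 - 2 * i') * (4 * b * i) + (2 * i') ^+ 2 * b <= 4 * b * i'.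
  have -> : (1 - 2 * i') * (4 * b * i) + (2 * i') ^+ 2 * b =
    4 * b * (i - 2 * (i * i') + i' * i') by ring.
  rewrite -ii'; apply: ler_wpM2l; first by rewrite mulr_ge0.
  by have := mulr_ge0 (ltW i'0) (_ : 0 <= i - i'); rewrite subr_ge0 => /(_ i'i); lra.
set g := 2 * i'; have g0 : 0 <= g by rewrite mulr_ge0 // ltW.
have g1 : 0 <= 1 - g by rewrite /g; lra.
have bi : 0 <= 4 * b * i by rewrite !mulr_ge0 // ltW.
have h2 : (1 - g) * (K * (c + 4 * b * i)) + g * c <= K * (c + (1 - g) * (4 * b * i)).
  by case/andP: K1 => K1 _; have := mulr_ge0 (mulr_ge0 g0 c0) (_ : 0 <= K - 1);
    rewrite subr_ge0 => /(_ K1); lra.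
have q0 : 0 <= 1 + rho * g ^+ 2 / 12.
  by rewrite addr_ge0 // divr_ge0 // mulr_ge0 ?sqr_ge0 // ltW.
have h3 := ler_wpM2l q0 h2; rewrite mulrA in h3.
have X0 : 0 <= c + (1 - g) * (4 * b * i) by rewrite addr_ge0 // mulr_ge0.
have h4 := ler_wpM2r X0 KK'.
have h5 : g ^+ 2 * b <= K' * (g ^+ 2 * b) by rewrite ler_peMl // mulr_ge0 ?sqr_ge0.
have h6 := ler_wpM2l (le_trans ler01 K'1) h1.
have -> : K' * (c + 4 * b * i') = K' * c + K' * (4 * b * i') by ring.
rewrite -/g in KK' h4 h6; lra.
Qed.

(** * Mean square error and drift of one call of the procedure *)

Section inner_mean.
Context {R : realType} {n : nat} {dX : measure_display} {Xi : measurableType dX}.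
Variables (mu : probability Xi R) (F : 'rV[R]_n -> 'rV[R]_n).
Variables (G : 'rV[R]_n -> Xi -> 'rV[R]_n) (sigma alpha rho : R).
Hypothesis mG : measurable_fun [set: 'rV[R]_n * Xi] (fun p => G p.1 p.2).
Hypothesis meanG : forall x i, ('E_mu[fun z => G x z ord0 i] = (F x ord0 i)%:E)%E.
Hypothesis varG : forall x,
  ('E_mu[fun z => (enorm (G x z - F x) ^+ 2)%R] <= (sigma ^+ 2)%:E)%E.
Hypothesis mono : forall z, monotone_op (fun x => alpha *: G x z).
Hypothesis lips : forall z, lipschitz_op (1 / 2) (fun x => alpha *: G x z).
Hypothesis rho_small : 0 < rho <= 1 / 16.

Local Notation gamma := (@gamma_seq R).
Local Notation s2 := ((alpha * sigma) ^+ 2).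

Let rho01 : 0 < rho <= 1.
Proof. by move: rho_small => /andP[-> h]; lra. Qed.

Lemma measurable_inner_step d (T : measurableType d) j (zeta : T -> Xi)
    (u w : T -> 'rV[R]_n) : measurable_fun setT zeta ->
  measurable_fun setT u -> measurable_fun setT w ->
  measurable_fun setT (fun t => inner_step G rho alpha (gamma j) (zeta t) j (u t) (w t)).
Proof.
move=> mz mu_ mw; pose p t : 'rV[R]_n := (1 - gamma j) *: w t + gamma j *: u t.
have mp : measurable_fun setT p.
  by apply: measurable_rVD; exact: measurable_rVZ.
rewrite /inner_step; elim: (inner_iters rho j).+1 => [//|m ih] /=.
apply: measurable_rVB => //; apply: measurable_rVZ.
exact: (measurable_oracle mG).
Qed.

#[local] Opaque inner_iters inner_step.

Lemma mean_le_inner_step j u v w y : y + alpha *: F y = v ->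
  mean_le mu (fun z => enorm (inner_step G rho alpha (gamma j) z j u w - y) ^+ 2)
    ((1 + rho * gamma j ^+ 2 / 12) *
       enorm ((1 - gamma j) *: (w - y) + gamma j *: (u - v)) ^+ 2
     + gamma j ^+ 2 * ((1 + rho / 4) * s2 + rho / 2 * enorm (v - y) ^+ 2)).
Proof.
move=> yv; set g := gamma j; set M := _ *: (w - y) + _.
have g0 : 0 < g := gamma_seq_gt0 j; have g1 : g <= 1 := gamma_seq_le1 j.
pose k := rho * g ^+ 2 / 32.
have /andP[rho0 rho1] := rho01.
have k0 : 0 <= k by rewrite divr_ge0 // mulr_ge0 ?sqr_ge0 // ltW.
have h1 := mean_leZ (addr_ge0 ler01 k0) (mean_le_shifted_noise mG meanG varG alpha y M g).
have h2 := mean_le_noise mG varG alpha y.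
have c0 : 0 <= 3 / 2 * enorm M ^+ 2 + 27 / 2 * enorm (v - y) ^+ 2.
  by have := sqr_ge0 (enorm M); have := sqr_ge0 (enorm (v - y)); lra.
have h3 := mean_leZ k0 (mean_leD (mean_le_cst mu c0) (mean_leZ (ler0n R 6) h2)).
pose r := (1 + k) * (enorm M ^+ 2 + g ^+ 2 * s2) +
  k * (3 / 2 * enorm M ^+ 2 + 27 / 2 * enorm (v - y) ^+ 2 + 6 * s2).
(* With k = rho g^2 / 32 the coefficients compare as 5/64 <= 1/12 for |M|^2, at most 7/32 <= 1/4 for
   the noise and 27/64 <= 1/2 for |v - y|^2. *)
apply: (@mean_leW _ _ _ _ _ r).
  have gg : g ^+ 2 <= 1 by rewrite expr_le1 // ltW.
  have M0 := sqr_ge0 (enorm M); have a0 := sqr_ge0 (enorm (v - y)).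
  have s0 : 0 <= s2 by exact: sqr_ge0.
  rewrite /r /k; move: (enorm M ^+ 2) (enorm (v - y) ^+ 2) (s2) M0 a0 s0 => m a s.
  move=> m0 a0 s0.
  have q0 : 0 <= rho * g ^+ 2 by rewrite mulr_ge0 ?sqr_ge0 // ltW.
  have q1 : rho * g ^+ 2 <= rho by rewrite ler_piMr // ltW.
  have qm := mulr_ge0 q0 m0; have qa := mulr_ge0 q0 a0; have qs := mulr_ge0 q0 s0.
  have gqs : rho * g ^+ 2 * (g ^+ 2 * s) <= rho * g ^+ 2 * s.
    by apply: ler_wpM2l => //; rewrite ler_piMl.
  lra.
apply: mean_le_trans (mean_leD h1 h3).
  apply: measurable_enorm_sqr; apply: measurable_rVB => //.
  exact: measurable_inner_step.
move=> z; rewrite sqr_ge0 /=; have := @inner_step_ref _ _ _ _ _ _ rho01 mono lips (fun x => alpha *: F x) z j u v w y yv.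
cbv zeta; rewrite -/g -/M -/k; lra.
Qed.

Section samples.
Variables (D : set (nat * nat)) (Q : probability (@sample_space _ _ Xi D) R).
Hypothesis law_splice : forall J, has_law (Q \x Q)%E Q
  (fun p => splice J p.1 p.2).
Hypothesis law_coord : forall i, D i -> has_law Q mu (fun s : @sample_space _ _ Xi D => s i).
Variable k : nat.

Local Notation W s u B := (approx_resolvent G B rho alpha gamma (fun j => s (k, j)) u).
Local Notation drift s u B := (inner_drift G rho alpha B (fun j => s (k, j)) u).

Lemma measurable_approx_resolvent d (T : measurableType d) B
    (f : T -> @sample_space _ _ Xi D) (u : T -> 'rV[R]_n) :
  (forall j, (j < B)%N -> D (k, j)) ->
  measurable_fun setT f -> measurable_fun setT u ->
  measurable_fun setT (fun t => W (f t) (u t) B).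
Proof.
move=> + mf mu_; elim: B => [//|B ih] kB /=.
apply: measurable_inner_step => //.
- by apply: (measurable_fun_sampleP _).1 => //; exact: kB.
- by apply: ih => j jB; apply: kB; exact: ltn_trans jB _.
Qed.

Lemma measurable_inner_drift d (T : measurableType d) B
    (f : T -> @sample_space _ _ Xi D) (u : T -> 'rV[R]_n) :
  (forall j, (j < B)%N -> D (k, j)) ->
  measurable_fun setT f -> measurable_fun setT u ->
  measurable_fun setT (fun t => drift (f t) (u t) B).
Proof.
move=> + mf mu_; elim: B => [//|B ih] kB /=.
have kB' j : (j < B)%N -> D (k, j) by move=> jB; apply: kB; exact: ltn_trans jB _.
apply: measurable_funD; first by apply: measurable_funM => //; exact: ih.
do 2 (apply: measurable_funM => //); apply: measurable_enorm.
apply: measurable_rVZ; apply: (measurable_oracle mG).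
- apply: measurable_rVD; apply: measurable_rVZ => //.
  exact: measurable_approx_resolvent.
- by apply: (measurable_fun_sampleP _).1 => //; exact: kB.
Qed.

(** Induction on the number of samples, conditioning on all but the newest one. Allowing v to differ
    from u is what later compares T_k at x_k with J at x_(N-1). *)
Lemma mean_le_approx_resolvent_step B u v y : y + alpha *: F y = v ->
  (forall j, (j < B.+1)%N -> D (k, j)) ->
  let b := (1 + rho / 4) * s2 + rho / 2 * enorm (v - y) ^+ 2 in
  mean_le Q (fun s => enorm (W s u B.+1 - y) ^+ 2)
    ((1 + 2 / 3 * rho * (1 - B.+2%:R^-1)) *
     (enorm (u - v) ^+ 2 + 4 * b / B.+2%:R)).
Proof.
move=> yv kB b.
have s0 : 0 <= s2 by exact: sqr_ge0.
have /andP[rho0 rho1] := rho_small.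
have b0 : 0 <= b.
  by rewrite /b addr_ge0 // mulr_ge0 ?sqr_ge0 ?addr_ge0 ?divr_ge0 // ltW.
elim: B kB => [|B ih] kB.
  have k0 : D (k, 0%N) by exact: kB.
  have := mean_le_law (measurable_coord k0) (law_coord k0) (mean_le_inner_step 0 u u yv).
  (* The first weight is 1, so p_0 = u and the first step already gives the base of the
     recursion. *)
  have -> : gamma 0 = 1 by rewrite /gamma_seq divff.
  rewrite subrr scale0r add0r scale1r expr1n mul1r => h.
  have -> : (fun s : @sample_space _ _ Xi D => enorm (W s u 1 - y) ^+ 2) =
      (fun z => enorm (inner_step G rho alpha 1 z 0 u u - y) ^+ 2) \o (fun s => s (k, 0%N)).
    apply/funext => s; rewrite [RHS]/= approx_resolventS.
    by have -> : gamma 0 = 1 by rewrite /gamma_seq divff.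
  apply: mean_leW h; have := sqr_ge0 (enorm (u - v)).
  rewrite -/b; move: (enorm (u - v) ^+ 2) => c c0; nra.
have kB' j : (j < B.+1)%N -> D (k, j) by move=> jB; apply: kB; exact: ltn_trans jB _.
(* Only the newest sample is resampled: the previous iterate then depends on the first path alone,
   and the new inner step uses an independent sample. *)
pose J : pred (nat * nat) := pred1 (k, B.+1).
pose f (s : @sample_space _ _ Xi D) := enorm (W s u B.+2 - y) ^+ 2.
have mf : measurable_fun setT f.
  apply: measurable_enorm_sqr; apply: measurable_rVB => //.
  exact: (measurable_approx_resolvent kB (@measurable_id _ _ setT) (measurable_cst u)).
apply: (mean_le_of_law (measurable_splice (D := D) J) (law_splice J) mf).
  by move=> s; exact: sqr_ge0.
apply: (mean_le_prod (h := fun s : @sample_space _ _ Xi D => (1 + rho * gamma B.+1 ^+ 2 / 12) *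
    ((1 - gamma B.+1) * enorm (W s u B.+1 - y) ^+ 2
     + gamma B.+1 * enorm (u - v) ^+ 2) + gamma B.+1 ^+ 2 * b)).
- exact: measurableT_comp mf (measurable_splice _).
- by move=> p; exact: sqr_ge0.
- move=> s1 /=.
  have kB1 : D (k, B.+1) by exact: kB.
  have -> : (fun s : @sample_space _ _ Xi D => f (splice J s1 s)) =
      (fun z => enorm (inner_step G rho alpha (gamma B.+1) z B.+1 u (W s1 u B.+1) - y) ^+ 2)
      \o (fun s => s (k, B.+1)).
    apply/funext => s; rewrite /f [in LHS]approx_resolventS.
    have -> : splice J s1 s (k, B.+1) = s (k, B.+1) by rewrite /splice /J/= eqxx.
    rewrite (@eq_approx_resolvent _ _ _ G rho alpha B.+1 _ (fun j => s1 (k, j))) // => j jB.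
    by rewrite /splice /J/= xpair_eqE eqxx/= ltn_eqF.
  have := mean_le_law (measurable_coord kB1) (law_coord kB1)
    (mean_le_inner_step B.+1 u (W s1 u B.+1) yv).
  apply: mean_leW; rewrite lerD2r ler_wpM2l //.
    by rewrite addr_ge0 // divr_ge0 // mulr_ge0 ?sqr_ge0 // ltW.
  apply: enorm_sqr_convex.
  by rewrite gamma_seq_le1 ltW ?gamma_seq_gt0.
- have g0 : 0 <= gamma B.+1 by rewrite ltW ?gamma_seq_gt0.
  have g1 : 0 <= 1 - gamma B.+1 by rewrite subr_ge0 gamma_seq_le1.
  have q0 : 0 <= 1 + rho * gamma B.+1 ^+ 2 / 12.
    by rewrite addr_ge0 // divr_ge0 // mulr_ge0 ?sqr_ge0 // ltW.
  have c0 : 0 <= gamma B.+1 * enorm (u - v) ^+ 2 by rewrite mulr_ge0 ?sqr_ge0.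
  have d0 : 0 <= gamma B.+1 ^+ 2 * b by rewrite mulr_ge0 ?sqr_ge0.
  have := mean_leD (mean_leZ q0 (mean_leD (mean_leZ g1 (ih kB')) (mean_le_cst Q c0)))
    (mean_le_cst Q d0).
  apply: mean_leW.
  (* The new sample has index j = B + 1, so a = j + 1 = B + 2. *)
  have := @inner_rate R rho B.+2%:R b (enorm (u - v) ^+ 2) rho_small.
  have -> : B.+2%:R + 1 = B.+3%:R :> R by rewrite natr1.
  rewrite /gamma_seq addn2; apply => //; last exact: sqr_ge0.
  by rewrite ler1n.
Qed.

Hypothesis lipsF : lipschitz_op (1 / 2) (fun x => alpha *: F x).

Lemma mean_le_resolvent B u v : (0 < B)%N -> (forall j, (j < B)%N -> D (k, j)) ->
  mean_le Q (fun s => enorm (W s u B - resolvent (fun x => alpha *: F x) v) ^+ 2)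
    ((1 + rho) * enorm (u - v) ^+ 2 + 5 * s2 / B.+1%:R
     + 2 * rho * enorm (v - resolvent (fun x => alpha *: F x) v) ^+ 2).
Proof.
case: B => // B _ kB.
have := mean_le_approx_resolvent_step u (resolventK lipsF v) kB.
apply: mean_leW; set y := resolvent _ v.
have /andP[rho0 rho1] := rho_small.
have := sqr_ge0 (enorm (u - v)); have := sqr_ge0 (enorm (v - y)).
have := sqr_ge0 (alpha * sigma).
move: (enorm (u - v) ^+ 2) (enorm (v - y) ^+ 2) (s2) => c q s s0 q0 c0.
have i0 : 0 < B.+2%:R^-1 :> R by rewrite invr_gt0.
have i1 : B.+2%:R^-1 <= 1 / 2 :> R by rewrite div1r lef_pV2 ?posrE // ler_nat.
move: (B.+2%:R^-1) i0 i1 => i i0 i1.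
set K := 1 + 2 / 3 * rho * (1 - i).
have K1 : 0 <= K <= 1 + 2 / 3 * rho by rewrite /K; apply/andP; split; nra.
have /andP[K0 K2] := K1.
have h1 : K * c <= (1 + rho) * c by apply: ler_wpM2r => //; lra.
have h2 : K * (4 * (1 + rho / 4)) <= 5.
  by apply: (@le_trans _ _ ((1 + 2 / 3 * rho) * (4 * (1 + rho / 4)))); [apply: ler_wpM2r => //; lra|nra].
have h3 : K * (4 * (1 + rho / 4)) * (s * i) <= 5 * (s * i).
  by apply: ler_wpM2r => //; rewrite mulr_ge0 // ltW.
have h4 : K * (2 * i) <= 2 by nra.
have h5 : K * (2 * i) * (rho * q) <= 2 * (rho * q).
  by apply: ler_wpM2r => //; rewrite mulr_ge0 // ltW.
lra.
Qed.

Variable xstar : 'rV[R]_n.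
Hypothesis F0 : F xstar = 0.

(** At the zero one may take v = y = xstar, which removes the residual term. The case of no samples
    is included because the first inner point is built from w_0. *)
Lemma mean_le_iterate_zero B u : (forall j, (j < B)%N -> D (k, j)) ->
  mean_le Q (fun s => enorm (W s u B - xstar) ^+ 2)
    ((1 + rho) * enorm (u - xstar) ^+ 2 + 5 * s2).
Proof.
have /andP[rho0 rho1] := rho_small.
have c0 := sqr_ge0 (enorm (u - xstar)); have s0 := sqr_ge0 (alpha * sigma).
case: B => [_|B kB].
  apply: mean_leW (mean_le_cst Q c0); nra.
have yv : xstar + alpha *: F xstar = xstar by rewrite F0 scaler0 addr0.
have := mean_le_approx_resolvent_step u yv kB; apply: mean_leW.
rewrite subrr enorm0 expr0n/= mulr0 addr0.
move: (enorm (u - xstar) ^+ 2) (s2) c0 s0 => c s c0 s0.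
have i0 : 0 < B.+2%:R^-1 :> R by rewrite invr_gt0.
have i1 : B.+2%:R^-1 <= 1 / 2 :> R by rewrite div1r lef_pV2 ?posrE // ler_nat.
move: (B.+2%:R^-1) i0 i1 => i i0 i1.
set K := 1 + 2 / 3 * rho * (1 - i).
have K1 : 0 <= K <= 1 + 2 / 3 * rho by rewrite /K; apply/andP; split; nra.
have /andP[K0 K2] := K1.
have h1 : K * c <= (1 + rho) * c by apply: ler_wpM2r => //; lra.
have h2 : K * (4 * (1 + rho / 4) * i) <= 5.
  apply: (@le_trans _ _ ((1 + 2 / 3 * rho) * (4 * (1 + rho / 4) * 1))); last nra.
  by apply: ler_pM => //; [rewrite !mulr_ge0 ?addr_ge0 ?divr_ge0 // ltW|nra].
have h3 := ler_wpM2r s0 h2; lra.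
Qed.

(** At xstar the sampled operator is pure noise, and 1/2-Lipschitz continuity carries this to the
    inner point. *)
Lemma mean_le_oracle_point B u : (forall j, (j < B.+1)%N -> D (k, j)) ->
  mean_le Q (fun s => enorm (alpha *: G (inner_point G rho alpha (fun j => s (k, j)) u B)
      (s (k, B))) ^+ 2)
    (enorm (u - xstar) ^+ 2 + 5 * s2).
Proof.
move=> kB; have kBB : D (k, B) by exact: kB.
have kB' j : (j < B)%N -> D (k, j) by move=> jB; exact: kB (ltnW jB).
have /andP[rho0 rho1] := rho_small.
have c0 := sqr_ge0 (enorm (u - xstar)); have s0 := sqr_ge0 (alpha * sigma).
have g0 : 0 <= gamma B by rewrite ltW ?gamma_seq_gt0.
have g1 : 0 <= 1 - gamma B by rewrite subr_ge0 gamma_seq_le1.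
have gc0 := mulr_ge0 g0 c0.
have h1 := mean_leD (mean_leZ g1 (mean_le_iterate_zero u kB')) (mean_le_cst Q gc0).
have h2 := mean_le_law (measurable_coord kBB) (law_coord kBB)
  (mean_le_noise mG varG alpha xstar).
have h3 := mean_leD (mean_leZ (ler0n R 2) h2) (mean_leZ (_ : 0 <= 1 / 2 :> R) h1).
have h : mean_le Q _ _ := h3 _; apply: (mean_le_trans _ _ (mean_leW _ (h _))).
- apply: measurable_enorm_sqr; apply: measurable_rVZ; apply: (measurable_oracle mG).
    apply: measurable_rVD; apply: measurable_rVZ => //.
    exact: (measurable_approx_resolvent kB' (@measurable_id _ _ setT) (measurable_cst u)).
  exact: measurable_coord.
- move=> s; rewrite sqr_ge0 /=.
  set p := inner_point _ _ _ _ _ _; set w := approx_resolvent _ _ _ _ _ _ _.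
  set z := s (k, B).
  have hp : enorm (p - xstar) ^+ 2 <=
      (1 - gamma B) * enorm (w - xstar) ^+ 2 + gamma B * enorm (u - xstar) ^+ 2.
    have -> : p - xstar = (1 - gamma B) *: (w - xstar) + gamma B *: (u - xstar).
      have -> : p = (1 - gamma B) *: w + gamma B *: u by [].
      by move: (w) => {}w; apply/rowP => i; rewrite !mxE; ring.
    by apply: enorm_sqr_convex; rewrite g0 -subr_ge0.
  have hl : enorm (alpha *: G p z - alpha *: G xstar z) ^+ 2 <=
      1 / 4 * enorm (p - xstar) ^+ 2.
    have -> : 1 / 4 * enorm (p - xstar) ^+ 2 = (1 / 2 * enorm (p - xstar)) ^+ 2 by field.
    by rewrite ler_sqr ?nnegrE ?mulr_ge0 ?enorm_ge0 //; exact: lips.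
  have := enormD_sqr_le (alpha *: G p z - alpha *: G xstar z)
    (alpha *: G xstar z - alpha *: F xstar).
  have -> : alpha *: G p z - alpha *: G xstar z +
      (alpha *: G xstar z - alpha *: F xstar) = alpha *: G p z.
    by rewrite subrKA F0 scaler0 subr0.
  lra.
- move: (enorm (u - xstar) ^+ 2) (s2) c0 s0 gc0 => c s c0 s0 gc0.
  have : (1 - gamma B) * ((1 + rho) * c + 5 * s) + gamma B * c <= (1 + rho) * c + 5 * s.
    by nra.
  by nra.
- by [].
Qed.

(** The recursion is a convex combination, so convexity of the square leaves increments of order
    rho^2 gamma_j^3. Relaxing gamma_j^3 to gamma_j^2 gives the same 1/(B+1) recursion as for the
    noise. *)
Lemma mean_le_inner_drift B u : (forall j, (j < B)%N -> D (k, j)) ->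
  mean_le Q (fun s => drift s u B ^+ 2)
    ((rho / 32) ^+ 2 * (4 * (enorm (u - xstar) ^+ 2 + 5 * s2)) / B.+1%:R).
Proof.
have q0 : 0 <= enorm (u - xstar) ^+ 2 + 5 * s2.
  by have := sqr_ge0 (enorm (u - xstar)); have := sqr_ge0 (alpha * sigma); lra.
elim: B => [|B ih] kB.
  have h0 : 0 <= (0 : R) by [].
  have -> : (fun s : @sample_space _ _ Xi D => drift s u 0 ^+ 2) = (fun=> 0).
    by apply/funext => s; rewrite /= expr0n.
  by apply: mean_leW (mean_le_cst Q h0); rewrite divr_ge0 // mulr_ge0 ?sqr_ge0 // mulr_ge0.
have kB' j : (j < B)%N -> D (k, j) by move=> jB; exact: kB (ltnW jB).
have g0 : 0 < gamma B := gamma_seq_gt0 B.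
have g1 : gamma B <= 1 := gamma_seq_le1 B.
have g10 : 0 <= 1 - gamma B by rewrite subr_ge0.
have r0 : 0 <= gamma B * (rho * gamma B / 32) ^+ 2 by rewrite mulr_ge0 ?sqr_ge0 // ltW.
have h := mean_leD (mean_leZ g10 (ih kB')) (mean_leZ r0 (mean_le_oracle_point u kB)).
apply: (mean_le_trans _ _ (mean_leW _ h)).
- by apply: measurable_funX;
    exact: (measurable_inner_drift kB (@measurable_id _ _ setT) (measurable_cst u)).
- move=> s; rewrite sqr_ge0 [inner_drift _ _ _ B.+1 _ _]/=.
  move: (inner_drift _ _ _ _ _ _) (enorm (alpha *: _)) => x y.
  by have := mulr_ge0 (mulr_ge0 (ltW g0) g10)
    (sqr_ge0 (x - rho * gamma B / 32 * y)); lra.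
- move: (enorm (u - xstar) ^+ 2 + _) q0 => q q0.
  have -> : gamma B * (rho * gamma B / 32) ^+ 2 * q =
     (rho / 32) ^+ 2 * q * (gamma B * gamma B ^+ 2) by field.
  have -> : (1 - gamma B) * ((rho / 32) ^+ 2 * (4 * q) / B.+1%:R) =
     (rho / 32) ^+ 2 * q * ((1 - gamma B) * 4 / B.+1%:R) by ring.
  have -> : (rho / 32) ^+ 2 * (4 * q) / B.+2%:R =
     (rho / 32) ^+ 2 * q * (4 / B.+2%:R) by ring.
  rewrite -mulrDr; apply: ler_wpM2l; first by rewrite mulr_ge0 ?sqr_ge0.
  have : gamma B * gamma B ^+ 2 <= gamma B ^+ 2 by rewrite ler_piMl ?sqr_ge0.
  rewrite /gamma_seq addn2.
  have ii' : B.+1%:R^-1 - B.+2%:R^-1 = B.+1%:R^-1 * B.+2%:R^-1 :> R.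
    rewrite -[B.+2%:R]natr1; move: (ltr0Sn R B); move: (B.+1%:R) => a a0.
    by field; apply/andP; split; apply: lt0r_neq0; lra.
  have i0 : 0 < B.+1%:R^-1 :> R by rewrite invr_gt0.
  have i'0 : 0 < B.+2%:R^-1 :> R by rewrite invr_gt0.
  move: (B.+1%:R^-1) (B.+2%:R^-1) ii' i0 i'0 => i i' ii' i0 i'0.
  have := mulr_ge0 (ltW i'0) (mulr_ge0 (ltW i0) (ltW i'0)); rewrite -ii'.
  have : (1 - 2 * i') * 4 * i = 4 * (i - 2 * (i * i')) by ring.
  by rewrite -ii'; lra.
Qed.

End samples.
End inner_mean.

(** * The outer loop *)

Section outer_loop.
Context {R : realType} {n : nat}.
Variables (N : nat) (x0 : 'rV[R]_n).
Implicit Types (T : nat -> 'rV[R]_n -> 'rV[R]_n) (k m : nat).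

Definition outer_x T k := (outer_iter N T x0 k).1.
Definition outer_z T k := (outer_iter N T x0 k).2.

Lemma outer_zS T k : outer_z T k.+1 = T k (outer_x T k).
Proof. by rewrite /outer_z /outer_x /=; case: outer_iter. Qed.

Lemma outer_xS T k : outer_x T k.+1 = outer_x T k +
  ((N - k - 1)%:R / (N - k)%:R) *: (outer_z T k.+1 - outer_z T k).
Proof. by rewrite outer_zS /outer_x /outer_z /=; case: outer_iter. Qed.

Lemma eq_outer_iter T T' k : (forall l, (l < k)%N -> T l =1 T' l) ->
  outer_iter N T x0 k = outer_iter N T' x0 k.
Proof.
elim: k => [//|k ih] TT /=; rewrite ih => [|l lk]; last by apply: TT; exact: ltnW.
by case: outer_iter => x z; rewrite TT.
Qed.

(** The weights are chosen before T, so the points x_k of two runs differ by one convex combination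
    of the differences of their outputs. *)
Lemma outer_x_convex k : (k < N)%N -> exists a : nat -> R,
  [/\ forall m, 0 <= a m, \sum_(m < k.+1) a m = 1 &
      forall T, outer_x T k = \sum_(m < k.+1) a m *: outer_z T m].
Proof.
(* The update moves weight (N-k-1)/(N-k) from z_k to z_(k+1), so the induction must know that z_k
   carries that much. These ratios decrease in k, hence the new last weight is again large
   enough. *)
suff h : (k < N)%N -> exists a : nat -> R,
  [/\ forall m, 0 <= a m, \sum_(m < k.+1) a m = 1,
      (N - k - 1)%:R / (N - k)%:R <= a k &
      forall T, outer_x T k = \sum_(m < k.+1) a m *: outer_z T m].
  by move=> /h [a [a0 a1 _ ax]]; exists a.
have ratio_le1 m : (m.-1%:R / m%:R : R) <= 1.
  case: m => [|m]; first by rewrite mul0r.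
  by rewrite ler_pdivrMr // mul1r ler_nat.
have ratio_mono m : (m.-1%:R / m%:R : R) <= (m%:R / m.+1%:R).
  case: m => [|m]; first by rewrite !mul0r.
  by rewrite ler_pdivrMr // mulrAC ler_pdivlMr // -!natrM ler_nat /= mulnS mulSn leq_add2r leqnSn.
elim: k => [|k ih] kN.
  exists (fun=> 1); split => //; first by rewrite big_ord1.
    by rewrite subn0 subn1.
  by move=> T; rewrite big_ord1 scale1r.
have [a [a0 a1 ak ax]] := ih (ltnW kN).
set r : R := (N - k - 1)%:R / (N - k)%:R in ak.
exists (fun m => if m == k.+1 then r else if m == k then a k - r else a m).
have r0 : 0 <= r by rewrite divr_ge0.
have sum_a (V : zmodType) (f g : nat -> V) : (forall m, (m < k)%N -> f m = g m) ->
    \sum_(m < k.+2) f m = \sum_(m < k.+1) g m + (f k - g k + f k.+1).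
  move=> fg; rewrite !big_ord_recr/= (eq_bigr (fun m : 'I_k => g m)) => [|i _].
    by rewrite -!addrA; congr (_ + _); rewrite [RHS]addrCA addNKr.
  exact: fg.
split.
- by move=> m; case: eqP => // _; case: eqP => // _; rewrite subr_ge0.
- rewrite (sum_a _ (fun m => if m == k.+1 then r else if m == k then a k - r else a m) a).
    by rewrite a1 !eqxx (ltn_eqF (ltnSn k)); ring.
  by move=> m mk; rewrite !ltn_eqF // ltnW.
- rewrite eqxx /r (subn1 (N - k)) (subn1 (N - k.+1)) subnS.
  have -> : (N - k)%N = (N - k).-1.+1 by rewrite prednK // subn_gt0 ltnW.
  exact: ratio_mono.
- move=> T.
  rewrite (sum_a _ (fun m => (if m == k.+1 then r else if m == k then a k - r else a m)
    *: outer_z T m) (fun m => a m *: outer_z T m)); last first.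
    by move=> m mk; rewrite !ltn_eqF // ltnW.
  rewrite -ax outer_xS -/r !eqxx (ltn_eqF (ltnSn k)) scalerBr scalerBl.
  congr (_ + _); rewrite [RHS]addrC; congr (_ + _).
  by rewrite addrAC subrr sub0r.
Qed.

Lemma outer_x_dist T T' k b : (k < N)%N ->
  (forall m, (m <= k)%N -> enorm (outer_z T m - outer_z T' m) <= b) ->
  enorm (outer_x T k - outer_x T' k) <= b.
Proof.
move=> kN zb; have [a [a0 a1 ax]] := outer_x_convex kN.
rewrite !ax -sumrB; apply: le_trans (enorm_sum_le _ _) _.
rewrite -[leRHS]mul1r -a1 mulr_suml; apply: ler_sum => m _.
by rewrite -scalerBr enormZ ger0_norm // ler_wpM2l // zb // -ltnS.
Qed.

(** Steps other than k enlarge the distance between the runs by drift only, and each x is a convex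
    combination of earlier outputs. Apart from drift, only step k creates distance. *)
Lemma outer_z_stable T T' (th th' : nat -> R) k m : (m <= N)%N ->
  (forall l, 0 <= th l) -> (forall l, 0 <= th' l) ->
  (forall l, (l < N)%N -> l != k -> enorm (T l (outer_x T l) - T' l (outer_x T' l)) <=
     enorm (outer_x T l - outer_x T' l) + th l + th' l) ->
  enorm (outer_z T m - outer_z T' m) <=
  enorm (outer_z T k.+1 - outer_z T' k.+1) + \sum_(l < m) (th l + th' l).
Proof.
move=> + th0 th'0 lip; elim/ltn_ind: m => -[_|m ih] mN.
  by rewrite /outer_z /= subrr enorm0 big_ord0 addr0 enorm_ge0.
have sum_ge0 i : 0 <= \sum_(l < i) (th l + th' l).
  by apply: sumr_ge0 => l _; rewrite addr_ge0.
have [->|mk] := eqVneq m k; first by rewrite lerDl.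
rewrite [outer_z T m.+1]outer_zS [outer_z T' m.+1]outer_zS.
apply: le_trans (lip _ mN mk) _; rewrite big_ord_recr/=.
suff : enorm (outer_x T m - outer_x T' m) <=
    enorm (outer_z T k.+1 - outer_z T' k.+1) + \sum_(l < m) (th l + th' l) by lra.
apply: outer_x_dist => // i im; apply: le_trans (ih i _ _) _.
- by rewrite ltnS.
- by apply: leq_trans im _; exact: ltnW.
rewrite lerD2l -(subnKC im) big_split_ord/= lerDl.
by apply: sumr_ge0 => l _; rewrite addr_ge0.
Qed.

End outer_loop.

Section outer_identity.
Context {R : realType} {n : nat}.
Implicit Types (x z v t : 'rV[R]_n).

(* Its increments along the outer loop are explicit whatever the maps T_k are. *)
Definition lyapunov (i : R) z x v t : R :=
  (1 + i^-1) * enorm (x - z - (v - t)) ^+ 2 + 2 / i * edot (x - z - (v - t)) (z - t).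

(** Here i = N - k, for which the outer momentum is (i - 1) / i; the last coefficient is the weight
    w_k. *)
Lemma lyapunov_step (i : R) x z z' v t : 1 < i ->
  lyapunov (i - 1) z' (x + ((i - 1) / i) *: (z' - z)) v t =
  lyapunov i z x v t +
  (i * (i - 1))^-1 * (enorm (x - v) ^+ 2 - enorm (z' - t) ^+ 2).
Proof.
move=> i1; have i0 : i != 0 by rewrite gt_eqF //; lra.
have i10 : i - 1 != 0 by rewrite gt_eqF //; lra.
rewrite /lyapunov !sqr_enorm !edotE.
rewrite !(edotC z' _) !(edotC z x) !(edotC v x) !(edotC v z) !(edotC t x) !(edotC t z) !(edotC t v).
by field; rewrite i0 i10.
Qed.

Lemma outer_residual_le N (x0 : 'rV[R]_n) T xstar t D : (0 < N)%N ->
  let v := outer_x N x0 T N.-1 in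
  let w k : R := ((N - k)%:R * (N - k.+1)%:R)^-1 in
  0 <= edot (v - t) (t - xstar) -> enorm (x0 - xstar) <= D ->
  1 / 2 * enorm (v - t) ^+ 2 +
    \sum_(k < N.-1) w k * enorm (outer_x N x0 T k - v) ^+ 2 <=
  2 * D ^+ 2 / N%:R ^+ 2 +
    \sum_(k < N.-1) w k * enorm (outer_z N x0 T k.+1 - t) ^+ 2.
Proof.
move=> N0 v w firm xD.
pose x := outer_x N x0 T; pose z := outer_z N x0 T.
have tel m : (m <= N.-1)%N -> lyapunov (N - m)%:R (z m) (x m) v t =
    lyapunov N%:R x0 x0 v t +
    \sum_(k < m) w k * (enorm (x k - v) ^+ 2 - enorm (z k.+1 - t) ^+ 2).
  elim: m => [|m ih] mN; first by rewrite subn0 big_ord0 addr0.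
  have m1 : (1 < N - m)%N by rewrite -subn1 in mN; lia.
  have -> : (N - m.+1)%:R = (N - m)%:R - 1 :> R.
    by rewrite subnS -subn1 natrB // ltnW.
  have -> : x m.+1 = x m + (((N - m)%:R - 1) / (N - m)%:R) *: (z m.+1 - z m).
    by rewrite /x outer_xS natrB // ltnW.
  rewrite lyapunov_step ?ltr1n // big_ord_recr/= ih ?(ltnW mN) // -addrA.
  by congr (_ + (_ + _ * _)); rewrite /w subnS -subn1 (natrB _ (ltnW m1)).
(* At i = 1 and x = v the function equals 2 |t - z|^2 - 2 |t - z|^2 = 0, so its initial value and
   the telescoped sum cancel. *)
have := tel N.-1 (leqnn _).
have -> : (N - N.-1)%N = 1%N by lia.
rewrite /lyapunov -/(x N.-1) (_ : x N.-1 = v) //.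
have -> : v - z N.-1 - (v - t) = t - z N.-1 by rewrite opprB addrC addrA subrK.
have -> : x0 - x0 - (v - t) = t - v by rewrite subrr sub0r opprB.
have Nr : 0 < N%:R :> R by rewrite ltr0n.
have -> : \sum_(k < N.-1) w k * (enorm (x k - v) ^+ 2 - enorm (z k.+1 - t) ^+ 2) =
    \sum_(k < N.-1) w k * enorm (x k - v) ^+ 2 -
    \sum_(k < N.-1) w k * enorm (z k.+1 - t) ^+ 2.
  by rewrite -sumrB; apply: eq_bigr => k _; rewrite mulrBr.
move: (\sum_(k < _) _) (\sum_(k < _) _) => X Z.
rewrite (enorm_distC t v).
have -> : edot (t - z N.-1) (z N.-1 - t) = - enorm (t - z N.-1) ^+ 2.
  by rewrite -[z N.-1 - t]opprB edotNr sqr_enorm.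
have -> : edot (t - v) (x0 - t) = edot (v - t) (t - xstar) - edot (v - t) (x0 - xstar).
  by rewrite !edotE; ring.
rewrite invr1 mulr1.
have := edot_le_enorm (v - t) (x0 - xstar); have g0 := enorm_ge0 (v - t).
move: firm xD; move: (edot (v - t) (t - xstar)) (edot (v - t) (x0 - xstar)).
move: g0 (enorm_ge0 (x0 - xstar)).
move: (enorm (v - t)) (enorm (x0 - xstar)) => g d g0 d0 e f e0 dD fgd E.
have iN0 : 0 < N%:R^-1 :> R by rewrite invr_gt0.
have fgD : f <= g * D by apply: le_trans fgd _; rewrite ler_wpM2l.
have -> : 2 * D ^+ 2 / N%:R ^+ 2 = 2 * (D * N%:R^-1) ^+ 2.
  by field; rewrite gt_eqF.
move: (N%:R^-1) iN0 E => i i0 E.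
(* The square h4 absorbs the cross term: 2 g D / N <= g^2 / 2 + 2 D^2 / N^2, which leaves half of
   g^2. *)
have h1 := mulr_ge0 (ltW i0) e0; have h2 := ler_wpM2l (ltW i0) fgD.
have h3 := mulr_ge0 (ltW i0) (sqr_ge0 g); have h4 := sqr_ge0 (g - 2 * (D * i)).
nra.
Qed.

End outer_identity.

(** An equality is required here: these means occur on both sides of the averaged outer bound and
    have to cancel. *)
Lemma expectation_wsum (R : realType) d (T : measurableType d) (mu : probability T R)
    (I : Type) (s : seq I) (a : I -> R) (f : I -> T -> R) (r : I -> R) :
  (forall i, 0 <= a i) -> (forall i, mean_le mu (f i) (r i)) ->
  ('E_mu[fun x => (\sum_(i <- s) a i * f i x)%R] =
   (\sum_(i <- s) a i * fine 'E_mu[f i])%:E)%E.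
Proof.
move=> a0 fr; elim: s => [|i s ih].
  under [X in 'E__[X]%E]funext do rewrite big_nil.
  by rewrite big_nil; exact: expectation_cst.
have [mf f0 _] := fr i.
have [ms s0 _] := mean_le_sum s (fun i => mean_leZ (a0 i) (fr i)).
under [X in 'E__[X]%E]funext do rewrite big_cons.
rewrite big_cons EFinD ge0_expectationD //.
- by rewrite ih ge0_expectationZl // EFinM -(fine_meanK (fr i)).
- exact: measurable_funM.
- by move=> x; rewrite mulr_ge0.
Qed.

(** * Exchanging two of three independent paths *)

Section swap.
Context {R : realType} {d : measure_display} {S : measurableType d}.
Variable Q : probability S R.

Definition swap23 (p : S * S * S) : S * S * S := ((p.1.1, p.2), p.1.2).

Lemma measurable_swap23 : measurable_fun setT swap23.
Proof.
apply: measurable_fun_pair; last exact: measurableT_comp measurable_snd measurable_fst.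
apply: measurable_fun_pair => //.
exact: measurableT_comp measurable_fst measurable_fst.
Qed.

Lemma mean_le_swap23 (f : S * S * S -> R) r :
  mean_le ((Q \x Q) \x Q)%E f r -> mean_le ((Q \x Q) \x Q)%E (f \o swap23) r.
Proof.
move=> [mf f0 fr]; have mfs := measurableT_comp mf measurable_swap23.
split; [exact: mfs|by move=> p /=|apply: le_trans fr; rewrite expectation.unlock].
have mE : measurable_fun setT (fun p => (f p)%:E) by exact/measurable_EFinP.
have mEs : measurable_fun setT (fun p => ((f \o swap23) p)%:E) by exact/measurable_EFinP.
have E0 p : (0 <= (f p)%:E)%E by rewrite lee_fin.
have Es0 p : (0 <= ((f \o swap23) p)%:E)%E by exact: E0.
rewrite (fubini_tonelli1 _ mEs Es0) (fubini_tonelli1 _ mE E0).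
have F0 (g : S * S * S -> \bar R) : (forall p, (0 <= g p)%E) ->
    forall p, (0 <= fubini_F Q g p)%E.
  by move=> g0 p; exact: integral_ge0.
rewrite (fubini_tonelli1 _ (measurable_fun_fubini_tonelli_F _ mEs Es0) (F0 _ Es0)).
rewrite (fubini_tonelli1 _ (measurable_fun_fubini_tonelli_F _ mE E0) (F0 _ E0)).
rewrite le_eqVlt; apply/orP; left; apply/eqP.
apply: eq_integral => s _; rewrite /fubini_F /=.
apply: (fubini_tonelli (m1 := Q) (m2 := Q) (fun p => (f ((s, p.2), p.1))%:E)).
- apply/measurable_EFinP; apply: (measurableT_comp mf).
  by apply: measurable_fun_pair => //; exact: measurable_fun_pair.
- by move=> p; rewrite lee_fin.
Qed.

Lemma law_fst : has_law ((Q \x Q) \x Q)%E (Q \x Q)%E fst.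
Proof.
move=> A mA; have -> : fst @^-1` A = A `*` [set: S].
  by apply/seteqP; split => -[x y] //= [].
apply: etrans (product_measure1E (Q \x Q)%E Q mA measurableT) _.
exact: etrans (congr1 (fun e => _ * e)%E (probability_setT Q)) (mule1 _).
Qed.

Lemma law_proj13 : has_law ((Q \x Q) \x Q)%E (Q \x Q)%E (fst \o swap23).
Proof.
move=> A mA; have m13 : measurable_fun setT (fst \o swap23).
  exact: measurableT_comp measurable_fst measurable_swap23.
pose phi : {mfun _ >-> _} := HB.pack (fst \o swap23)
  (isMeasurableFun.Build _ _ _ _ (fst \o swap23) m13).
apply/esym; rewrite -[RHS]/(distribution ((Q \x Q) \x Q)%E phi A).
apply: product_measure_unique => // B C mB mC.
rewrite -[LHS]/(((Q \x Q) \x Q)%E ((fst \o swap23) @^-1` (B `*` C))).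
have -> : (fst \o swap23) @^-1` (B `*` C) = (B `*` setT) `*` C.
  by apply/seteqP; split => -[[x y] z] //= [] // [].
apply: etrans (product_measure1E (Q \x Q)%E Q (measurableX mB measurableT) mC) _.
congr (_ * _)%E; apply: etrans (product_measure1E Q Q mB measurableT) _.
exact: etrans (congr1 (fun e => _ * e)%E (probability_setT Q)) (mule1 _).
Qed.

End swap.

Lemma sqr_sum_le (R : realType) (m : nat) (r : nat -> R) :
  (\sum_(l < m) r l) ^+ 2 <= m%:R * \sum_(l < m) r l ^+ 2.
Proof.
elim: m => [|m ih]; first by rewrite !big_ord0 expr0n mulr0.
rewrite !big_ord_recr/= -natr1.
have : 2 * r m * \sum_(l < m) r l <= \sum_(l < m) r l ^+ 2 + m%:R * r m ^+ 2.
  have -> : m%:R * r m ^+ 2 = \sum_(l < m) r m ^+ 2.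
    by rewrite sumr_const card_ord mulr_natl.
  rewrite mulr_sumr -big_split/=; apply: ler_sum => l _.
  by have := sqr_ge0 (r l - r m); lra.
by lra.
Qed.

(** * Mean residual of the outer loop for abstract nearly nonexpansive random maps *)

Section outer_mean.
Context {R : realType} {n : nat} {d : measure_display} {S : measurableType d}.
Variables (Q : probability S R) (N : nat) (sp : nat -> S * S -> S).
Variables (T : nat -> S -> 'rV[R]_n -> 'rV[R]_n) (th : nat -> S -> 'rV[R]_n -> R).
Variables (J : 'rV[R]_n -> 'rV[R]_n) (x0 xstar : 'rV[R]_n) (D rho kappa : R) (c : nat -> R).
Hypothesis msp : forall k, measurable_fun setT (sp k).
Hypothesis law_sp : forall k, has_law (Q \x Q)%E Q (sp k).
Hypothesis mT : forall k, (k < N)%N ->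
  measurable_fun [set: S * 'rV[R]_n] (fun p => T k p.1 p.2).
Hypothesis mth : forall k, (k < N)%N ->
  measurable_fun [set: S * 'rV[R]_n] (fun p => th k p.1 p.2).
Hypothesis T_fresh : forall k p u, (k < N)%N -> T k (sp k p) u = T k p.2 u.
Hypothesis T_old : forall k l p u, (l < N)%N -> l != k -> T l (sp k p) u = T l p.1 u.
Hypothesis th_fresh : forall k p u, (k < N)%N -> th k (sp k p) u = th k p.2 u.
Hypothesis th_old : forall k l p u, (l < N)%N -> l != k -> th l (sp k p) u = th l p.1 u.
Hypothesis th_ge0 : forall k s u, 0 <= th k s u.
Hypothesis T_dist : forall k s u v, (k < N)%N ->
  enorm (T k s u - T k s v) <= enorm (u - v) + th k s u + th k s v.
Hypothesis T_mean : forall k u v, (k < N)%N ->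
  mean_le Q (fun s => enorm (T k s u - J v) ^+ 2)
    ((1 + rho) * enorm (u - v) ^+ 2 + c k + 2 * rho * enorm (v - J v) ^+ 2).
Hypothesis th_mean : forall k u, (k < N)%N ->
  mean_le Q (fun s => th k s u ^+ 2) (kappa * (enorm (u - xstar) ^+ 2 + c k)).
Hypothesis mJ : measurable_fun setT J.
Hypothesis J_nonexp : forall u v, enorm (J u - J v) <= enorm (u - v).
Hypothesis J_fix : J xstar = xstar.
Hypothesis J_firm : forall v, 0 <= edot (v - J v) (J v - xstar).
Hypothesis J_residual : forall v, enorm (v - J v) <= enorm (v - xstar).
Hypothesis x0D : enorm (x0 - xstar) <= D.
Hypothesis rho_ge0 : 0 <= rho.
Hypothesis c_ge0 : forall k, 0 <= c k.

Local Notation X k s := (outer_x N x0 (fun l => T l s) k).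
Local Notation Z k s := (outer_z N x0 (fun l => T l s) k).

Lemma measurable_outer k : (k <= N)%N ->
  measurable_fun setT (fun s => X k s) /\ measurable_fun setT (fun s => Z k s).
Proof.
elim: k => [|k ih] kN; first by split; exact: measurable_cst.
have [mX mZ] := ih (ltnW kN).
have mZ' : measurable_fun setT (fun s => Z k.+1 s).
  under eq_fun do rewrite outer_zS.
  exact: (measurableT_comp (mT kN) (measurable_fun_pair (@measurable_id _ _ setT) mX)).
split => //; under eq_fun do rewrite outer_xS.
by apply: measurable_rVD => //; apply: measurable_rVZ; exact: measurable_rVB.
Qed.

Lemma outer_old k l p : (l <= k)%N -> (k < N)%N ->
  X l (sp k p) = X l p.1 /\ Z l (sp k p) = Z l p.1.
Proof.
move=> lk kN; rewrite /outer_x /outer_z.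
rewrite (@eq_outer_iter _ _ N x0 _ (fun m => T m p.1) l) => // m ml u.
by apply: T_old; [lia|rewrite ltn_eqF //; lia].
Qed.

(* Conditioning on everything but the samples of step k. *)
Lemma mean_le_fresh k (f : S -> 'rV[R]_n -> R) (g : S -> 'rV[R]_n)
    (h : 'rV[R]_n -> R) r :
  measurable_fun [set: S * 'rV[R]_n] (fun p => f p.1 p.2) ->
  (forall s u, 0 <= f s u) -> measurable_fun setT g ->
  (forall p u, f (sp k p) u = f p.2 u) -> (forall p, g (sp k p) = g p.1) ->
  (forall u, mean_le Q (f ^~ u) (h u)) -> mean_le Q (h \o g) r ->
  mean_le Q (fun s => f s (g s)) r.
Proof.
move=> mf f0 mg fsp gsp fh hr.
have mfg : measurable_fun setT (fun s => f s (g s)).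
  exact: (measurableT_comp mf (measurable_fun_pair (@measurable_id _ _ setT) mg)).
apply: (mean_le_of_law (msp k) (law_sp k) mfg) => //.
apply: (mean_le_prod (h := h \o g)) => //.
- exact: measurableT_comp mfg (msp k).
- by move=> p; exact: f0.
- move=> s1; have -> : (fun y => ((fun s => f s (g s)) \o sp k) (s1, y)) = f ^~ (g s1).
    by apply/funext => s2 /=; rewrite fsp gsp.
  exact: fh.
Qed.

(** Bounds the mean squares of both z_k - xstar and x_k - xstar: the former by [T_mean] at the fixed
    point, the latter by convexity. *)
Fixpoint moment k : R := if k is l.+1 then (1 + rho) * moment l + c l else D ^+ 2.

Lemma moment_ge0 k : 0 <= moment k.
Proof.
elim: k => [|k ih] /=; first exact: sqr_ge0.
by rewrite addr_ge0 // mulr_ge0 // addr_ge0.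
Qed.

Lemma moment_le k l : (k <= l)%N -> moment k <= moment l.
Proof.
elim: l => [|l ih]; first by rewrite leqn0 => /eqP ->.
rewrite leq_eqVlt => /predU1P[->//|]; rewrite ltnS => /ih kl.
apply: le_trans kl _ => /=; have := moment_ge0 l; have := c_ge0 l.
by move=> c0 m0; have := mulr_ge0 rho_ge0 m0; lra.
Qed.

Lemma measurable_T_enorm k (g : 'rV[R]_n -> 'rV[R]_n) : (k < N)%N ->
  measurable_fun setT g ->
  measurable_fun [set: S * 'rV[R]_n] (fun p => enorm (T k p.1 p.2 - g p.2) ^+ 2).
Proof.
move=> kN mg; apply: measurable_enorm_sqr; apply: measurable_rVB; first exact: mT.
exact: measurableT_comp mg measurable_snd.
Qed.

Lemma mean_le_outer_x_of_z k : (k < N)%N ->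
  (forall m, (m <= k)%N -> mean_le Q (fun s => enorm (Z m s - xstar) ^+ 2) (moment m)) ->
  mean_le Q (fun s => enorm (X k s - xstar) ^+ 2) (moment k).
Proof.
move=> kN zm; have [a [a0 a1 ax]] := @outer_x_convex R n N x0 k kN.
have h : mean_le Q (fun s => \sum_(m < k.+1) a m * enorm (Z m s - xstar) ^+ 2)
    (\sum_(m < k.+1) a m * moment k).
  apply: mean_le_sum => m; apply: mean_leZ => //.
  by apply: mean_leW (zm m _); [apply: moment_le|]; rewrite -ltnS.
rewrite -mulr_suml a1 mul1r in h; apply: mean_le_trans h.
  apply: measurable_enorm_sqr; apply: measurable_rVB => //.
  by have [] := measurable_outer (ltnW kN).
move=> s; rewrite sqr_ge0 ax /=.
exact: (enorm_sqr_jensen (fun m : 'I_k.+1 => Z m s)).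
Qed.

Lemma mean_le_outer_z k : (k <= N)%N ->
  mean_le Q (fun s => enorm (Z k s - xstar) ^+ 2) (moment k).
Proof.
elim/ltn_ind: k => -[_ _|k ih kN].
  apply: mean_leW (mean_le_cst Q (sqr_ge0 (enorm (x0 - xstar)))).
  by rewrite /= ler_sqr ?nnegrE ?enorm_ge0 // (le_trans _ x0D) ?enorm_ge0.
have Xk : mean_le Q (fun s => enorm (X k s - xstar) ^+ 2) (moment k).
  by apply: mean_le_outer_x_of_z => // m mk; apply: ih; lia.
have -> : (fun s => enorm (Z k.+1 s - xstar) ^+ 2) =
    (fun s => enorm (T k s (X k s) - xstar) ^+ 2).
  by apply/funext => s; rewrite outer_zS.
apply: (mean_le_fresh (k := k) (f := fun s u => enorm (T k s u - xstar) ^+ 2)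
  (h := fun u => (1 + rho) * enorm (u - xstar) ^+ 2 + c k)).
- exact: (measurable_T_enorm kN (measurable_cst xstar)).
- by move=> s u; exact: sqr_ge0.
- by have [] := measurable_outer (ltnW kN).
- by move=> p u; rewrite T_fresh.
- by move=> p; have [] := outer_old p (leqnn k) kN.
- move=> u; have := T_mean u xstar kN.
  by rewrite J_fix subrr enorm0 expr0n/= mulr0 addr0.
- apply: mean_leD; last exact: mean_le_cst.
  by apply: mean_leZ => //; rewrite addr_ge0.
Qed.

Lemma mean_le_outer_x k : (k < N)%N ->
  mean_le Q (fun s => enorm (X k s - xstar) ^+ 2) (moment k).
Proof.
move=> kN; apply: mean_le_outer_x_of_z => // m mk.
by apply: mean_le_outer_z; lia.
Qed.

(** Given the earlier samples x_k is fixed, so [T_mean] applies with both points equal to x_k. *)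
Lemma mean_le_step_error k : (k < N)%N ->
  mean_le Q (fun s => enorm (Z k.+1 s - J (X k s)) ^+ 2) (c k + 2 * rho * moment k).
Proof.
move=> kN; have -> : (fun s => enorm (Z k.+1 s - J (X k s)) ^+ 2) =
    (fun s => enorm (T k s (X k s) - J (X k s)) ^+ 2).
  by apply/funext => s; rewrite outer_zS.
apply: (mean_le_fresh (k := k) (f := fun s u => enorm (T k s u - J u) ^+ 2)
  (h := fun u => c k + 2 * rho * enorm (u - xstar) ^+ 2)).
- exact: (measurable_T_enorm kN mJ).
- by move=> s u; exact: sqr_ge0.
- by have [] := measurable_outer (ltnW kN).
- by move=> p u; rewrite T_fresh.
- by move=> p; have [] := outer_old p (leqnn k) kN.
- move=> u; have := T_mean u u kN.
  rewrite subrr enorm0 expr0n/= mulr0 add0r; apply: mean_leW.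
  rewrite lerD2l ler_wpM2l ?mulr_ge0 //.
  by rewrite ler_sqr ?nnegrE ?enorm_ge0.
- apply: mean_leD; first exact: mean_le_cst.
  by apply: mean_leZ; [rewrite mulr_ge0|exact: mean_le_outer_x].
Qed.

Hypothesis kappa_ge0 : 0 <= kappa.
Hypothesis N_gt0 : (0 < N)%N.

Lemma mean_le_drift k : (k < N)%N ->
  mean_le Q (fun s => th k s (X k s) ^+ 2) (kappa * (moment k + c k)).
Proof.
move=> kN; apply: (mean_le_fresh (k := k) (f := fun s u => th k s u ^+ 2)
  (h := fun u => kappa * (enorm (u - xstar) ^+ 2 + c k))).
- by apply: measurable_funX; exact: mth.
- by move=> s u; exact: sqr_ge0.
- by have [] := measurable_outer (ltnW kN).
- by move=> p u; rewrite th_fresh.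
- by move=> p; have [] := outer_old p (leqnn k) kN.
- by move=> u; exact: th_mean.
- apply: mean_leZ => //; apply: mean_leD; last exact: mean_le_cst.
  exact: mean_le_outer_x.
Qed.

Local Notation V s := (X N.-1 s).
Local Notation M := (moment N).

Let N1N : (N.-1 < N)%N. Proof. by rewrite prednK. Qed.

(** Mean square bound for the drift collected by two runs: N from Cauchy-Schwarz over the steps, 4
    from adding the drifts of the two runs. *)
Definition drift_total : R := 4 * N%:R * \sum_(l < N) kappa * (M + c l).

Section compare_with_last.
Variable k : nat.
Hypothesis kN : (k.+1 < N)%N.

Let kN' : (k < N)%N. Proof. exact: ltnW. Qed.

Let Q3 : probability (S * S * S)%type R := ((Q \x Q) \x Q)%E.

(** [fresh1] and [fresh2] share all samples outside step k and carry independent ones at step k;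
    [swap23] exchanges them. *)
Definition fresh1 (p : S * S * S) : S := sp k (p.1.1, p.2).
Definition fresh2 (p : S * S * S) : S := sp k p.1.

Lemma measurable_fresh1 : measurable_fun setT fresh1.
Proof.
exact: (measurableT_comp (msp k) (measurableT_comp measurable_fst (@measurable_swap23 _ S))).
Qed.

Lemma measurable_fresh2 : measurable_fun setT fresh2.
Proof. exact: measurableT_comp (msp k) measurable_fst. Qed.

Lemma law_fresh1 : has_law Q3 Q fresh1.
Proof.
move=> A mA; rewrite -(law_sp k mA); apply: law_proj13.
by rewrite -[Y in measurable Y]setTI; exact: msp.
Qed.

Lemma law_fresh2 : has_law Q3 Q fresh2.
Proof.
move=> A mA; rewrite -(law_sp k mA); apply: law_fst.
by rewrite -[Y in measurable Y]setTI; exact: msp.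
Qed.

Lemma measurable_V : measurable_fun setT (fun s => V s).
Proof. by have [] := measurable_outer (ltnW N1N). Qed.

Lemma mean_le_X l : (l < N)%N -> mean_le Q (fun s => enorm (X l s - xstar) ^+ 2) M.
Proof. by move=> lN; apply: mean_leW (mean_le_outer_x lN); apply: moment_le; exact: ltnW. Qed.

Lemma mean_le_residual : mean_le Q (fun s => enorm (V s - J (V s)) ^+ 2) M.
Proof.
apply: mean_le_trans (mean_le_X N1N).
  apply: measurable_enorm_sqr; apply: measurable_rVB; first exact: measurable_V.
  exact: measurableT_comp mJ measurable_V.
by move=> s; rewrite sqr_ge0 /= ler_sqr ?nnegrE ?enorm_ge0.
Qed.

Lemma mean_le_to_last : mean_le Q (fun s => enorm (X k s - V s) ^+ 2) (4 * M).
Proof.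
have h := mean_leZ (ler0n R 2) (mean_leD (mean_le_X kN') (mean_le_X N1N)).
have -> : 4 * M = 2 * (M + M) by ring.
apply: mean_le_trans h.
  apply: measurable_enorm_sqr; apply: measurable_rVB; last exact: measurable_V.
  by have [] := measurable_outer (ltnW kN').
move=> s; rewrite sqr_ge0 /= (enorm_distC (V s) xstar).
exact: enorm_sqr_triangle.
Qed.

Let a := fine ('E_Q[fun s => (enorm (X k s - V s) ^+ 2)%R])%E.

Let measurable_Zk : measurable_fun setT (fun s => Z k.+1 s).
Proof. by have [] := measurable_outer (ltnW kN). Qed.

Let measurable_JV : measurable_fun setT (fun s => J (V s)).
Proof. exact: measurableT_comp mJ measurable_V. Qed.

(** The point V of the second path is independent of the step-k samples of the first path, so
    [T_mean] applies conditionally with that V as reference. *)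
Lemma mean_le_cross : mean_le Q3
  (fun p => enorm (Z k.+1 (fresh1 p) - J (V (fresh2 p))) ^+ 2)
  ((1 + rho) * a + c k + 2 * rho * M).
Proof.
have r2 : 0 <= 2 * rho by rewrite mulr_ge0.
have r1 : 0 <= 1 + rho by rewrite addr_ge0.
pose H s := (1 + rho) * enorm (X k s - V s) ^+ 2 + c k + 2 * rho * enorm (V s - J (V s)) ^+ 2.
have HH : mean_le Q H ((1 + rho) * a + c k + 2 * rho * M).
  apply: mean_leD; last exact: mean_leZ mean_le_residual.
  apply: mean_leD; last exact: mean_le_cst.
  by apply: mean_leZ => //; exact: mean_le_fine mean_le_to_last.
apply: (mean_le_prod (mu := (Q \x Q)%E) (nu := Q) (h := H \o sp k)).
- apply: measurable_enorm_sqr; apply: measurable_rVB.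
    exact: measurableT_comp measurable_Zk measurable_fresh1.
  exact: measurableT_comp measurable_JV measurable_fresh2.
- by move=> p; exact: sqr_ge0.
- move=> q; have [Xq _] := outer_old q (leqnn k) kN'.
  have -> : (fun y => enorm (Z k.+1 (fresh1 (q, y)) - J (V (fresh2 (q, y)))) ^+ 2) =
      (fun y => enorm (T k y (X k q.1) - J (V (sp k q))) ^+ 2).
    apply/funext => y; rewrite outer_zS /fresh1 /fresh2 T_fresh //=.
    by have [-> _] := outer_old (q.1, y) (leqnn k) kN'.
  by rewrite /H /= -Xq; exact: T_mean.
- exact: mean_le_law (msp k) (law_sp k) HH.
Qed.

(** x_k is common to both paths, and each output is close to J x_k. *)
Lemma mean_le_gap : mean_le Q3
  (fun p => enorm (Z k.+1 (fresh1 p) - Z k.+1 (fresh2 p)) ^+ 2) (4 * (c k + 2 * rho * M)).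
Proof.
have e : mean_le Q (fun s => enorm (Z k.+1 s - J (X k s)) ^+ 2) (c k + 2 * rho * M).
  apply: mean_leW (mean_le_step_error kN'); rewrite lerD2l ler_wpM2l ?mulr_ge0 //.
  by apply: moment_le; exact: ltnW.
have e1 := mean_le_law measurable_fresh1 law_fresh1 e.
have e2 := mean_le_law measurable_fresh2 law_fresh2 e.
have -> : 4 * (c k + 2 * rho * M) = 2 * ((c k + 2 * rho * M) + (c k + 2 * rho * M)) by ring.
apply: mean_le_trans (mean_leZ (ler0n R 2) (mean_leD e1 e2)).
  apply: measurable_enorm_sqr; apply: measurable_rVB.
    exact: measurableT_comp measurable_Zk measurable_fresh1.
  exact: measurableT_comp measurable_Zk measurable_fresh2.
move=> p; rewrite sqr_ge0 /=.
have [-> _] := outer_old (p.1.1, p.2) (leqnn k) kN'.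
have [-> _] := outer_old p.1 (leqnn k) kN'.
rewrite (enorm_distC (Z k.+1 (fresh2 p))); exact: enorm_sqr_triangle.
Qed.

(** The gap created at step k reaches V enlarged by drift only; it is squared together with the
    drift sum by Cauchy-Schwarz. *)
Lemma mean_le_stability : mean_le Q3
  (fun p => enorm (V (fresh1 p) - V (fresh2 p)) ^+ 2)
  (2 * (4 * (c k + 2 * rho * M) + drift_total)).
Proof.
pose t1 l p := th l (fresh1 p) (X l (fresh1 p)).
pose t2 l p := th l (fresh2 p) (X l (fresh2 p)).
have M0 : 0 <= M := moment_ge0 N.
have tQ l : (l < N)%N -> mean_le Q (fun s => th l s (X l s) ^+ 2) (kappa * (M + c l)).
  move=> lN; apply: mean_leW (mean_le_drift lN); rewrite ler_wpM2l // lerD2r.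
  by apply: moment_le; exact: ltnW.
have t12 l : (l < N)%N -> mean_le Q3 (fun p => (t1 l p + t2 l p) ^+ 2) (4 * (kappa * (M + c l))).
  move=> lN; have h1 := mean_le_law measurable_fresh1 law_fresh1 (tQ l lN).
  have h2 := mean_le_law measurable_fresh2 law_fresh2 (tQ l lN).
  have -> : 4 * (kappa * (M + c l)) = 2 * (kappa * (M + c l) + kappa * (M + c l)) by ring.
  apply: mean_le_trans (mean_leZ (ler0n R 2) (mean_leD h1 h2)).
    have mt : measurable_fun setT (fun s => th l s (X l s)).
      have [mX _] := measurable_outer (ltnW lN).
      exact: (measurableT_comp (mth lN) (measurable_fun_pair (@measurable_id _ _ setT) mX)).
    apply: measurable_funX; apply: measurable_funD.
      exact: measurableT_comp mt measurable_fresh1.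
    exact: measurableT_comp mt measurable_fresh2.
  move=> p; rewrite sqr_ge0 /= -/(t1 l p) -/(t2 l p).
  by have := sqr_ge0 (t1 l p - t2 l p); lra.
have sumt : mean_le Q3 (fun p => N.-1%:R * \sum_(l < N.-1) (t1 l p + t2 l p) ^+ 2) drift_total.
  have := mean_leZ (ler0n R N.-1) (mean_le_sum (index_enum 'I_N.-1)
    (fun l : 'I_N.-1 => t12 l (ltn_trans (ltn_ord l) N1N))).
  apply: mean_leW; rewrite /drift_total (mulrC 4) -mulrA; apply: ler_pM => //.
  - by apply: sumr_ge0 => l _; rewrite !mulr_ge0 ?addr_ge0.
  - by rewrite ler_nat leq_pred.
  rewrite -mulr_sumr ler_wpM2l //.
  have -> : \sum_(l < N) kappa * (M + c l) =
      \sum_(l < N.-1) kappa * (M + c l) + kappa * (M + c N.-1).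
    move: (fun l => kappa * (M + c l)) => F.
    by move: N_gt0; case: (N) => // N' _; rewrite big_ord_recr.
  by rewrite lerDl mulr_ge0 ?addr_ge0.
have h := mean_leZ (ler0n R 2) (mean_leD mean_le_gap sumt).
apply: mean_le_trans h.
  apply: measurable_enorm_sqr; apply: measurable_rVB.
    exact: measurableT_comp measurable_V measurable_fresh1.
  exact: measurableT_comp measurable_V measurable_fresh2.
move=> p; rewrite sqr_ge0 /=.
set g := enorm (Z k.+1 _ - _); set sm := \sum_(l < N.-1) (t1 l p + t2 l p).
have Vd : enorm (V (fresh1 p) - V (fresh2 p)) <= g + sm.
  apply: outer_x_dist => // m mN.
  have := @outer_z_stable R n N x0 (fun l => T l (fresh1 p)) (fun l => T l (fresh2 p))
    (t1 ^~ p) (t2 ^~ p) k m.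
  move=> /(_ _ _ _ _)/le_trans; apply.
  - by apply: leq_trans mN _; exact: ltnW.
  - by move=> l; exact: th_ge0.
  - by move=> l; exact: th_ge0.
  - move=> l lN lk; rewrite /t1 /t2 /fresh1 /fresh2.
    have -> : T l (sp k p.1) = T l (sp k (p.1.1, p.2)).
      by apply/funext => u; rewrite !T_old.
    have -> : th l (sp k p.1) (X l (sp k p.1)) =
        th l (sp k (p.1.1, p.2)) (X l (sp k p.1)) by rewrite !th_old.
    exact: T_dist.
  - rewrite lerD2l /sm -(subnKC mN) big_split_ord/= lerDl.
    by apply: sumr_ge0 => l _; rewrite addr_ge0 // th_ge0.
have g0 : 0 <= g := enorm_ge0 _.
have sm0 : 0 <= sm by apply: sumr_ge0 => l _; rewrite addr_ge0 // th_ge0.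
apply: (@le_trans _ _ ((g + sm) ^+ 2)).
  by rewrite ler_sqr ?nnegrE ?enorm_ge0 ?addr_ge0.
have := sqr_sum_le N.-1 (fun l => t1 l p + t2 l p); rewrite -/sm.
by have := sqr_ge0 (g - sm); lra.
Qed.

(* The samples of step k and an independent copy of them are exchangeable, so
   the point J(V), which depends on the samples of step k, can be traded for one
   that does not at a cost of second order in the noise. *)
Lemma mean_le_compare_with_last :
  mean_le Q (fun s => enorm (Z k.+1 s - J (V s)) ^+ 2)
    (a + (7 * c k + 18 * rho * M + drift_total)).
Proof.
pose A s := enorm (Z k.+1 s - J (V s)) ^+ 2.
have mA : measurable_fun setT A.
  by apply: measurable_enorm_sqr; apply: measurable_rVB.
have A0 s : 0 <= A s by exact: sqr_ge0.
have cross := mean_le_cross; have cross' := mean_le_swap23 cross.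
have mA1 := measurableT_comp mA measurable_fresh1.
have mA2 := measurableT_comp mA measurable_fresh2.
have bound := mean_leD (mean_leD cross cross') (mean_leD mean_le_gap mean_le_stability).
have h : mean_le Q3 (fun p => (A \o fresh1) p + (A \o fresh2) p)
    (((1 + rho) * a + c k + 2 * rho * M + ((1 + rho) * a + c k + 2 * rho * M))
     + (4 * (c k + 2 * rho * M) + 2 * (4 * (c k + 2 * rho * M) + drift_total))).
  apply: mean_le_trans bound.
    exact: measurable_funD.
  move=> p; rewrite addr_ge0 ?A0 //= /A.
  have -> : fresh1 (swap23 p) = fresh2 p by case: p => -[].
  have -> : fresh2 (swap23 p) = fresh1 p by case: p => -[].
  have JV : enorm (J (V (fresh1 p)) - J (V (fresh2 p))) ^+ 2 <=
      enorm (V (fresh1 p) - V (fresh2 p)) ^+ 2.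
    by rewrite ler_sqr ?nnegrE ?enorm_ge0.
  apply: le_trans (lerD (lexx _) (lerD (lexx _) JV)).
  move: (Z k.+1 (fresh1 p)) (Z k.+1 (fresh2 p)) (J (V (fresh1 p))) (J (V (fresh2 p))).
  (* Matched minus crossed squares equal -2 <z - z', t - t'>, at most |z - z'|^2 + |t - t'|^2. *)
  move=> z z' t t'; have := edot_ge0 (z - z' + (t - t')).
  rewrite !sqr_enorm !edotE.
  rewrite !(edotC z' z) !(edotC t z) !(edotC t z') !(edotC t' z) !(edotC t' z') !(edotC t' t).
  by lra.
split; [exact: mA|exact: A0|].
have [_ _] := h.
rewrite (ge0_expectationD _ mA1 (fun p => A0 _) mA2 (fun p => A0 _)).
rewrite (expectation_law measurable_fresh1 law_fresh1 mA A0).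
rewrite (expectation_law measurable_fresh2 law_fresh2 mA A0).
(* Halving the symmetric bound gives (1 + rho) a + 7 c_k + 14 rho M plus drift; rho a <= 4 rho M
   turns 14 into 18. *)
have a4 : a <= 4 * M by exact: fine_mean_le mean_le_to_last.
have ra := ler_wpM2l rho_ge0 a4.
case: ('E_Q[A])%E (expectation_ge0 Q A0) => [r|//|//] _.
by rewrite -EFinD !lee_fin; lra.
Qed.

End compare_with_last.

(** Averaging the pathwise bound puts w_k E|x_k - v|^2 on both sides with equal coefficients; these
    finite terms cancel and only the errors remain. *)
Lemma mean_le_outer_residual :
  mean_le Q (fun s => enorm (V s - J (V s)) ^+ 2)
    (4 * D ^+ 2 / N%:R ^+ 2 + 2 * \sum_(k < N.-1) ((N - k)%:R * (N - k.+1)%:R)^-1 *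
      (7 * c k + 18 * rho * M + drift_total)).
Proof.
pose w k : R := ((N - k)%:R * (N - k.+1)%:R)^-1.
have w0 k : 0 <= w k by rewrite invr_ge0 mulr_ge0.
have kN (k : 'I_N.-1) : (k.+1 < N)%N by have := ltn_ord k; lia.
pose e k := 7 * c k + 18 * rho * M + drift_total.
pose a k := fine ('E_Q[fun s => (enorm (X k s - V s) ^+ 2)%R])%E.
have right := mean_leD (mean_le_cst Q (_ : 0 <= 2 * D ^+ 2 / N%:R ^+ 2))
  (mean_le_sum (index_enum 'I_N.-1)
    (fun k : 'I_N.-1 => mean_leZ (w0 k) (mean_le_compare_with_last (kN k)))).
have {}right := right (divr_ge0 (mulr_ge0 (ler0n R 2) (sqr_ge0 D)) (sqr_ge0 _)).
have res := mean_le_residual.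
have sumX := mean_le_sum (index_enum 'I_N.-1)
    (fun k : 'I_N.-1 => mean_leZ (w0 k) (mean_le_to_last (kN k))).
have half0 : 0 <= 1 / 2 :> R by [].
have [mr r0 _] := mean_leZ half0 res.
have [ms s0 _] := sumX.
have left : mean_le Q (fun s => 1 / 2 * enorm (V s - J (V s)) ^+ 2 +
    \sum_(k < N.-1) w k * enorm (X k s - V s) ^+ 2)
  (2 * D ^+ 2 / N%:R ^+ 2 + \sum_(k < N.-1) w k * (a k + e k)).
  apply: mean_le_trans right; first exact: measurable_funD.
  move=> s; rewrite addr_ge0 //=.
  by apply: outer_residual_le.
split; [by case: res|by move=> s; exact: sqr_ge0|].
have [_ _] := left; rewrite (ge0_expectationD _ mr r0 ms s0).
have [mres res0 _] := res; rewrite (ge0_expectationZl _ half0 mres res0).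
have wsum := @expectation_wsum _ _ _ Q _ (index_enum 'I_N.-1) (fun k : 'I_N.-1 => w k)
  (fun k s => enorm (X k s - V s) ^+ 2) (fun=> 4 * M) (fun k : 'I_N.-1 => w0 k)
  (fun k => mean_le_to_last (kN k)).
rewrite wsum.
have -> : \sum_(k < N.-1) w k * (a k + e k) =
    \sum_(k < N.-1) w k * a k + \sum_(k < N.-1) w k * e k.
  by rewrite -big_split; apply: eq_bigr => k _; rewrite mulrDr.
rewrite (fine_meanK res) -EFinM -EFinD !lee_fin -/(a _).
move: (fine _) => r; rewrite /a.
move: (\sum_(k < N.-1) w k * e k); rewrite -/w => E.
move: (\sum_(k < N.-1) _) => Y; lra.
Qed.

End outer_mean.

(** * Logarithmic sums *)

Section log_sums.
Context {R : realType}.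
Variable N : nat.
Hypothesis N_gt0 : (0 < N)%N.

Definition logratio (i : nat) : R := ln (expR 1 * N%:R / i%:R).

Local Notation lam := (ln (expR 1 * N%:R : R)).

Let Nr : 0 < N%:R :> R. Proof. by rewrite ltr0n. Qed.
Let e0 : 0 < expR 1 :> R. Proof. exact: expR_gt0. Qed.

Lemma ln_eN : lam = 1 + ln N%:R.
Proof. by rewrite lnM ?posrE // expRK. Qed.

Lemma logratioE i : (0 < i)%N -> logratio i = 1 + ln N%:R - ln i%:R.
Proof.
by move=> i0; rewrite /logratio ln_div ?posrE ?mulr_gt0 ?ltr0n // ln_eN.
Qed.

Lemma logratio1 : logratio 1 = lam.
Proof. by rewrite /logratio divr1. Qed.

Lemma logratio_ge1 i : (0 < i <= N)%N -> 1 <= logratio i.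
Proof.
move=> /andP[i0 iN]; rewrite logratioE // -addrA lerDl subr_ge0.
by rewrite ler_ln ?posrE ?ltr0n // ler_nat.
Qed.

Lemma lam_ge1 : 1 <= lam.
Proof. by rewrite -logratio1; apply: logratio_ge1; rewrite N_gt0. Qed.

(** Discrete form of the fact that -2 sqrt(log(eN/i)) has derivative 1 / (i sqrt(log(eN/i))). With
    a, b the two roots, 1/(2i) <= a^2 - b^2 <= (a - b) (5/2) b, which gives the constant 5. *)
Lemma inv_le_sqrt_logratio_diff i : (0 < i < N)%N ->
  (i%:R * Num.sqrt (logratio i.+1))^-1 <=
  5 * (Num.sqrt (logratio i) - Num.sqrt (logratio i.+1)) :> R.
Proof.
move=> /andP[i0 iN].
have ir : 0 < i%:R :> R by rewrite ltr0n.
have i1r : 1 <= i%:R :> R by rewrite ler1n.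
set a := Num.sqrt (logratio i); set b := Num.sqrt (logratio i.+1).
have lb : 1 <= logratio i.+1 by apply: logratio_ge1.
have la : 1 <= logratio i by apply: logratio_ge1; rewrite i0 ltnW.
have a2 : a ^+ 2 = logratio i by rewrite sqr_sqrtr //; lra.
have b2 : b ^+ 2 = logratio i.+1 by rewrite sqr_sqrtr //; lra.
have b1 : 1 <= b by rewrite -sqrtr1 ler_sqrt //; lra.
have a0 : 0 <= a by exact: sqrtr_ge0.
have lab : a ^+ 2 - b ^+ 2 = ln i.+1%:R - ln i%:R.
  by rewrite a2 b2 !logratioE //; ring.
have l_le : ln i.+1%:R - ln i%:R <= i%:R^-1 :> R.
  rewrite -ln_div ?posrE ?ltr0n //.
  have -> : i.+1%:R / i%:R = 1 + i%:R^-1 :> R by rewrite -natr1; field; rewrite gt_eqF.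
  by apply: le_ln1Dx; apply: lt_trans (_ : 0 < _); rewrite ?invr_gt0 // ltrN10.
have l_ge : (i%:R + 1)^-1 <= ln i.+1%:R - ln i%:R :> R.
  rewrite -[leRHS]opprB -ln_div ?posrE ?ltr0n // -lerN2 opprK.
  have -> : i%:R / i.+1%:R = 1 + (- (i%:R + 1)^-1) :> R.
    by rewrite -natr1; field; rewrite gt_eqF //; lra.
  apply: le_ln1Dx; rewrite ltrN2 invf_lt1 //; lra.
have i_inv : 2^-1 * i%:R^-1 <= (i%:R + 1)^-1 :> R.
  by rewrite -invfM lef_pV2 ?posrE ?mulr_gt0 //; lra.
have ii : i%:R^-1 <= 1 :> R by rewrite invf_le1.
rewrite invfM ler_pdivrMr; last by lra.
move: (i%:R^-1) lab l_le l_ge i_inv ii => v lab l_le l_ge i_inv ii.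
(* a^2 <= b^2 + 1/i <= 2 b^2 <= (9/4) b^2. *)
have a_le : a <= 3 / 2 * b.
  rewrite -ler_sqr ?nnegrE //; last by lra.
  by nra.
have : a ^+ 2 - b ^+ 2 <= (a - b) * (5 / 2 * b).
  have ab : 0 <= a - b.
    rewrite subr_ge0 ler_sqrt //; last by lra.
    by rewrite -a2 -b2 -subr_ge0 lab; apply: le_trans l_ge; rewrite invr_ge0; lra.
  have -> : a ^+ 2 - b ^+ 2 = (a - b) * (a + b) by ring.
  by rewrite ler_wpM2l //; lra.
lra.
Qed.

Lemma sum_inv_sqrt_logratio_le :
  \sum_(k < N.-1) ((N - k.+1)%:R * Num.sqrt (logratio (N - k)))^-1 <=
  5 * Num.sqrt lam :> R.
Proof.
suff h m : (m <= N.-1)%N ->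
    \sum_(k < m) ((N - k.+1)%:R * Num.sqrt (logratio (N - k)))^-1 <=
    5 * (Num.sqrt (logratio (N - m)) - 1) :> R.
  apply: le_trans (h _ (leqnn _)) _; rewrite ler_pM2l //.
  have -> : (N - N.-1)%N = 1%N by lia.
  by rewrite logratio1 lerBlDr lerDl.
elim: m => [_|m ih mN].
  rewrite big_ord0 mulr_ge0 // subr_ge0 -[leLHS]sqrtr1 ler_sqrt //.
    by apply: logratio_ge1; rewrite subn0 N_gt0 /=.
  by apply: le_trans ler01 _; apply: logratio_ge1; rewrite subn0 N_gt0 /=.
rewrite big_ord_recr/=.
have cond : (0 < N - m.+1 < N)%N by lia.
have := inv_le_sqrt_logratio_diff cond.
have -> : (N - m.+1).+1 = (N - m)%N by lia.
by move: (ih (ltnW mN)); lra.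
Qed.

Lemma sum_inv_pair : \sum_(k < N.-1) ((N - k)%:R * (N - k.+1)%:R)^-1 <= 1 :> R.
Proof.
suff h m : (m <= N.-1)%N ->
    \sum_(k < m) ((N - k)%:R * (N - k.+1)%:R)^-1 = (N - m)%:R^-1 - N%:R^-1 :> R.
  rewrite h //; have -> : (N - N.-1)%N = 1%N by lia.
  by rewrite invr1 gerBl invr_ge0.
elim: m => [_|m ih mN]; first by rewrite big_ord0 subn0 subrr.
rewrite big_ord_recr/= ih; last exact: ltnW.
have -> : (N - m)%N = (N - m.+1).+1 by lia.
have : 0 < (N - m.+1)%:R :> R by rewrite ltr0n; lia.
rewrite -natr1; move: ((N - m.+1)%:R) => a a0.
by field; rewrite !gt_eqF //; lra.
Qed.

End log_sums.

(** * Error bounds for the chosen parameters *)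

Section parameter_bounds.
Context {R : realType}.
Variables (L D sigma eps : R).
Hypothesis L0 : 0 < L.
Hypothesis D0 : 0 <= D.
Hypothesis s0 : 0 < sigma.
Hypothesis eps0 : 0 < eps.

Local Notation N := (horizon L D eps).
Local Notation rho := (tolerance L D eps).
Local Notation lam := (ln (expR 1 * N%:R : R)).

Lemma horizon_ge2 : (2 <= N)%N.
Proof. exact: leq_maxl. Qed.

Lemma le_natr_ceil (x : R) : x <= `|Num.ceil x|%N%:R.
Proof. by apply: le_trans (ceil_ge x) _; rewrite natr_absz ler_int ler_norm. Qed.

Lemma natr_ceil_le (x : R) : 0 <= x -> `|Num.ceil x|%N%:R <= x + 1.
Proof.
move=> x0; rewrite natr_absz ger0_norm; last first.
  by rewrite ceil_ge0 (lt_le_trans _ x0) // ltrN10.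
by have := ceilB1_lt x; rewrite intrB; lra.
Qed.

Lemma horizon_ge : 32 * L * D / eps <= N%:R.
Proof.
by apply: le_trans (le_natr_ceil _) _; rewrite ler_nat leq_maxr.
Qed.

Let Nr2 : 2 <= N%:R :> R. Proof. by rewrite ler_nat horizon_ge2. Qed.
Let Nr : 0 < N%:R :> R. Proof. by apply: lt_le_trans Nr2. Qed.
Let Ngt0 : (0 < N)%N. Proof. exact: leq_trans horizon_ge2. Qed.

Lemma tolerance_bounds : 0 < rho <= 1 / 16.
Proof.
rewrite /tolerance divr_gt0 ?mulr_gt0 ?exprn_gt0 //=.
rewrite !div1r lef_pV2 ?posrE ?mulr_gt0 ?exprn_gt0 //.
have : 2 ^+ 3 <= N%:R ^+ 3 :> R by rewrite lerXn2r ?nnegrE.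
by rewrite !exprS expr0; lra.
Qed.

Definition budget_real (k : nat) : R :=
  1024 * sigma ^+ 2 / (eps ^+ 2 * (N - k)%:R) * Num.sqrt (lam * logratio N (N - k)).

Lemma budget_real_ge0 k : 0 <= budget_real k.
Proof.
apply: mulr_ge0; last exact: sqrtr_ge0.
apply: divr_ge0; apply: mulr_ge0; by [exact: ler0n|exact: sqr_ge0].
Qed.

Lemma budget_gt0 k : (0 < budget L D sigma eps k)%N.
Proof. exact: leq_maxl. Qed.

Lemma budget_ge k : budget_real k <= (budget L D sigma eps k)%:R.
Proof. by apply: le_trans (le_natr_ceil _) _; rewrite ler_nat leq_maxr. Qed.

Lemma budget_le k : (budget L D sigma eps k)%:R <= 1 + budget_real k.
Proof.
have b0 := budget_real_ge0 k.
rewrite /budget -/(budget_real k) /maxn; case: ifP => _; last first.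
  by rewrite lerDl.
by rewrite addrC; exact: natr_ceil_le.
Qed.

(* In this unit, 32 L D / eps <= N reads D^2 <= N^2 u, and the target eps^2 is
   1024 L^2 u. *)
Definition unit_error : R := eps ^+ 2 / (1024 * L ^+ 2).

Local Notation u := unit_error.

Lemma unit_error_gt0 : 0 < u.
Proof.
apply: divr_gt0; first exact: exprn_gt0.
by apply: mulr_gt0; [rewrite ltr0n|exact: exprn_gt0].
Qed.

(** The variance term of [mean_le_resolvent] for the chosen step size and budget. *)
Definition noise_level (k : nat) : R :=
  5 * (stepsize L * sigma) ^+ 2 / (budget L D sigma eps k).+1%:R.

Local Notation c := noise_level.

Lemma noise_level_ge0 k : 0 <= c k.
Proof. by rewrite divr_ge0 // mulr_ge0 ?sqr_ge0. Qed.

(** Inserts the lower bound on the budget; 5/4 is 5 (alpha L)^2 with alpha L = 1/2. *)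
Lemma noise_level_le k : (k < N)%N ->
  c k <= 5 / 4 * u * (N - k)%:R / Num.sqrt (lam * logratio N (N - k)).
Proof.
move=> kN; have i0 : 0 < (N - k)%:R :> R by rewrite ltr0n subn_gt0.
have l1 : 1 <= lam by exact: lam_ge1.
have t1 : 1 <= logratio N (N - k) :> R.
  by apply: logratio_ge1 => //; rewrite subn_gt0 kN leq_subr.
set q := Num.sqrt _; have q0 : 0 < q by rewrite sqrtr_gt0 mulr_gt0 //; lra.
have B0 : 0 < (budget L D sigma eps k).+1%:R :> R by rewrite ltr0n.
rewrite ler_pdivlMr // [leLHS]mulrAC ler_pdivrMr // /stepsize /u.
have := budget_ge k; rewrite /budget_real -/q => hB.
have {hB} hB : 1024 * sigma ^+ 2 * q <= eps ^+ 2 * (N - k)%:R * (budget L D sigma eps k).+1%:R.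
  have e2 : 0 < eps ^+ 2 * (N - k)%:R by rewrite mulr_gt0 ?exprn_gt0.
  apply: (@le_trans _ _ ((budget L D sigma eps k)%:R * (eps ^+ 2 * (N - k)%:R))).
    by move: hB; rewrite mulrAC ler_pdivrMr.
  by rewrite mulrC ler_wpM2l ?ler_nat // ltW.
move: hB; move: (_.+1%:R) B0 ((N - k)%:R) i0 => b b0 i i0 hB.
have -> : 5 * (1 / (2 * L) * sigma) ^+ 2 * q =
  (5 / (4 * 1024 * L ^+ 2)) * (1024 * sigma ^+ 2 * q) by field; rewrite gt_eqF.
have -> : 5 / 4 * (eps ^+ 2 / (1024 * L ^+ 2)) * i * b =
  (5 / (4 * 1024 * L ^+ 2)) * (eps ^+ 2 * i * b) by field; rewrite gt_eqF.
apply: ler_wpM2l hB; apply: divr_ge0; first exact: ler0n.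
by apply: mulr_ge0; [apply: mulr_ge0; exact: ler0n|exact: sqr_ge0].
Qed.

Lemma noise_level_le_N k : (k < N)%N -> c k <= 5 / 4 * u * N%:R.
Proof.
move=> kN; apply: le_trans (noise_level_le kN) _.
have u0 := unit_error_gt0.
have l1 : 1 <= lam by exact: lam_ge1.
have t1 : 1 <= logratio N (N - k) :> R.
  by apply: logratio_ge1 => //; rewrite subn_gt0 kN leq_subr.
have q1 : 1 <= Num.sqrt (lam * logratio N (N - k)).
  rewrite -[leLHS]sqrtr1 ler_sqrt; last by rewrite mulr_ge0 //; lra.
  by rewrite -[leLHS]mulr1 ler_pM.
rewrite ler_pdivrMr; last by apply: lt_le_trans q1.
have u1 : 0 <= 5 / 4 * u by lra.
apply: (@le_trans _ _ (5 / 4 * u * N%:R)).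
  by rewrite ler_wpM2l // ler_nat leq_subr.
by rewrite ler_peMr // mulr_ge0.
Qed.

Lemma D_sqr_le : D ^+ 2 <= N%:R ^+ 2 * u.
Proof.
have h : 32 * L * D <= N%:R * eps by rewrite -ler_pdivrMr // horizon_ge.
have h2 : (32 * L * D) ^+ 2 <= (N%:R * eps) ^+ 2.
  by rewrite ler_sqr ?nnegrE ?mulr_ge0 // ltW.
have L2 : 0 < 1024 * L ^+ 2 by apply: mulr_gt0; [rewrite ltr0n|exact: exprn_gt0].
rewrite /u mulrA ler_pdivlMr //.
by rewrite !exprMn in h2; lra.
Qed.

Lemma moment_le_unit : moment D rho c N <= 13 / 5 * N%:R ^+ 2 * u.
Proof.
have u0 := unit_error_gt0; have /andP[r0 r1] := tolerance_bounds.
have rN : rho * N%:R <= 1 / 8.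
  have -> : rho * N%:R = 1 / (2 * N%:R ^+ 2).
    by rewrite /tolerance; field; rewrite gt_eqF.
  rewrite ler_pdivrMr ?mulr_gt0 ?exprn_gt0 //.
  have : 2 ^+ 2 <= N%:R ^+ 2 :> R by rewrite lerXn2r ?nnegrE.
  by rewrite expr2; lra.
have S0 k : 0 <= D ^+ 2 + \sum_(l < k) c l.
  by rewrite addr_ge0 ?sqr_ge0 // sumr_ge0 // => l _; exact: noise_level_ge0.
(* The linear factor dominates (1 + rho)^k as long as rho k <= 1/8, and then stays below 8/7. With
   D^2 <= N^2 u and noise at most 5/4 N^2 u the total is 8/7 * 9/4 <= 13/5. *)
have h k : (k <= N)%N ->
    moment D rho c k <= (1 + 8 / 7 * (rho * k%:R)) * (D ^+ 2 + \sum_(l < k) c l).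
  elim: k => [_|k ih kN]; first by rewrite /= big_ord0 !mulr0 !addr0 mul1r.
  rewrite /= big_ord_recr/= -natr1 addrA.
  have rk : rho * k%:R <= 1 / 8.
    by apply: le_trans rN; rewrite ler_pM2l // ler_nat ltnW.
  have rk0 : 0 <= rho * k%:R by rewrite mulr_ge0 // ltW.
  have h1 : (1 + rho) * moment D rho c k <=
      (1 + rho) * ((1 + 8 / 7 * (rho * k%:R)) * (D ^+ 2 + \sum_(l < k) c l)).
    by apply: ler_wpM2l; [lra|exact: ih (ltnW kN)].
  move: (S0 k) h1 (noise_level_ge0 k); move: (D ^+ 2 + _) => S SS0 h1 ck0.
  have h2 : (1 + rho) * (1 + 8 / 7 * (rho * k%:R)) <= 1 + 8 / 7 * (rho * (k%:R + 1)).
    by have := ler_wpM2l (ltW r0) rk; lra.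
  have h3 := ler_wpM2r SS0 h2.
  have h4 : 0 <= rho * (k%:R + 1) * c k.
    by apply: mulr_ge0 ck0; apply: mulr_ge0; [exact: ltW|rewrite addr_ge0].
  rewrite mulrA in h1; lra.
apply: le_trans (h N (leqnn _)) _.
have cs : \sum_(l < N) c l <= 5 / 4 * u * N%:R ^+ 2.
  apply: (@le_trans _ _ (\sum_(l < N) (5 / 4 * u * N%:R))).
    by apply: ler_sum => l _; exact: noise_level_le_N.
  by rewrite sumr_const card_ord -[leLHS]mulr_natr; lra.
have D2 := D_sqr_le.
apply: (@le_trans _ _ ((8 / 7) * (9 / 4 * (N%:R ^+ 2 * u)))).
  apply: ler_pM => //; [by rewrite addr_ge0 // mulr_ge0 // mulr_ge0 // ltW|lra|lra].
have Nu : 0 <= N%:R ^+ 2 * u by apply: mulr_ge0; [exact: sqr_ge0|exact: ltW].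
lra.
Qed.

Lemma tolerance_moment_le : rho * moment D rho c N <= 13 / 20 * u.
Proof.
have u0 := unit_error_gt0; have /andP[r0 r1] := tolerance_bounds.
apply: le_trans (ler_wpM2l (ltW r0) moment_le_unit) _.
have -> : rho * (13 / 5 * N%:R ^+ 2 * u) = 13 / 10 * u / N%:R.
  by rewrite /tolerance; field; rewrite gt_eqF.
by rewrite ler_pdivrMr //; have := ler_wpM2l (ltW u0) Nr2; lra.
Qed.

Lemma last_step_error_le : c N.-1 + 2 * rho * moment D rho c N <= 3 * u.
Proof.
have N1 : (N.-1 < N)%N by rewrite prednK.
have := noise_level_le N1; have -> : (N - N.-1)%N = 1%N by lia.
have l1 : 1 <= lam by exact: lam_ge1.
rewrite logratio1 -expr2 sqrtr_sqr ger0_norm ?mulr1; last by lra.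
have u0 := unit_error_gt0.
have : 5 / 4 * u / lam <= 5 / 4 * u.
  rewrite ler_pdivrMr; last by lra.
  by rewrite ler_peMr // mulr_ge0 // ltW.
have := tolerance_moment_le; lra.
Qed.

(** The tolerance enters squared, of order N^-6, against 4 N summed over N steps of moments of order
    N^2 u. *)
Lemma drift_total_le : drift_total N D rho (rho ^+ 2 / 256) c <= 1 / 10 * u.
Proof.
have u0 := unit_error_gt0; have /andP[r0 r1] := tolerance_bounds.
have M0 := moment_le_unit; have NN := Nr2.
rewrite /drift_total.
have k0 : 0 <= rho ^+ 2 / 256 by apply: divr_ge0; [exact: sqr_ge0|exact: ler0n].
apply: (@le_trans _ _ (4 * N%:R * \sum_(l < N) (rho ^+ 2 / 256 * (4 * N%:R ^+ 2 * u)))).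
  rewrite ler_wpM2l ?mulr_ge0 //; apply: ler_sum => l _; rewrite ler_wpM2l //.
  have := noise_level_le_N (ltn_ord l).
  have : u * N%:R * 2 <= u * N%:R * N%:R by rewrite ler_wpM2l // mulr_ge0 // ltW.
  have -> : u * N%:R * N%:R = N%:R ^+ 2 * u by ring.
  have Nu : 0 <= N%:R ^+ 2 * u by apply: mulr_ge0; [exact: sqr_ge0|exact: ltW].
  lra.
rewrite sumr_const card_ord.
have -> : 4 * N%:R * ((rho ^+ 2 / 256 * (4 * N%:R ^+ 2 * u)) *+ N) =
   u * (1 / 64 / N%:R ^+ 2) :> R.
  rewrite -[(_ * (4 * _ * _)) *+ _]mulr_natr.
  by rewrite /tolerance; field; rewrite gt_eqF.
rewrite mulrC ler_pM2r // ler_pdivrMr ?exprn_gt0 //.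
have : 2 ^+ 2 <= N%:R ^+ 2 :> R by rewrite lerXn2r ?nnegrE.
by rewrite expr2; lra.
Qed.

(** The constant collects 4 + 2 (175/4 + 12) = 115.5, where 175/4 = 7 * 5/4 * 5 is the noise and 12
    bounds the tolerance and drift terms. *)
Lemma residual_bound_le :
  4 * D ^+ 2 / N%:R ^+ 2 + 2 * \sum_(k < N.-1) ((N - k)%:R * (N - k.+1)%:R)^-1 *
    (7 * c k + 18 * rho * moment D rho c N + drift_total N D rho (rho ^+ 2 / 256) c)
  <= 116 * u.
Proof.
have u0 := unit_error_gt0.
have l1 : 1 <= lam by exact: lam_ge1.
set E := 18 * rho * _; set Th := drift_total _ _ _ _ _.
have w0 k : 0 <= ((N - k)%:R * (N - k.+1)%:R)^-1 :> R by rewrite invr_ge0 mulr_ge0.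
have ET : E + Th <= 12 * u.
  by have := tolerance_moment_le; have := drift_total_le; rewrite /E /Th; lra.
have D2 : 4 * D ^+ 2 / N%:R ^+ 2 <= 4 * u.
  by rewrite ler_pdivrMr ?exprn_gt0 //; have := D_sqr_le; lra.
(* The factor N - k of the noise level cancels one factor of w_k, leaving the summand of
   [sum_inv_sqrt_logratio_le]. *)
have term (k : 'I_N.-1) : ((N - k)%:R * (N - k.+1)%:R)^-1 * (7 * c k + E + Th) <=
  35 / 4 * u / Num.sqrt lam * ((N - k.+1)%:R * Num.sqrt (logratio N (N - k)))^-1
  + 12 * u * ((N - k)%:R * (N - k.+1)%:R)^-1.
  have kN1 : (k.+1 < N)%N by rewrite -ltn_predRL.
  have kN : (k < N)%N := ltnW kN1.
  have t1 : 1 <= logratio N (N - k) :> R.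
  by apply: logratio_ge1 => //; rewrite subn_gt0 kN leq_subr.
  have h := ler_wpM2l (w0 k) (noise_level_le kN).
  have h2 := ler_wpM2l (w0 k) ET.
  rewrite sqrtrM ?mulr_ge0 in h; last by lra.
  have q1 : 0 < Num.sqrt lam by rewrite sqrtr_gt0; lra.
  have q2 : 0 < Num.sqrt (logratio N (N - k)) :> R by rewrite sqrtr_gt0; lra.
  have i0 : 0 < (N - k)%:R :> R by rewrite ltr0n subn_gt0.
  have i1 : 0 < (N - k.+1)%:R :> R by rewrite ltr0n subn_gt0.
  have e : ((N - k)%:R * (N - k.+1)%:R)^-1 *
      (5 / 4 * u * (N - k)%:R / (Num.sqrt lam * Num.sqrt (logratio N (N - k)))) =
      5 / 4 * u / Num.sqrt lam * ((N - k.+1)%:R * Num.sqrt (logratio N (N - k)))^-1.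
    by field; rewrite !gt_eqF.
  rewrite e in h; move: h h2; lra.
have S := ler_sum _ (fun k _ => term k) : (\sum_(k < N.-1) _ <= _).
rewrite big_split/= -!mulr_sumr in S.
have h1 : 35 / 4 * u / Num.sqrt lam *
   \sum_(k < N.-1) ((N - k.+1)%:R * Num.sqrt (logratio N (N - k)))^-1 <= 175 / 4 * u.
  have q1 : 0 < Num.sqrt lam by rewrite sqrtr_gt0; lra.
  have -> : 175 / 4 * u = 35 / 4 * u / Num.sqrt lam * (5 * Num.sqrt lam).
    by field; rewrite gt_eqF.
  apply: ler_wpM2l; last exact: sum_inv_sqrt_logratio_le.
  by apply: divr_ge0; [lra|exact: ltW].
have u12 : 0 <= 12 * u by lra.
have h2 : 12 * u * \sum_(k < N.-1) ((N - k)%:R * (N - k.+1)%:R)^-1 <= 12 * u.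
  by rewrite ler_piMr // sum_inv_pair.
move: S h1 h2 D2; lra.
Qed.

End parameter_bounds.

(** * Number of operator evaluations *)

Section cost.
Context {R : realType}.
Variables (L D sigma eps : R).
Hypothesis L0 : 0 < L.
Hypothesis D0 : 0 <= D.
Hypothesis s0 : 0 < sigma.
Hypothesis eps0 : 0 < eps.

Local Notation N := (horizon L D eps).
Local Notation rho := (tolerance L D eps).
Local Notation lam := (ln (expR 1 * N%:R : R)).

Let Ngt0 : (0 < N)%N. Proof. exact: leq_trans (horizon_ge2 _ _ _). Qed.
Let Nr : 0 < N%:R :> R. Proof. by rewrite ltr0n. Qed.
Let lam1 : 1 <= lam. Proof. exact: lam_ge1. Qed.

Lemma ln2_ge : 1 / 2 <= ln 2 :> R.
Proof.
have h : ln (1 + - (1 / 2)) <= - (1 / 2) :> R by apply: le_ln1Dx; lra.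
have e : 1 + - (1 / 2) = 2^-1 :> R by field.
by rewrite e lnV ?posrE // in h; lra.
Qed.

Lemma ln2_le : ln 2 <= 1 :> R.
Proof.
have -> : 2 = 1 + 1 :> R by [].
by apply: le_ln1Dx; apply: lt_trans (_ : 0 < _); rewrite ?ltrN10.
Qed.

(** Here 16/rho = 2^5 N^3, whose logarithm is at most 5 log(eN). The 2 pays for the ceiling and for
    the extra iteration. *)
Lemma inner_iters_le j :
  (inner_iters rho j).+1%:R <= 2 + 5 * lam / ln (j + 2)%:R.
Proof.
have j2 : 0 < ln (j + 2)%:R :> R by rewrite ln_gt0 // ltr1n addn2.
have rho0 : 0 < rho by have /andP[] := tolerance_bounds L D eps.
have e16 : 16 / rho = 2 ^+ 5 * N%:R ^+ 3.
  by rewrite /tolerance; field; rewrite gt_eqF.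
have l16 : ln (16 / rho) <= 5 * lam.
  have p5 : 2 ^+ 5 \is @Num.pos R by rewrite posrE exprn_gt0.
  have p3 : N%:R ^+ 3 \is @Num.pos R by rewrite posrE exprn_gt0.
  rewrite e16 (lnM p5 p3) (lnXn 5) // (lnXn 3) // -(mulr_natl _ 5) -(mulr_natl _ 3).
  rewrite (ln_eN Ngt0); have := ln2_le; have : 0 <= ln N%:R :> R by rewrite ln_ge0 // ler1n.
  lra.
have r0 : 0 <= ln (16 / rho) / ln (j + 2)%:R.
  rewrite divr_ge0 ?ln_ge0 //; last by rewrite ler1n addn2.
  rewrite ler_pdivlMr // mul1r; have /andP[_] := tolerance_bounds L D eps; lra.
rewrite -natr1; have := natr_ceil_le r0; rewrite -/(inner_iters rho j).
have : ln (16 / rho) / ln (j + 2)%:R <= 5 * lam / ln (j + 2)%:R.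
  by rewrite ler_pM2r // invr_gt0.
rewrite /inner_iters; lra.
Qed.

Lemma count_le_real (h : R) B : 0 <= h ->
  \sum_(j < B) ((j + 2)%:R < h :> R)%:R <= h :> R.
Proof.
move=> h0; elim: B => [|B ih]; first by rewrite big_ord0.
rewrite big_ord_recr/=; case: ltP => [Bh|_]; last by rewrite addr0.
apply: (@le_trans _ _ (B%:R + 1)).
  rewrite lerD2r; apply: (@le_trans _ _ (\sum_(j < B) 1)).
    by apply: ler_sum => j _; case: (_ < _).
  by rewrite sumr_const card_ord.
by apply: le_trans (ltW Bh); rewrite natrD lerD2l ler1n.
Qed.

(** Split at j + 2 = exp(t/2): beyond it each term is at most 2/t, and the fewer than exp(t/2)
    earlier terms are at most 1/log 2 <= 2. *)
Lemma sum_inv_ln_le (t : R) B : 1 <= t ->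
  \sum_(j < B) (ln (j + 2)%:R)^-1 <= 2 * B%:R / t + 2 * expR (t / 2).
Proof.
move=> t1; have l2 := ln2_ge.
apply: (@le_trans _ _ (\sum_(j < B) (2 / t + 2 * ((j + 2)%:R < expR (t / 2) :> R)%:R))).
  apply: ler_sum => j _; have j2 : 0 < ln (j + 2)%:R :> R by rewrite ln_gt0 // ltr1n addn2.
  case: ltP => h.
    have : (ln (j + 2)%:R)^-1 <= 2 :> R.
      rewrite -[leRHS]invrK lef_pV2 ?posrE //; apply: le_trans (_ : ln 2 <= _); first by lra.
      by rewrite ler_ln ?posrE ?ltr0n ?addn2 // ler_nat.
    have : 0 <= 2 / t by rewrite divr_ge0 //; lra.
    by rewrite mulr1; lra.
  rewrite mulr0 addr0 -[2 / t]invf_div lef_pV2 ?posrE //; last by rewrite divr_gt0 //; lra.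
  by rewrite -[leLHS]expRK ler_ln ?posrE ?expR_gt0 // ltr0n addn2.
rewrite big_split/= sumr_const card_ord -mulr_sumr -[_ *+ B]mulr_natl mulrA (mulrC _ 2).
rewrite lerD2l ler_wpM2l //; apply: count_le_real; exact: expR_ge0.
Qed.

(** Each term is sqrt(eN/(N-k)), and the sum of 1/sqrt(i) telescopes against 2 sqrt(i). *)
Lemma sum_exp_half_le : \sum_(k < N) expR (logratio N (N - k) / 2) <=
  2 * Num.sqrt (expR 1) * N%:R :> R.
Proof.
have term (k : 'I_N) : expR (logratio N (N - k) / 2) <=
   Num.sqrt (expR 1 * N%:R) * (2 * (Num.sqrt (N - k)%:R - Num.sqrt (N - k.+1)%:R)) :> R.
  have kN := ltn_ord k.
  have i0 : 0 < (N - k)%:R :> R by rewrite ltr0n subn_gt0.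
  have -> : expR (logratio N (N - k) / 2) = Num.sqrt (expR 1 * N%:R) / Num.sqrt (N - k)%:R :> R.
    rewrite -sqrtrV ?ltW // -sqrtrM; last by rewrite mulr_ge0 // expR_ge0.
    rewrite -[LHS]ger0_norm ?expR_ge0 // -sqrtr_sqr -expRM_natl.
    have -> : 2%:R * (logratio N (N - k) / 2) = logratio N (N - k) :> R by field.
    by rewrite /logratio lnK // posrE divr_gt0 // mulr_gt0 // expR_gt0.
  rewrite ler_wpM2l ?sqrtr_ge0 //.
  have -> : (N - k)%N = (N - k.+1).+1 by rewrite subnSK.
  move: (N - k.+1)%N => m.
  set a := Num.sqrt m.+1%:R; set b := Num.sqrt m%:R.
  have a0 : 0 < a by rewrite sqrtr_gt0.
  have a2 : a ^+ 2 = m%:R + 1 by rewrite sqr_sqrtr // natr1.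
  have b2 : b ^+ 2 = m%:R by rewrite sqr_sqrtr.
  rewrite -div1r ler_pdivrMr //.
  by have := sqr_ge0 (a - b); lra.
apply: le_trans (ler_sum _ (fun k _ => term k)) _; rewrite -mulr_sumr -mulr_sumr.
have tel m : (m <= N)%N -> \sum_(k < m) (Num.sqrt (N - k)%:R - Num.sqrt (N - k.+1)%:R) =
    Num.sqrt N%:R - Num.sqrt (N - m)%:R :> R.
  elim: m => [_|m ih mN]; first by rewrite big_ord0 subn0 subrr.
  by rewrite big_ord_recr/= ih ?(ltnW mN) // addrA subrK.
rewrite tel // subnn sqrtr0 subr0 sqrtrM ?expR_ge0 //.
have NN : Num.sqrt N%:R ^+ 2 = N%:R :> R by rewrite sqr_sqrtr.
by rewrite -[in leRHS]NN le_eqVlt; apply/orP; left; apply/eqP; ring.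
Qed.

Lemma sum_inv_sqrt_logratio_full :
  \sum_(k < N) ((N - k)%:R * Num.sqrt (logratio N (N - k)))^-1 <= 6 * Num.sqrt lam.
Proof.
have split_last (F : nat -> R) : \sum_(k < N) F k = \sum_(k < N.-1) F k + F N.-1.
  by move: Ngt0; case: (N) => // m _; rewrite big_ord_recr.
rewrite (split_last (fun k => ((N - k)%:R * Num.sqrt (logratio N (N - k)))^-1)).
have -> : (N - N.-1)%N = 1%N by lia.
have q1 : 1 <= Num.sqrt lam.
  by rewrite -[leLHS]sqrtr1 ler_sqrt //; apply: le_trans lam1.
have last : (1%:R * Num.sqrt (logratio N 1))^-1 <= Num.sqrt lam.
  rewrite logratio1 mul1r; apply: (le_trans _ q1).
  by rewrite invf_le1 //; apply: lt_le_trans q1.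
have first : \sum_(k < N.-1) ((N - k)%:R * Num.sqrt (logratio N (N - k)))^-1 <=
    5 * Num.sqrt lam.
  apply: le_trans (sum_inv_sqrt_logratio_le Ngt0); apply: ler_sum => k _.
  have kN1 : (k.+1 < N)%N by rewrite -ltn_predRL.
  have t1 : 1 <= logratio N (N - k) :> R.
    by apply: logratio_ge1 => //; rewrite subn_gt0 (ltnW kN1) leq_subr.
  have q0 : 0 < Num.sqrt (logratio N (N - k)) :> R by rewrite sqrtr_gt0; lra.
  rewrite lef_pV2 ?posrE ?mulr_gt0 ?ltr0n ?subn_gt0 ?(ltnW kN1) //.
  by rewrite ler_pM2r // ler_nat leq_sub2l.
lra.
Qed.

(** Splitting the inner sums at t = log(eN/(N-k)) makes the early terms add up to O(N) over k. It
    also divides the budget by t, which restores the summand 1 / (i sqrt t) of the error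
    analysis. *)
Lemma total_evals_le : (total_evals L D sigma eps)%:R <=
  (12 + 20 * Num.sqrt (expR 1)) * (lam * N%:R)
  + 12 * 6 * 1024 * (sigma ^+ 2 / eps ^+ 2 * lam ^+ 2).
Proof.
have l1 : 1 <= lam := lam1.
have S0 : 0 <= sigma ^+ 2 / eps ^+ 2 by apply: divr_ge0; exact: sqr_ge0.
have q0 : 0 <= Num.sqrt lam by exact: sqrtr_ge0.
have q2 : Num.sqrt lam ^+ 2 = lam by rewrite sqr_sqrtr //; lra.
have step (k : 'I_N) : (resolvent_evals (budget L D sigma eps k) rho)%:R <=
    12 * lam + 10 * lam * expR (logratio N (N - k) / 2) +
    12 * 1024 * (sigma ^+ 2 / eps ^+ 2) * (lam * Num.sqrt lam) *
      ((N - k)%:R * Num.sqrt (logratio N (N - k)))^-1 :> R.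
  have kN := ltn_ord k.
  have i0 : 0 < (N - k)%:R :> R by rewrite ltr0n subn_gt0.
  have t1 : 1 <= logratio N (N - k) :> R.
    by apply: logratio_ge1 => //; rewrite subn_gt0 kN leq_subr.
  have tl : logratio N (N - k) <= lam.
    rewrite (ln_eN Ngt0) logratioE ?subn_gt0 // lerBlDr lerDl.
    by rewrite ln_ge0 // ler1n subn_gt0.
  set t : R := logratio N (N - k) in t1 tl *.
  have tq : 0 < Num.sqrt t by rewrite sqrtr_gt0; lra.
  have t2 : Num.sqrt t ^+ 2 = t by rewrite sqr_sqrtr //; lra.
  rewrite /resolvent_evals natr_sum; set B := budget _ _ _ _ _.
  apply: (@le_trans _ _ (2 * B%:R + 5 * lam * \sum_(j < B) (ln (j + 2)%:R)^-1)).
    apply: (@le_trans _ _ (\sum_(j < B) (2 + 5 * lam / ln (j + 2)%:R))).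
      by apply: ler_sum => j _; exact: inner_iters_le.
    by rewrite big_split/= sumr_const card_ord -mulr_sumr -[_ *+ B]mulr_natl mulrC.
  have h := sum_inv_ln_le B t1.
  have lam5 : 0 <= 5 * lam by lra.
  have h1 := ler_wpM2l lam5 h.
  have Bt : B%:R <= lam * (B%:R / t).
    rewrite mulrA ler_pdivlMr; last by lra.
    by rewrite mulrC ler_wpM2r.
  have hB : B%:R <= 1 + budget_real L D sigma eps k by exact: budget_le.
  have hBt : lam * (B%:R / t) <= lam + lam * (budget_real L D sigma eps k / t).
    have l0 : 0 <= lam by lra.
    have -> : lam + lam * (budget_real L D sigma eps k / t) =
      lam * (1 + budget_real L D sigma eps k / t) by ring.
    apply: ler_wpM2l => //; rewrite ler_pdivrMr; last by lra.
    rewrite mulrDl mulrVK ?unitfE ?gt_eqF //; last by lra.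
    by apply: le_trans hB _; rewrite lerD2r mul1r.
  have e : lam * (budget_real L D sigma eps k / t) =
    1024 * (sigma ^+ 2 / eps ^+ 2) * (lam * Num.sqrt lam) * ((N - k)%:R * Num.sqrt t)^-1.
    rewrite /budget_real -/t sqrtrM; last by lra.
    have -> : t^-1 = (Num.sqrt t ^+ 2)^-1 by rewrite t2.
    move: (Num.sqrt lam) (Num.sqrt t) tq => a b b0.
    by field; rewrite !gt_eqF.
  rewrite e in hBt; lra.
rewrite /total_evals natr_sum; apply: le_trans (ler_sum _ (fun k _ => step k)) _.
rewrite !big_split/= -!mulr_sumr sumr_const card_ord -[_ *+ horizon _ _ _]mulr_natr.
have h1 := sum_exp_half_le; have h2 := sum_inv_sqrt_logratio_full.
have l10 : 0 <= 10 * lam by lra.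
have K0 : 0 <= 12 * 1024 * (sigma ^+ 2 / eps ^+ 2) * (lam * Num.sqrt lam).
  apply: mulr_ge0; last by apply: mulr_ge0 => //; lra.
  by apply: mulr_ge0 S0; apply: mulr_ge0; exact: ler0n.
have h1' := ler_wpM2l l10 h1; have h2' := ler_wpM2l K0 h2.
have e : 12 * 1024 * (sigma ^+ 2 / eps ^+ 2) * (lam * Num.sqrt lam) * (6 * Num.sqrt lam) =
  12 * 6 * 1024 * (sigma ^+ 2 / eps ^+ 2 * lam ^+ 2).
  transitivity (12 * 6 * 1024 * (sigma ^+ 2 / eps ^+ 2 * (lam * Num.sqrt lam ^+ 2))).
    by ring.
  by rewrite q2 -expr2.
rewrite e in h2'; lra.
Qed.

End cost.

(** C is chosen after a lower bound on LD/eps: the stated expression tends to 0 with this ratio when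
    sigma/eps is fixed, while the horizon stays at least 2. Above c0, log(eN) is at most A log(1 +
    LD/eps). *)
Lemma total_evals_bound (R : realType) (c0 : R) : 0 < c0 ->
  exists2 C : R, 0 < C & forall L D sigma eps : R,
    0 < L -> 0 < sigma -> 0 < eps -> 0 <= D -> c0 <= L * D / eps ->
    (total_evals L D sigma eps)%:R <=
      C * ((1 + L * D / eps) * ln (1 + L * D / eps)
            + sigma ^+ 2 / eps ^+ 2 * ln (1 + L * D / eps) ^+ 2).
Proof.
move=> c00; have lc : 0 < ln (1 + c0) by rewrite ln_gt0 // ltrDl.
pose A := 1 + (1 + ln 35) / ln (1 + c0).
have l35 : 0 <= ln 35 :> R by rewrite ln_ge0 // ler1n.
have A0 : 0 < A by rewrite /A; have : 0 <= (1 + ln 35) / ln (1 + c0); [rewrite divr_ge0 //; lra|lra].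
pose K := 12 + 20 * Num.sqrt (expR 1) : R.
have K0 : 0 < K by rewrite /K; have := sqrtr_ge0 (expR 1 : R); lra.
have [W W0 eW] : exists2 W : R, 0 < W & W = 12 * 6 * 1024.
  exists (12 * 6 * 1024); last reflexivity.
  by apply: mulr_gt0; [apply: mulr_gt0|]; rewrite ltr0n.
exists (35 * K * A + W * A ^+ 2).
  by rewrite addr_gt0 ?mulr_gt0 ?exprn_gt0.
move=> L D sigma eps L0 s0 eps0 D0 cx.
have := total_evals_le L0 D0 s0 eps0; rewrite -/K -eW.
set N := horizon L D eps; set x := L * D / eps.
have x0 : 0 <= x by apply: le_trans cx; exact: ltW.
have Nx : N%:R <= 35 * (1 + x).
  have e : 32 * L * D / eps = 32 * x by rewrite /x; ring.
  rewrite /N /horizon /maxn; case: ifP => _; last by lra.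
  have /natr_ceil_le : 0 <= 32 * L * D / eps by rewrite e mulr_ge0.
  by rewrite e; lra.
have N0 : (0 < N)%N by exact: leq_trans (horizon_ge2 _ _ _).
set l := ln (1 + x); have lx : ln (1 + c0) <= l.
  by rewrite ler_ln ?posrE; [rewrite lerD2l|lra|lra].
have l0 : 0 < l by lra.
have lamA : ln (expR 1 * N%:R) <= A * l.
  rewrite ln_eN //; have : ln N%:R <= ln 35 + l.
    rewrite -lnM ?posrE; [|lra|lra].
    by rewrite ler_ln ?posrE ?ltr0n //; lra.
  have : 1 + ln 35 <= (1 + ln 35) / ln (1 + c0) * l.
    rewrite mulrAC ler_pdivlMr // ler_wpM2l //; lra.
  rewrite /A; lra.
have lam1 : 1 <= ln (expR 1 * N%:R) :> R := lam_ge1 N0.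
move: (ln (expR 1 * N%:R)) lamA lam1 => lam lamA lam1 /le_trans; apply.
have S0 : 0 <= sigma ^+ 2 / eps ^+ 2 by apply: divr_ge0; exact: sqr_ge0.
move: (sigma ^+ 2 / eps ^+ 2) S0 => S S0.
have h1 : lam * N%:R <= (A * l) * (35 * (1 + x)) by apply: ler_pM => //; lra.
have h2 : lam ^+ 2 <= (A * l) ^+ 2 by rewrite ler_sqr ?nnegrE //; lra.
have h3 := ler_wpM2l (ltW K0) h1; have h4 := ler_wpM2l (ltW W0) (ler_wpM2l S0 h2).
apply: le_trans (lerD h3 h4) _.
have p1 : 0 <= 35 * K * A by rewrite !mulr_ge0 // ltW.
have p2 : 0 <= W * A ^+ 2 by rewrite mulr_ge0 ?sqr_ge0 // ltW.
have r1 : 0 <= (1 + x) * l by rewrite mulr_ge0 ?ltW //; lra.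
have r2 : 0 <= S * l ^+ 2 by rewrite mulr_ge0 ?sqr_ge0.
have := mulr_ge0 p1 r2; have := mulr_ge0 p2 r1.
lra.
Qed.

(** * The final output *)

Section regular_oracle.
Context {R : realType} {n : nat} {dO dX : measure_display}.
Context {Omega : measurableType dO} {Xi : measurableType dX}.
Variables (P : probability Omega R) (mu : probability Xi R).
Variables (F : 'rV[R]_n -> 'rV[R]_n) (G : 'rV[R]_n -> Xi -> 'rV[R]_n).
Variables (xstar x0 : 'rV[R]_n) (L D sigma eps : R) (xi : nat -> nat -> {RV P >-> Xi}).
Hypothesis F0 : F xstar = 0.
Hypothesis s0 : 0 < sigma.
Hypothesis L0 : 0 < L.
Hypothesis eps0 : 0 < eps.
Hypothesis mG : measurable_fun [set: 'rV[R]_n * Xi] (fun p => G p.1 p.2).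
Hypothesis meanG : forall x i, ('E_mu[fun z => G x z ord0 i] = (F x ord0 i)%:E)%E.
Hypothesis varG : forall x,
  ('E_mu[fun z => (enorm (G x z - F x) ^+ 2)%R] <= (sigma ^+ 2)%:E)%E.
Hypothesis mono : forall z, monotone_op (G ^~ z).
Hypothesis lips : forall z, lipschitz_op L (G ^~ z).
Hypothesis x0D : enorm (x0 - xstar) <= D.
Hypothesis law_xi : forall k j, drawn L D sigma eps (k, j) -> has_law P mu (xi k j).
Hypothesis indep : mutually_independent P (drawn L D sigma eps) (fun kj => xi kj.1 kj.2).

Local Notation N := (horizon L D eps).
Local Notation rho := (tolerance L D eps).
Local Notation alpha := (stepsize L).
Local Notation B := (budget L D sigma eps).
Local Notation c := (noise_level L D sigma eps).
Local Notation u := (unit_error L eps).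
Local Notation S := (@sample_space _ _ Xi (drawn L D sigma eps)).

Let D0 : 0 <= D. Proof. exact: le_trans (enorm_ge0 _) x0D. Qed.
Let Ngt0 : (0 < N)%N. Proof. exact: leq_trans (horizon_ge2 _ _ _). Qed.
Let alpha0 : 0 < alpha. Proof. by rewrite divr_gt0 // mulr_gt0. Qed.

Let Q : probability S R := sample_law (drawn L D sigma eps) (fun kj => xi kj.1 kj.2).
Let J := resolvent (fun x => alpha *: F x).
Let T k (s : S) x := approx_resolvent G (B k) rho alpha (@gamma_seq R) (fun j => s (k, j)) x.
Let th k (s : S) x := inner_drift G rho alpha (B k) (fun j => s (k, j)) x.
Let sp k (p : S * S) : S := splice (fun i => i.1 == k) p.1 p.2.

Lemma monotone_scaled (H : 'rV[R]_n -> 'rV[R]_n) :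
  monotone_op H -> monotone_op (fun x => alpha *: H x).
Proof. by move=> mH x y; rewrite -scalerBr edotZl mulr_ge0 // ltW. Qed.

Lemma lipschitz_scaled (H : 'rV[R]_n -> 'rV[R]_n) :
  lipschitz_op L H -> lipschitz_op (1 / 2) (fun x => alpha *: H x).
Proof.
move=> lH x y; rewrite -scalerBr enormZ gtr0_norm //.
have -> : 1 / 2 * enorm (x - y) = alpha * (L * enorm (x - y)).
  by rewrite /stepsize; field; rewrite gt_eqF.
by rewrite ler_pM2l.
Qed.

Let monoF := monotone_scaled (monotone_mean mG meanG varG mono).
Let lipsF := lipschitz_scaled (lipschitz_mean mG meanG varG lips).
Let mF := measurable_mean mG meanG.
Let monoG z := monotone_scaled (mono z).
Let lipsG z := lipschitz_scaled (lips z).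

Let law_coord i : drawn L D sigma eps i -> has_law Q mu (fun s : S => s i).
Proof. by case: i => k j kj A mA; exact: (law_xi kj). Qed.

Let drawn_block k : (k < N)%N -> forall j, (j < B k)%N -> drawn L D sigma eps (k, j).
Proof. by []. Qed.

Let rho_ge0 : 0 <= rho.
Proof. by have /andP[/ltW] := tolerance_bounds L D eps. Qed.

Let T_fresh k p x : (k < N)%N -> T k (sp k p) x = T k p.2 x.
Proof. by move=> _; apply: eq_approx_resolvent => j _; rewrite /sp /splice eqxx. Qed.

Let T_old k l p x : (l < N)%N -> l != k -> T l (sp k p) x = T l p.1 x.
Proof.
by move=> _ lk; apply: eq_approx_resolvent => j _; rewrite /sp /splice (negbTE lk).
Qed.

Let th_fresh k p x : (k < N)%N -> th k (sp k p) x = th k p.2 x.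
Proof. by move=> _; apply: eq_inner_drift => j _; rewrite /sp /splice eqxx. Qed.

Let th_old k l p x : (l < N)%N -> l != k -> th l (sp k p) x = th l p.1 x.
Proof.
by move=> _ lk; apply: eq_inner_drift => j _; rewrite /sp /splice (negbTE lk).
Qed.

Let mT k : (k < N)%N -> measurable_fun [set: S * 'rV[R]_n] (fun p => T k p.1 p.2).
Proof.
move=> kN; exact: (measurable_approx_resolvent _ _ mG (drawn_block kN) measurable_fst measurable_snd).
Qed.

Let mth k : (k < N)%N -> measurable_fun [set: S * 'rV[R]_n] (fun p => th k p.1 p.2).
Proof.
move=> kN; exact: (measurable_inner_drift _ _ mG (drawn_block kN) measurable_fst measurable_snd).
Qed.

Let T_mean k x v : (k < N)%N ->
  mean_le Q (fun s => enorm (T k s x - J v) ^+ 2)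
    ((1 + rho) * enorm (x - v) ^+ 2 + c k + 2 * rho * enorm (v - J v) ^+ 2).
Proof.
move=> kN; exact: (mean_le_resolvent mG meanG varG monoG lipsG (tolerance_bounds L D eps)
  (splice_law indep) law_coord lipsF x v (budget_gt0 _ _ _ _ k) (drawn_block kN)).
Qed.

Let th_mean k x : (k < N)%N ->
  mean_le Q (fun s => th k s x ^+ 2) (rho ^+ 2 / 256 * (enorm (x - xstar) ^+ 2 + c k)).
Proof.
move=> kN; have := mean_le_inner_drift mG meanG varG monoG lipsG (tolerance_bounds L D eps)
  (splice_law indep) law_coord F0 x (drawn_block kN).
apply: mean_leW; rewrite /noise_level.
have b0 : 0 < (B k).+1%:R :> R by rewrite ltr0n.
have -> : (rho / 32) ^+ 2 * (4 * (enorm (x - xstar) ^+ 2 + 5 * (alpha * sigma) ^+ 2)) / (B k).+1%:R =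
  rho ^+ 2 / 256 * (enorm (x - xstar) ^+ 2 / (B k).+1%:R + 5 * (alpha * sigma) ^+ 2 / (B k).+1%:R).
  by field; rewrite gt_eqF.
apply: ler_wpM2l; first by apply: divr_ge0; [exact: sqr_ge0|exact: ler0n].
by rewrite lerD2r ler_pdivrMr // ler_peMr ?sqr_ge0 // ler1n.
Qed.

Lemma mean_le_final_output_regular :
  mean_le Q (fun s => enorm (F (outer_z N x0 (T ^~ s) N)) ^+ 2) (eps ^+ 2).
Proof.
have kappa0 : 0 <= rho ^+ 2 / 256 by apply: divr_ge0; [exact: sqr_ge0|exact: ler0n].
have Jx : J xstar = xstar.
  by apply: resolvent_zero => //; rewrite F0 scaler0.
have firm v : 0 <= edot (v - J v) (J v - xstar).
  by apply: resolvent_firm => //; rewrite F0 scaler0.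
have resid v : enorm (v - J v) <= enorm (v - xstar).
  by apply: resolvent_residual_le => //; rewrite F0 scaler0.
have mJ : measurable_fun setT J.
  by apply: measurable_resolvent => //; exact: measurable_rVZ.
have msp k : measurable_fun setT (sp k) by exact: measurable_splice.
have law_sp k : has_law (Q \x Q)%E Q (sp k) by exact: splice_law.
have T_dist k s x y : (k < N)%N ->
    enorm (T k s x - T k s y) <= enorm (x - y) + th k s x + th k s y.
  move=> _; apply: approx_resolvent_dist => //.
  by have /andP[-> h] := tolerance_bounds L D eps; lra.
have th0 k s x : 0 <= th k s x by exact: inner_drift_ge0.
have res := mean_le_outer_residual msp law_sp mT mth T_fresh T_old th_fresh th_old th0
  T_dist T_mean th_mean mJ (resolvent_nonexpansive lipsF monoF) Jx firm resid x0D
  rho_ge0 (noise_level_ge0 L D sigma eps) kappa0 Ngt0.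
have N1 : (N.-1 < N)%N by rewrite prednK.
have [_ mZ] := measurable_outer x0 mT (leqnn N).
(* v is determined before the samples of step N - 1 are drawn, so the direct error bound of one call
   applies. *)
have last := mean_le_step_error msp law_sp mT T_fresh T_old T_mean mJ Jx resid x0D
  rho_ge0 (noise_level_ge0 L D sigma eps) N1.
rewrite prednK // in last.
have {}res := mean_leW (residual_bound_le sigma L0 D0 eps0) res.
have {}last : mean_le Q (fun s => enorm (outer_z N x0 (T ^~ s) N -
    J (outer_x N x0 (T ^~ s) N.-1)) ^+ 2) (3 * u).
  apply: mean_leW last; apply: le_trans (last_step_error_le L0 D0 s0 eps0).
  rewrite lerD2l; apply: ler_wpM2l; first by apply: mulr_ge0; [exact: ler0n|].
  by apply: moment_le; [|exact: noise_level_ge0|exact: leq_pred].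
have L2 : 0 <= L ^+ 2 by exact: sqr_ge0.
have u0 : 0 <= u by apply: ltW; exact: unit_error_gt0.
have epsu : eps ^+ 2 = 1024 * (L ^+ 2 * u).
  by rewrite /unit_error; field; rewrite gt_eqF.
have Lu : 0 <= L ^+ 2 * u by exact: mulr_ge0.
have fL0 : 0 <= 4 * L ^+ 2 by apply: mulr_ge0; [exact: ler0n|].
have sum := mean_leZ (ler0n R 2) (mean_leD (mean_leZ fL0 res) (mean_leZ L2 last)).
(* 2 (4 * 116 + 3) = 934 <= 1024. *)
have le_eps : 2 * (4 * L ^+ 2 * (116 * u) + L ^+ 2 * (3 * u)) <= eps ^+ 2.
  by rewrite epsu; lra.
apply: mean_le_trans (mean_leW le_eps sum).
  by apply: measurable_enorm_sqr; exact: measurableT_comp mF mZ.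
move=> s; rewrite sqr_ge0 /=.
set v := outer_x _ _ _ _; set y := outer_z _ _ _ _.
(* The resolvent equation reads v - J v = alpha F(J v) with alpha = 1/(2L), so the squared residual
   times 4 L^2 is |F(J v)|^2. *)
have Ft : enorm (v - J v) ^+ 2 = alpha ^+ 2 * enorm (F (J v)) ^+ 2.
  rewrite -exprMn -{1}(resolventK lipsF v) -/J addrAC subrr add0r enormZ.
  by rewrite gtr0_norm.
have -> : 4 * L ^+ 2 * enorm (v - J v) ^+ 2 = enorm (F (J v)) ^+ 2.
  by rewrite Ft /stepsize; field; rewrite gt_eqF.
have yt : enorm (F y - F (J v)) ^+ 2 <= L ^+ 2 * enorm (y - J v) ^+ 2.
  rewrite -exprMn ler_sqr ?nnegrE ?enorm_ge0 //; first exact: (lipschitz_mean mG meanG varG lips).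
  by rewrite mulr_ge0 ?enorm_ge0 // ltW.
have := enormD_sqr_le (F (J v)) (F y - F (J v)); rewrite addrC subrK.
by move=> h; apply: le_trans h _; rewrite ler_pM2l // lerD2l.
Qed.

End regular_oracle.

Lemma ae_eq_expectation (R : realType) d (T : measurableType d) (P : probability T R)
    (f g : T -> R) : measurable_fun setT f -> measurable_fun setT g ->
  (\forall x \ae P, f x = g x) -> ('E_P[f] = 'E_P[g])%E.
Proof.
move=> mf mg fg; rewrite expectation.unlock.
apply: ae_eq_integral => //; [exact/measurable_EFinP..|].
by apply: filterS fg => x -> _.
Qed.

Lemma eq_approx_resolvent_oracle (R : realType) (n : nat) (Xi : Type)
    (G G' : 'rV[R]_n -> Xi -> 'rV[R]_n) B rho alpha (gamma : nat -> R) (z : nat -> Xi) u :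
  (forall j, (j < B)%N -> G ^~ (z j) =1 G' ^~ (z j)) ->
  approx_resolvent G B rho alpha gamma z u = approx_resolvent G' B rho alpha gamma z u.
Proof.
elim: B => [//|B ih] GG; rewrite [LHS]/= [RHS]/= ih => [|j jB]; last first.
  by apply: GG; exact: ltnW.
rewrite /inner_step; apply: eq_iter => q.
by congr (_ - _ *: _); exact: GG.
Qed.

Lemma measurable_final_output (R : realType) (n : nat) dO dX (Omega : measurableType dO)
    (Xi : measurableType dX) (P : probability Omega R) (G : 'rV[R]_n -> Xi -> 'rV[R]_n)
    (x0 : 'rV[R]_n) (L D sigma eps : R) (xi : nat -> nat -> {RV P >-> Xi}) :
  measurable_fun [set: 'rV[R]_n * Xi] (fun p => G p.1 p.2) ->
  measurable_fun setT (fun w => final_output L D sigma eps G x0 (fun k j => xi k j w)).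
Proof.
move=> mG; pose N := horizon L D eps.
pose s (w : Omega) : sample_space (drawn L D sigma eps) := fun kj => xi kj.1 kj.2 w.
have ms : measurable_fun setT s.
  by apply/measurable_fun_sampleP => kj _; exact: measurable_funPT.
pose T k w := approx_resolvent G (budget L D sigma eps k) (tolerance L D eps)
  (stepsize L) (@gamma_seq R) (fun j => s w (k, j)).
have mT k : (k < N)%N -> measurable_fun [set: Omega * 'rV[R]_n] (fun p => T k p.1 p.2).
  move=> kN.
  have kj j : (j < budget L D sigma eps k)%N -> drawn L D sigma eps (k, j) by [].
  exact: (measurable_approx_resolvent _ _ mG kj (measurableT_comp ms measurable_fst)
    measurable_snd).
by have [_] := measurable_outer x0 mT (leqnn N).
Qed.

(** One null set serves all points x at once. On it the oracle becomes the zero operator, which is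
    monotone and L-Lipschitz, and no mean changes. *)
Lemma modify_null_oracle (R : realType) (n : nat) dX (Xi : measurableType dX)
    (mu : probability Xi R) (F : 'rV[R]_n -> 'rV[R]_n) (G : 'rV[R]_n -> Xi -> 'rV[R]_n)
    (L sigma : R) : 0 <= L ->
  measurable_fun [set: 'rV[R]_n * Xi] (fun p => G p.1 p.2) ->
  (forall x i, ('E_mu[fun z => G x z ord0 i] = (F x ord0 i)%:E)%E) ->
  (forall x, ('E_mu[fun z => (enorm (G x z - F x) ^+ 2)%R] <= (sigma ^+ 2)%:E)%E) ->
  {ae mu, forall z, monotone_op (G ^~ z) /\ lipschitz_op L (G ^~ z)} ->
  exists A G', [/\ measurable A /\ mu A = 0%E,
    forall x z, ~ A z -> G x z = G' x z,
    measurable_fun [set: 'rV[R]_n * Xi] (fun p => G' p.1 p.2),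
    (forall x i, ('E_mu[fun z => G' x z ord0 i] = (F x ord0 i)%:E)%E) /\
    (forall x, ('E_mu[fun z => (enorm (G' x z - F x) ^+ 2)%R] <= (sigma ^+ 2)%:E)%E) &
    (forall z, monotone_op (G' ^~ z)) /\ (forall z, lipschitz_op L (G' ^~ z))].
Proof.
move=> L0 mG meanG varG [A [mA A0 badA]].
pose G' x z := (\1_(~` A) z : R) *: G x z.
have GG' x z : ~ A z -> G x z = G' x z.
  by move=> nAz; rewrite /G' indicE mem_set // scale1r.
have G'0 x z : A z -> G' x z = 0.
  by move=> Az; rewrite /G' indicE memNset ?scale0r //; apply.
have mG' : measurable_fun [set: 'rV[R]_n * Xi] (fun p => G' p.1 p.2).
  apply/measurable_fun_rVP => i; under eq_fun do rewrite mxE.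
  apply: measurable_funM; last by move: i; apply/measurable_fun_rVP.
  have mi : measurable_fun setT (\1_(~` A) : Xi -> R).
    exact: measurable_indic (measurableC mA).
  exact: (measurableT_comp mi measurable_snd).
have aeG x : \forall z \ae mu, G' x z = G x z.
  by exists A; split => // z /= h; apply: contrapT => /(GG' x) e; apply: h.
have good z : ~ A z -> monotone_op (G ^~ z) /\ lipschitz_op L (G ^~ z).
  by move=> nA; apply: contrapT => h; apply: nA; exact: badA.
have off z : A z -> G' ^~ z = fun=> 0 by move=> Az; apply/funext => x; exact: G'0.
have on z : ~ A z -> G' ^~ z = G ^~ z by move=> Az; apply/funext => x; exact/esym/GG'.
exists A, G'; split => //.
- split=> [x i|x].
  + rewrite -meanG; apply: ae_eq_expectation.
    * by move: i; apply/measurable_fun_rVP; exact: measurable_oracle2.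
    * by move: i; apply/measurable_fun_rVP; exact: measurable_oracle2.
    * by apply: filterS (aeG x) => z ->.
  + apply: le_trans (varG x); rewrite le_eqVlt; apply/orP; left; apply/eqP.
    apply: ae_eq_expectation.
    * by apply: measurable_enorm_sqr; apply: measurable_rVB => //; exact: measurable_oracle2.
    * by apply: measurable_enorm_sqr; apply: measurable_rVB => //; exact: measurable_oracle2.
    * by apply: filterS (aeG x) => z ->.
- split=> z; have [Az|nAz] := pselect (A z).
  + by rewrite off // => x y; rewrite subrr /edot big1 // => i _; rewrite mxE mul0r.
  + by rewrite on //; case: (good z nAz).
  + by rewrite off // => x y; rewrite subrr enorm0 mulr_ge0 ?enorm_ge0.
  + by rewrite on //; case: (good z nAz).
Qed.

Theorem corollary3p6 (R : realType) (c0 : R) (c0_gt0 : 0 < c0) :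
  exists2 C : R, 0 < C &
  forall (n : nat) (dO dX : measure_display)
    (Omega : measurableType dO) (Xi : measurableType dX)
    (P : probability Omega R) (mu : probability Xi R)
    (F : 'rV[R]_n -> 'rV[R]_n) (G : 'rV[R]_n -> Xi -> 'rV[R]_n)
    (xstar x0 : 'rV[R]_n) (L D sigma eps : R)
    (xi : nat -> nat -> {RV P >-> Xi}),
    F xstar = 0 ->
    0 < sigma -> 0 < L -> 0 < eps ->
    measurable_fun [set: 'rV[R]_n * Xi] (fun p => G p.1 p.2) ->
    (forall x i, ('E_mu[fun z => G x z ord0 i] = (F x ord0 i)%:E)%E) ->
    (forall x, ('E_mu[fun z => (enorm (G x z - F x) ^+ 2)%R]
                 <= (sigma ^+ 2)%:E)%E) ->
    {ae mu, forall z, monotone_op (G ^~ z) /\ lipschitz_op L (G ^~ z)} ->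
    enorm (x0 - xstar) <= D ->
    (forall k j, drawn L D sigma eps (k, j) -> has_law P mu (xi k j)) ->
    mutually_independent P (drawn L D sigma eps) (fun kj => xi kj.1 kj.2) ->
    ('E_P[fun w => (enorm (F (final_output L D sigma eps G x0
                                (fun k j => xi k j w))) ^+ 2)%R]
       <= (eps ^+ 2)%:E)%E /\
    (c0 <= L * D / eps ->
     (total_evals L D sigma eps)%:R <=
       C * ((1 + L * D / eps) * ln (1 + L * D / eps)
            + sigma ^+ 2 / eps ^+ 2 * ln (1 + L * D / eps) ^+ 2)).
Proof.
have [C C0 evals] := total_evals_bound c0_gt0.
exists C => // n dO dX Omega Xi P mu F G xstar x0 L D sigma eps xi F0 s0 L0 eps0 mG
  meanG varG aeG x0D law_xi indep.
split; last by apply: evals => //; exact: le_trans (enorm_ge0 _) x0D.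
have [A [G' [[mA A0] GG' mG' [meanG' varG'] [mono' lips']]]] :=
  modify_null_oracle (ltW L0) mG meanG varG aeG.
have mF := measurable_mean mG meanG.
pose good w := forall k j, drawn L D sigma eps (k, j) -> ~ A (xi k j w).
(* Countably many null events, one for each drawn index. *)
have aegood : \forall w \ae P, good w.
  apply: ae_foralln => k; apply: ae_foralln => j.
  have [kj|nkj] := pselect (drawn L D sigma eps (k, j)); last by apply: aeW => w /nkj.
  exists (xi k j @^-1` A); split.
  - by rewrite -[X in measurable X]setTI; exact: measurable_funPT.
  - exact: etrans (law_xi k j kj A mA) A0.
  - by move=> w /= h; apply: contrapT => nA; apply: h.
have eqG w : good w -> final_output L D sigma eps G x0 (fun k j => xi k j w) =
    final_output L D sigma eps G' x0 (fun k j => xi k j w).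
  move=> gw; rewrite /final_output; congr snd; apply: eq_outer_iter => k kN x.
  by apply: eq_approx_resolvent_oracle => j jB y; apply: GG'; exact: gw.
have mfin H (mH : measurable_fun [set: 'rV[R]_n * Xi] (fun p => H p.1 p.2)) :
    measurable_fun setT (fun w =>
      enorm (F (final_output L D sigma eps H x0 (fun k j => xi k j w))) ^+ 2).
  apply: measurable_enorm_sqr; apply: (measurableT_comp mF).
  exact: measurable_final_output.
rewrite (ae_eq_expectation (mfin G mG) (mfin G' mG')); last first.
  by apply: filterS aegood => w /eqG ->.
pose X kj := xi kj.1 kj.2.
(* The bound on path space is pulled back to P along the path of actual samples. *)
have [_ _] := mean_le_law (@measurable_sample_path _ _ _ _ _ _ P _ X) (sample_path_law X)
  (mean_le_final_output_regular F0 s0 L0 eps0 mG' meanG' varG' mono' lips' x0D law_xi indep).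
by [].
Qed.
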